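(* Let $\alpha>0$, $\nu>0$, $\lambda>0$, and let $X^{BT}(t)=\int_{-\infty}^te^{-\lambda(t-\tau)}\,dB_{\alpha,\nu}(\lambda\tau)$ be the strictly stationary solution of $dX(t)=-\lambda X(t)\,dt+dB_{\alpha,\nu}(\lambda t)$, where $B_{\alpha,\nu}$ is the Bell-Touchard process (extended to a two-sided Lévy process). Then $$\{X^{BT}(t),t\ge0\}\overset{\text{fdd}}{=}\Big\{\sum_{j=1}^\infty X_{\theta_j,j}(t),t\ge0\Big\},$$ where $X_{\theta_j,j}$, $j\ge1$, are independent DOU processes with parameters $\theta_j=\frac{\alpha\nu^j}{j!}$, $a_j=j$ and the same $\lambda$. Moreover $\mathbb{E}X^{BT}(t)=\alpha\nu e^{\nu}$ and $\mathrm{Cov}(X^{BT}(t),X^{BT}(t+\tau))=\frac{\alpha e^{\nu}}{2}\nu(\nu+1)e^{-\lambda\tau}$ for $\tau\ge0$.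
   Context: The Bell-Touchard process with parameters $\alpha,\nu>0$ is the compound Poisson process $B_{\alpha,\nu}(t)=\sum_{i=1}^{N(t)}Y_i$ (empty sum $=0$), where $N$ is a homogeneous Poisson process with rate $\alpha(e^\nu-1)$ and $Y_i$ are i.i.d., independent of $N$, with $\mathbb{P}(Y_i=n)=\frac{1}{e^\nu-1}\frac{\nu^n}{n!}$, $n=1,2,\dots$. A DOU process with parameters $\theta,a>0$ and mean-reverting parameter $\lambda>0$ is $X(t)=\int_{-\infty}^te^{-\lambda(t-\tau)}\,dN_{\theta,a}(\lambda\tau)$, where $N_{\theta,a}(t)=aN(t)$ with $N$ a homogeneous Poisson process of rate $\theta$ extended to a two-sided Lévy process. $\overset{\text{fdd}}{=}$ denotes equality of all finite-dimensional distributions. *)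

(* Defs.v *)
From HB Require Import structures.
From mathcomp Require Import all_boot all_order all_algebra.
From mathcomp Require Import all_classical all_reals all_analysis.
Set Implicit Arguments. Unset Strict Implicit. Unset Printing Implicit Defensive.
Import Order.TTheory GRing.Theory Num.Theory.
Import numFieldNormedType.Exports.
Local Open Scope classical_set_scope.
Local Open Scope ring_scope.

Definition sigma_gen {d} {T : measurableType d} {R : realType} {K : Type}
  (X : K -> T -> R) : set (set T) :=
  <<s [set A | exists k (B : set R), measurable B /\ A = X k @^-1` B] >>.

Definition mutual_indep {d} {T : measurableType d} {R : realType} {I : eqType}
  (P : probability T R) (F : I -> set (set T)) : Prop :=
  forall (J : seq I) (E : I -> set T), uniq J ->
    (forall i, i \in J -> F i (E i)) ->
    P (\bigcap_(i in [set i | i \in J]) E i) = (\prod_(i <- J) P (E i))%E.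

Definition poisson_process {d} {T : measurableType d} {R : realType}
  (P : probability T R) (r : R) (N : T -> R -> R) : Prop :=
  (forall t, measurable_fun setT (fun w => N w t)) /\
      (forall w, N w 0 = 0) /\
      (forall w t, 0 <= t -> exists k : nat, N w t = k%:R) /\
      (forall w s t, 0 <= s -> s <= t -> N w s <= N w t) /\
      (forall w t, 0 <= t -> N w x @[x --> t^'+] --> N w t) /\
      (forall tt : nat -> R, 0 <= tt 0%N -> (forall k, tt k <= tt k.+1) ->
         mutual_indep P (fun k : nat =>
           sigma_gen (fun _ : unit => fun w => N w (tt k.+1) - N w (tt k)))) /\
      (forall s t (k : nat), 0 <= s -> s <= t ->
         P [set w | N w t - N w s = k%:R] =
         (expR (- (r * (t - s))) * (r * (t - s)) ^+ k / k`!%:R)%:E).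

Definition cp_path {R : realType} (n : R -> R) (y : nat -> R) (t : R) : R :=
  \sum_(i < Num.truncn (n t)) y i.

(* two-sided extension of a Levy path: L(t) for t >= 0 and -L'((-t)-) for
   t < 0, with L' an independent copy *)
Definition twosided {R : realType} (L L' : R -> R) (t : R) : R :=
  if 0 <= t then L t else - lim (L' x @[x --> (- t)^'-]).

Definition jump {R : realType} (b : R -> R) (s : R) : R :=
  b s - lim (b x @[x --> s^'-]).

(* pathwise (Stieltjes) integral  int_{-oo}^t e^{-lam (t - tau)} db(lam tau)
   for a pure-jump path b with locally finitely many jumps:
   sum over jump points s = lam tau <= lam t of e^{s - lam t} (Delta b)(s),
   as the limit of the sums over s in [-n, lam t]. *)
Definition ou_integral {R : realType} (lam t : R) (b : R -> R) : R :=
  limn (fun n : nat =>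
    \sum_(s \in [set s | - n%:R <= s <= lam * t /\ jump b s != 0]) 
      expR (s - lam * t) * jump b s).

Definition XBT {T : Type} {R : realType} (lam : R)
  (N : bool -> T -> R -> R) (Y : bool -> nat -> T -> R) (t : R) (w : T) : R :=
  ou_integral lam t
    (twosided (cp_path (N true w) (fun i => Y true i w))
              (cp_path (N false w) (fun i => Y false i w))).

Definition DOU {T : Type} {R : realType} (lam a : R)
  (M : bool -> T -> R -> R) (t : R) (w : T) : R :=
  ou_integral lam t (twosided (fun s => a * M true w s) (fun s => a * M false w s)).

(* equality of finite-dimensional distributions on t >= 0 (on products of
   Borel sets, which determine the joint laws) *)
Definition fdd_eq {d d'} {T : measurableType d} {T' : measurableType d'}
  {R : realType} (P : probability T R) (P' : probability T' R)
  (X : R -> T -> R) (Z : R -> T' -> R) : Prop :=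
  forall (n : nat) (t : 'I_n -> R) (A : 'I_n -> set R),
    (forall i, 0 <= t i) -> (forall i, measurable (A i)) ->
    P [set w | forall i, A i (X (t i) w)] = P' [set w | forall i, A i (Z (t i) w)].

(* Main.v *)
Require Import Defs.
From HB Require Import structures.
From mathcomp Require Import all_boot all_order all_algebra.
From mathcomp Require Import finmap.
From mathcomp Require Import all_classical all_reals all_analysis.
From mathcomp Require Import measurable_realfun ring lra.
Import Order.TTheory GRing.Theory Num.Theory.
Import numFieldNormedType.Exports.
Local Open Scope classical_set_scope.
Local Open Scope ring_scope.
Set Implicit Arguments.
Unset Strict Implicit.
Unset Printing Implicit Defensive.

(** Both sides are limits of linear functionals of step paths with independent increments, so they are compared through
    joint Laplace transforms.  If [tau_i] are the arrival times and [Y_i] the jumps, the stationary solution is the shot noise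
    [sum_i h_t(tau_i) Y_i], where [h_t] is an exponential kernel; since [h_t] is left continuous, this is a limit of sums
    [sum_k h_t(k/2^m) (L((k+1)/2^m) - L(k/2^m))], valid on every sample path.  The increments have Laplace exponent
    [alpha (e^nu - exp (nu e^-x)) = sum_j theta_j (1 - e^(-j x))], which is the exponent of a superposition of independent
    Poisson processes [j N_(theta_j)]; the error after truncation at [J] is at most [x * sum_(j > J) j theta_j], uniformly in the mesh.
    A vector with nonnegative coordinates is determined by its joint Laplace transform, because
    [(1 - e^(-n x))^N] with [N] of order [n e^(n a)] tends to the indicator of [x > a].
    The first two moments of the increments are read off the Laplace exponent at [0], and the moments of the process follow
    from geometric Riemann sums. *)

(** * Paths of pure jump type *)

(** Real exponentials of nonnegative variables keep every integrand in [0, 1], so each passage to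
    the limit in the transforms is bounded convergence. The limits are taken in a fixed order: mesh,
    then time horizon [n], then number of components [J]. The estimate between the two sides is
    proved at a finite mesh with a bound free of mesh and horizon, so it survives the first two
    limits and vanishes in the third. Two obstacles shape the proof. The jumps are independent of
    the counting processes, but the number of jumps in a cell is random; in place of conditioning,
    the event of bounded counts is cut into finitely many pieces on which the jumps sit in fixed
    blocks. And the jumps are positive only almost surely, while path values are prescribed
    everywhere; so measurability is proved for the signed jumps and all law computations are done
    for their absolute values. Moments involve unbounded functions. They are recovered from
    transforms through (1 - e^(-s x)) / s as s tends to 0, first for one increment over a grid cell,
    then for the shot noise. *)

Definition counting {R : realType} (nu : R -> nat) :=
  [/\ nu 0 = 0%N,
      (forall s t, 0 <= s -> s <= t -> (nu s <= nu t)%N) &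
      (forall s, 0 <= s -> exists2 e, 0 < e & forall x, s <= x -> x < s + e -> nu x = nu s)].

(** Jump times are counted with multiplicity: a jump of height r is shared by r consecutive indices.
    If level [i] is never exceeded the infimum is a default value, whence the witness [q] with
    [(i < nu q)%N] in the lemmas below. *)
Definition arrival {R : realType} (nu : R -> nat) (i : nat) : R :=
  inf [set s | 0 <= s /\ (i < nu s)%N].

Section pathwise.
Context {R : realType}.
Implicit Types (nu : R -> nat) (g : nat -> R) (L b h : R -> R).

(** Local constancy to the right makes the infimum attained: some point of the defining set lies
    below [x + e], where the path still has its value at [x]. *)
Lemma arrival_le nu i q x : counting nu -> 0 <= q -> (i < nu q)%N -> 0 <= x ->
  (i < nu x)%N = (arrival nu i <= x).
Proof.
move=> [nu0 numono nucst] q0 iq x0.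
set S := [set s | 0 <= s /\ (i < nu s)%N].
have Sne : S !=set0 by exists q.
have Slb : has_lbound S by exists 0 => s [].
have hS : has_inf S by split.
apply/idP/idP => [ix|].
  by apply: ge_inf => //.
move=> lex; have [e e0 he] := nucst x x0.
have [s [s0 si] slt] := inf_adherent e0 hS.
have sltx : s < x + e by apply: (lt_le_trans slt); rewrite lerD2r.
have [xs|sx] := leP x s; first by rewrite -(he s).
by apply: (leq_trans si); apply: numono => //; exact: ltW.
Qed.

Lemma arrival_gt0 nu i q : counting nu -> 0 <= q -> (i < nu q)%N -> 0 < arrival nu i.
Proof.
move=> cnu q0 iq; rewrite ltNge -(arrival_le cnu q0 iq (lexx _)).
by case: cnu => ->.
Qed.

(** The left limit is the largest value taken on [0, s). It exists since values there are bounded by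
    [nu s], and by monotonicity the path keeps that value from the point where it is reached until
    [s]. *)
Lemma left_count nu s : counting nu -> 0 < s ->
  exists k : nat, [/\ (k <= nu s)%N,
    exists2 e, 0 < e <= s & (forall x, s - e <= x -> x < s -> nu x = k) &
    forall i q, 0 <= q -> (i < nu q)%N -> (i < k)%N = (arrival nu i < s)].
Proof.
move=> cnu s0; have [nu0 numono nucst] := cnu.
pose p := [pred k | `[< exists2 x, 0 <= x < s & nu x = k >]].
have pex : exists k, p k.
  by exists 0%N; apply/asboolP; exists 0 => //; rewrite lexx.
have pub k : p k -> (k <= nu s)%N.
  by move=> /asboolP[x /andP[x0 xs] <-]; apply: numono => //; exact: ltW.
case: (ex_maxnP pex pub) => k pk kmax.
have /asboolP[x0 /andP[x00 x0s] x0k] := pk.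
have hx x : x0 <= x -> x < s -> nu x = k.
  move=> x0x xs; apply/eqP; rewrite eqn_leq -{2}x0k numono // andbT.
  by apply: kmax; apply/asboolP; exists x => //; rewrite xs (le_trans x00).
exists k; split; first exact: pub.
  exists (s - x0); first by rewrite subr_gt0 x0s gerBl.
  by move=> x; rewrite subKr; exact: hx.
move=> i q q0 iq; apply/idP/idP => [ik|ai].
  apply: le_lt_trans x0s; rewrite -(arrival_le cnu q0 iq x00).
  by rewrite x0k.
pose y := Num.max (arrival nu i) x0.
have y0 : 0 <= y by rewrite le_max x00 orbT.
have ys : y < s by rewrite gt_max ai x0s.
rewrite -(hx y) ?le_max ?lexx ?orbT//.
by rewrite (arrival_le cnu q0 iq y0) le_max lexx.
Qed.

Lemma lim_at_left_cst (f : R -> R) s c e : 0 < e ->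
  (forall x, s - e < x -> x < s -> f x = c) -> lim (f x @[x --> s^'-]) = c.
Proof.
move=> e0 fc; apply: cvg_lim => //; apply: cvg_near_cst.
near=> x; apply: fc.
- by near: x; apply: nbhs_left_gt; rewrite gtrBl.
- by near: x; exact: nbhs_left_lt.
Unshelve. all: by end_near. Qed.

(** Telescoping with indicators over a range [Q] that does not depend on [a], so that path values at
    two times can be subtracted term by term. *)
Lemma count_sum g (Q a : nat) : (a <= Q)%N ->
  \sum_(i < Q) (i < a)%:R * (g i.+1 - g i) = g a - g 0%N :> R.
Proof.
move=> aQ; rewrite -(@telescope_sumr _ 0 a g) // big_mkord.
rewrite (big_ord_widen_cond _ (fun=> true) (fun i => g i.+1 - g i) aQ) /=.
rewrite [RHS]big_mkcond /=; apply: eq_bigr => i _.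
by case: ifP; rewrite ?mul1r ?mul0r.
Qed.

Section twosided_jump.
Variables (nu nu' : R -> nat) (g g' : nat -> R) (L L' : R -> R).
Hypotheses (cnu : counting nu) (cnu' : counting nu').
Hypotheses (g0 : g 0%N = 0) (g'0 : g' 0%N = 0).
Hypotheses (HL : forall x, 0 <= x -> L x = g (nu x))
  (HL' : forall x, 0 <= x -> L' x = g' (nu' x)).

Let left_lim (s : R) k e : 0 < e <= s -> (forall x, s - e <= x -> x < s -> nu' x = k) ->
  lim (L' x @[x --> s^'-]) = g' k.
Proof.
move=> /andP[e0 es] he; apply: (lim_at_left_cst e0) => x x1 x2.
rewrite HL' ?(he x) ?(ltW x1)//.
by apply: le_trans (ltW x1); rewrite subr_ge0.
Qed.

Lemma jump_twosided_gt0 s : 0 < s -> exists k : nat, [/\ (k <= nu s)%N,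
  jump (twosided L L') s = g (nu s) - g k &
  forall i q, 0 <= q -> (i < nu q)%N -> (i < k)%N = (arrival nu i < s)].
Proof.
move=> s0; have [k [ks [e /andP[e0 es] he] ik]] := left_count cnu s0.
exists k; split => //; rewrite /jump {1}/twosided (ltW s0) (HL (ltW s0)).
congr (_ - _); apply: (lim_at_left_cst e0) => x x1 x2.
have x0 : 0 <= x by apply: le_trans (ltW x1); rewrite subr_ge0.
by rewrite /twosided x0 HL // he // ltW.
Qed.

(** Gluing creates no jump at the origin: just before 0 the path is minus a left limit of [L'] near
    0, where [L'] still equals [g' 0%N = 0]. *)
Lemma jump_twosided0 : jump (twosided L L') 0 = 0.
Proof.
rewrite /jump {1}/twosided lexx HL // (let: And3 h _ _ := cnu in h) g0 sub0r.
have [nu'0 nu'm nu'c] := cnu'.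
have [e e0 he] := nu'c 0 (lexx 0).
rewrite (@lim_at_left_cst _ _ 0 e) ?oppr0//.
move=> x; rewrite sub0r => x1 x2; rewrite /twosided leNgt x2 /=.
have nx0 : 0 < - x by rewrite oppr_gt0.
rewrite (@left_lim _ 0%N (- x)) ?g'0 ?oppr0//; first by rewrite nx0 lexx.
move=> y; rewrite subrr => y0 yx; rewrite he // add0r (lt_trans yx)//.
by rewrite ltrNl.
Qed.

(** Reflection exchanges value and one-sided limit: at [- s] the path takes minus the left limit of
    [L'] at [s], while its own left limit is minus the value of [L'] just after [s], which is
    [L' s]. The jump is therefore that of [L'] at [s]. *)
Lemma jump_twosided_lt0 s : 0 < s -> exists k : nat, [/\ (k <= nu' s)%N,
  jump (twosided L L') (- s) = g' (nu' s) - g' k &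
  forall i q, 0 <= q -> (i < nu' q)%N -> (i < k)%N = (arrival nu' i < s)].
Proof.
move=> s0; have [k [ks [e e0s he] ik]] := left_count cnu' s0.
exists k; split => //; rewrite /jump {1}/twosided leNgt oppr_lt0 s0 /= opprK.
rewrite (left_lim e0s he) [RHS]addrC; congr (_ + _).
have [_ _ nu'c] := cnu'; have [e' e'0 he'] := nu'c s (ltW s0).
rewrite (@lim_at_left_cst _ _ (- g' (nu' s)) e') ?opprK//.
move=> x x1 x2; have xs : s < - x by rewrite ltrNr.
have x0 : x < 0 by rewrite (lt_trans x2)// oppr_lt0.
rewrite /twosided leNgt x0 /= (@left_lim _ (nu' s) (- x - s)) //.
  by rewrite subr_gt0 xs gerBl ltW.
move=> y; rewrite subKr => sy yx; apply: he' => //.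
by apply: (lt_trans yx); rewrite ltrNl opprD addrC addrC.
Qed.

Lemma jump_sum nu1 g1 s q k : counting nu1 -> 0 < s -> s <= q ->
  (k <= nu1 s)%N ->
  (forall i q, 0 <= q -> (i < nu1 q)%N -> (i < k)%N = (arrival nu1 i < s)) ->
  g1 (nu1 s) - g1 k =
  \sum_(i < nu1 q) (arrival nu1 i == s)%:R * (g1 i.+1 - g1 i) :> R.
Proof.
move=> cnu1 s0 sq ks ik.
have q0 : 0 <= q by apply: le_trans sq; exact: ltW.
have sQ : (nu1 s <= nu1 q)%N by case: cnu1 => _ + _; apply => //; exact: ltW.
have -> : g1 (nu1 s) - g1 k = (g1 (nu1 s) - g1 0%N) - (g1 k - g1 0%N) by ring.
rewrite -(count_sum _ sQ) -(count_sum _ (leq_trans ks sQ)) -sumrB.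
apply: eq_bigr => i _; rewrite -mulrBl; congr (_ * _).
rewrite (ik i q)// (arrival_le cnu1 q0 (ltn_ord i) (ltW s0)).
by case: ltgtP; rewrite ?subrr ?subr0.
Qed.

(** The left side runs over distinct jump points, the right side over arrivals with multiplicity.
    Arrivals sharing a time add up to the jump there, and an arrival time where they cancel has a
    zero jump and contributes nothing to either side. *)
Lemma ou_sum (F : R -> R) (q p : R) : 0 <= q -> 0 <= p ->
  \sum_(s \in [set s | - p <= s <= q /\ jump (twosided L L') s != 0])
     F s * jump (twosided L L') s =
  \sum_(i < nu q) F (arrival nu i) * (g i.+1 - g i) +
  \sum_(i < nu' p) F (- arrival nu' i) * (g' i.+1 - g' i).
Proof.
move=> q0 p0.
(* A finite set containing every jump point of the window; [undup] merges simultaneous arrivals, and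
   the points of [U] without a jump have weight 0. *)
pose U := undup ([seq arrival nu i | i : 'I_(nu q)] ++
                 [seq - arrival nu' i | i : 'I_(nu' p)]).
have jE s : - p <= s <= q -> jump (twosided L L') s =
  \sum_(i < nu q) (arrival nu i == s)%:R * (g i.+1 - g i) +
  \sum_(i < nu' p) (- arrival nu' i == s)%:R * (g' i.+1 - g' i).
  move=> /andP[ps sq]; case: (ltgtP s 0) => s0.
  - rewrite big1 ?add0r; last first.
      move=> i _; rewrite gt_eqF ?mul0r//.
      by rewrite (lt_trans s0)// (arrival_gt0 cnu q0).
    have Ns0 : 0 < - s by rewrite oppr_gt0.
    have [k [ks + ik]] := jump_twosided_lt0 Ns0; rewrite opprK => ->.
    rewrite (jump_sum _ cnu' Ns0 _ ks ik (q := p)); last by rewrite lerNl.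
    by apply: eq_bigr => i _; rewrite -eqr_oppLR.
  - rewrite [X in _ + X]big1 ?addr0; last first.
      move=> i _; rewrite lt_eqF ?mul0r// (le_lt_trans _ s0)//.
      by rewrite oppr_le0 ltW// (arrival_gt0 cnu' p0).
    have [k [ks -> ik]] := jump_twosided_gt0 s0.
    by rewrite (jump_sum _ cnu s0 sq ks ik).
  - rewrite s0 jump_twosided0 !big1 ?addr0// => i _.
      by rewrite lt_eqF ?mul0r// oppr_lt0 (arrival_gt0 cnu' p0).
    by rewrite gt_eqF ?mul0r// (arrival_gt0 cnu q0).
have Ubnd s : s \in U -> - p <= s <= q.
  rewrite mem_undup mem_cat => /orP[] /mapP[i _ ->].
    rewrite -(arrival_le cnu q0 (ltn_ord i) q0) ltn_ord andbT.
    by apply: le_trans (ltW (arrival_gt0 cnu q0 (ltn_ord i))); rewrite oppr_le0.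
  rewrite lerN2 -(arrival_le cnu' p0 (ltn_ord i) p0) ltn_ord /=.
  by apply: le_trans q0; rewrite oppr_le0 ltW // (arrival_gt0 cnu' p0).
rewrite (@fsbig_fwiden _ _ _ _ U) ?undup_uniq//; last first.
- move=> s [/= sU /not_andP[]]; first by rewrite (Ubnd s sU).
  by move=> /negP/negPn/eqP; rewrite /preimage /= => ->; rewrite mulr0.
- move=> s [/= psq /eqP jn0]; apply: contrapT => /negP sU; apply: jn0.
  rewrite jE // !big1 ?addr0// => i _.
    rewrite (_ : (_ == _) = false) ?mul0r//; apply: contraNF sU => /eqP <-.
    by rewrite mem_undup mem_cat (map_f (fun i : 'I_(nu' p) => - arrival nu' i)) ?orbT ?mem_enum.
  rewrite (_ : (_ == _) = false) ?mul0r//; apply: contraNF sU => /eqP <-.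
  by rewrite mem_undup mem_cat (map_f (fun i : 'I_(nu q) => arrival nu i)) ?mem_enum.
rewrite big_seq.
under eq_bigr => s sU do rewrite (jE _ (Ubnd _ sU)) mulrDr !mulr_sumr.
rewrite -big_seq big_split /=; congr (_ + _).
- rewrite exchange_big /=; apply: eq_bigr => i _.
  rewrite (bigD1_seq (arrival nu i)) ?undup_uniq //=; last first.
    by rewrite mem_undup mem_cat (map_f (fun i : 'I_(nu q) => arrival nu i)) ?mem_enum.
  rewrite eqxx mul1r big1 ?addr0// => s /negPf; rewrite eq_sym => ->.
  by rewrite mul0r mulr0.
- rewrite exchange_big /=; apply: eq_bigr => i _.
  rewrite (bigD1_seq (- arrival nu' i)) ?undup_uniq //=; last first.
    by rewrite mem_undup mem_cat (map_f (fun i : 'I_(nu' p) => - arrival nu' i)) ?orbT ?mem_enum.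
  rewrite eqxx mul1r big1 ?addr0// => s /negPf; rewrite eq_sym => ->.
  by rewrite mul0r mulr0.
Qed.

End twosided_jump.
End pathwise.

Lemma cvg_sumr {R : realType} {T : Type} (F : set_system T) {FF : Filter F}
  (I : Type) (r : seq I) (f : I -> T -> R) (l : I -> R) :
  (forall i, f i x @[x --> F] --> l i) ->
  (\sum_(i <- r) f i x) @[x --> F] --> \sum_(i <- r) l i.
Proof.
move=> fl; apply: (@cvg_big _ _ _ _ (fun=> true)) => //.
by move=> x; exact: add_continuous.
Qed.

(** The two image filters coincide, so the equality also covers the default value taken by [limn]
    under divergence. *)
Lemma lim_near_eq {R : realType} (u v : nat -> R) :
  (\forall n \near \oo, u n = v n) -> limn u = limn v.
Proof.
move=> uv; congr (lim _); apply/seteqP; split=> A /=; rewrite /fmap /=.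
  by move=> uA; near=> n; rewrite /preimage /= -(near uv n)//; near: n.
by move=> vA; near=> n; rewrite /preimage /= (near uv n)//; near: n.
Unshelve. all: by end_near. Qed.

(** * Dyadic sampling of shot noise functionals *)

Definition mesh {R : realType} (m : nat) : R := 2^-1 ^+ m.
Definition grid {R : realType} (m k : nat) : R := k%:R * mesh m.

Definition asum {R : realType} (h : R -> R) (nu : R -> nat) (g : nat -> R) (n : nat) : R :=
  \sum_(i < nu n%:R) h (arrival nu i) * (g i.+1 - g i).

Definition rsum {R : realType} (h L : R -> R) (n m : nat) : R :=
  \sum_(k < n * 2 ^ m) h (grid m k) * (L (grid m k.+1) - L (grid m k)).

Definition left_cts {R : realType} (h : R -> R) :=
  forall s, 0 < s -> h x @[x --> s^'-] --> h s.

(** With [u = lam * t], [hpos] weighs a jump at time s >= 0 and [hneg] a jump at time -s. The closed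
    condition [s <= u] is what makes the cutoff left continuous. *)
Definition hpos {R : realType} (u s : R) : R := if s <= u then expR (s - u) else 0.
Definition hneg {R : realType} (u s : R) : R := expR (- s - u).

Section grid_approximation.
Context {R : realType}.
Implicit Types (nu : R -> nat) (g : nat -> R) (h L : R -> R).

Lemma mesh_gt0 m : 0 < mesh m :> R. Proof. by rewrite exprn_gt0. Qed.

Lemma mesh_le1 m : mesh m <= 1 :> R.
Proof. by rewrite exprn_ile1 // invf_le1 // ler1n. Qed.

Lemma cvg_mesh : (mesh m : R) @[m --> \oo] --> 0.
Proof. by apply: cvg_expr; rewrite ger0_norm // invf_lt1 // ltr1n. Qed.

Lemma gridS m k : grid m k.+1 = grid m k + mesh m :> R.
Proof. by rewrite /grid -natr1 mulrDl mul1r. Qed.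

Lemma grid0 m : grid m 0 = 0 :> R. Proof. by rewrite /grid mul0r. Qed.

Lemma grid_ge0 m k : 0 <= grid m k :> R.
Proof. by rewrite mulr_ge0 // ltW // mesh_gt0. Qed.

Lemma gridE n m : grid m (n * 2 ^ m) = n%:R :> R.
Proof. by rewrite /grid natrM natrX -mulrA -exprMn divff ?expr1n ?mulr1. Qed.

Lemma le_grid m i j : (i <= j)%N -> grid m i <= grid m j :> R.
Proof. by move=> ij; rewrite ler_pM2r ?mesh_gt0 // ler_nat. Qed.

(** The indicator of reaching [a] changes in exactly one cell, the half-open cell (left, right]
    containing [a]; hence the sum samples [h] strictly to the left of [a], at distance at most one
    mesh. *)
Lemma grid_left_point m n (a : R) : 0 < a -> a <= n%:R ->
  exists2 x : R, a - mesh m <= x < a & forall h,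
   \sum_(k < n * 2 ^ m) h (grid m k) *
     ((a <= grid m k.+1)%R%:R - (a <= grid m k)%R%:R) = h x.
Proof.
move=> a0 an; pose p := [pred k | a <= grid m k].
have pex : exists k, p k by exists (n * 2 ^ m)%N; rewrite /= gridE.
case: (ex_minnP pex) => -[|j]; first by rewrite /= grid0 leNgt a0.
rewrite inE => aj jmin.
have ja : grid m j < a.
  rewrite ltNge; apply/negP => jp; have := jmin j jp; by rewrite ltnn.
have jn : (j < n * 2 ^ m)%N by apply: jmin; rewrite /= gridE.
exists (grid m j); first by rewrite ja andbT lerBlDr -gridS.
move=> h; rewrite (bigD1 (Ordinal jn)) //= aj leNgt ja /= subr0 mulr1.
rewrite big1 ?addr0// => k kj.
have [kltj|] := ltnP k j.
  rewrite !leNgt (le_lt_trans _ ja) ?le_grid// (le_lt_trans _ ja) ?le_grid 1?ltnW//.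
  by rewrite subrr mulr0.
rewrite leq_eqVlt => /orP[/eqP jk|jk].
  by move: kj; rewrite -val_eqE /= jk eqxx.
rewrite (le_trans aj) ?le_grid 1?ltnW// (le_trans aj) ?le_grid//.
by rewrite subrr mulr0.
Qed.

(** Each increment of the path is expanded over arrivals and the sums are exchanged; every arrival
    then samples [h] at a grid point tending to it from the left. *)
Lemma rsum_cvg h nu g L n : counting nu -> left_cts h ->
  (forall x, 0 <= x -> L x = g (nu x)) ->
  rsum h L n m @[m --> \oo] --> asum h nu g n.
Proof.
move=> cnu hl HL.
have [nu0 numono _] := cnu.
have n0 : 0 <= n%:R :> R by [].
pose w (i : 'I_(nu n%:R)) m := \sum_(k < n * 2 ^ m) h (grid m k) *
     ((arrival nu i <= grid m k.+1)%R%:R - (arrival nu i <= grid m k)%R%:R).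
have rE m : rsum h L n m = \sum_(i < nu n%:R) w i m * (g i.+1 - g i).
  under [RHS]eq_bigr do rewrite mulr_suml.
  rewrite exchange_big /=; apply: eq_bigr => k _.
  have gn j : (j <= n * 2 ^ m)%N -> (nu (grid m j) <= nu n%:R)%N.
    by move=> jn; apply: numono; rewrite ?grid_ge0 // -(gridE n m) le_grid.
  rewrite !HL ?grid_ge0//.
  have -> : g (nu (grid m k.+1)) - g (nu (grid m k)) =
    (g (nu (grid m k.+1)) - g 0%N) - (g (nu (grid m k)) - g 0%N) by ring.
  rewrite -(count_sum g (gn k.+1 (ltn_ord k))) -(count_sum g (gn k (ltnW (ltn_ord k)))).
  rewrite -sumrB mulr_sumr; apply: eq_bigr => i _.
  by rewrite -mulrBl mulrA !(arrival_le cnu n0 (ltn_ord i)) ?grid_ge0.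
rewrite (_ : rsum h L n = (fun m => \sum_(i < nu n%:R) w i m * (g i.+1 - g i))); last exact/funext.
apply: cvg_sumr => i; apply: cvgMl.
have a0 := arrival_gt0 cnu n0 (ltn_ord i).
have an : arrival nu i <= n%:R by rewrite -(arrival_le cnu n0 (ltn_ord i)).
have /choice [x hx] : forall m, exists x : R,
    arrival nu i - mesh m <= x < arrival nu i /\ w i m = h x.
  by move=> m; have [x xb xE] := grid_left_point m a0 an; exists x; split => //; exact: xE.
rewrite (_ : w i = h \o x); last by apply/funext => m; case: (hx m).
have /cvg_at_leftP := hl _ a0; apply; split.
  by move=> m; case: (hx m) => /andP[].
apply: (@squeeze_cvgr _ _ _ _ (fun m => arrival nu i - mesh m) (fun=> arrival nu i)).
- by near=> m; case: (hx m) => /andP[-> /ltW ->].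
- rewrite -[X in _ --> X]subr0; apply: cvgB; [exact: cvg_cst|exact: cvg_mesh].
- exact: cvg_cst.
Unshelve. all: by end_near. Qed.

Lemma hpos_left_cts (u : R) : left_cts (hpos u).
Proof.
move=> s s0; rewrite /hpos; case: ifPn => [su|]; last first.
  rewrite -ltNge => us; apply: cvg_near_cst; near=> x.
  rewrite ifF //; apply/negbTE; rewrite -ltNge; near: x; exact: nbhs_left_gt.
have : expR (x - u) @[x --> s^'-] --> expR (s - u).
  apply: continuous_cvg; first exact: continuous_expR.
  apply: cvgB; [exact: cvg_within | exact: cvg_cst].
apply: cvg_trans; apply: near_eq_cvg; near=> x.
by rewrite (le_trans _ su)//; near: x; exact: nbhs_left_le.
Unshelve. all: by end_near. Qed.

Lemma hneg_left_cts (u : R) : left_cts (hneg u).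
Proof.
move=> s s0; rewrite /hneg; apply: continuous_cvg; first exact: continuous_expR.
by apply: cvgB; [apply: cvgN; exact: cvg_within | exact: cvg_cst].
Qed.

(** Once [n >= lam * t], extending the nonnegative half up to [n] adds only terms that [hpos] kills,
    so both halves can share the horizon [n]. *)
Lemma ou_integralE nu nu' g g' L L' (lam t : R) :
  counting nu -> counting nu' -> g 0%N = 0 -> g' 0%N = 0 ->
  (forall x, 0 <= x -> L x = g (nu x)) -> (forall x, 0 <= x -> L' x = g' (nu' x)) ->
  0 <= lam * t ->
  ou_integral lam t (twosided L L') =
  limn (fun n => asum (hpos (lam * t)) nu g n + asum (hneg (lam * t)) nu' g' n).
Proof.
move=> cnu cnu' g0 g'0 HL HL'; set u := lam * t => u0.
rewrite /ou_integral; apply: lim_near_eq; near=> n.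
rewrite (ou_sum cnu cnu' g0 g'0 HL HL' (fun s => expR (s - u)))//.
congr (_ + _); rewrite /asum.
have un : u <= n%:R by near: n; exact: nbhs_infty_ger.
have nun : (nu u <= nu n%:R)%N by case: cnu => _ + _; apply.
rewrite (big_ord_widen _ (fun i => expR (arrival nu i - u) * (g i.+1 - g i)) nun).
rewrite big_mkcond; apply: eq_bigr => i _.
rewrite (arrival_le cnu _ (ltn_ord i))//= /hpos.
by case: ifP; rewrite ?mul0r.
Unshelve. all: by end_near. Qed.

End grid_approximation.

(** * Measurability and independence *)

Section measurability.
Context d (T : measurableType d) (R : realType).

(** This presents the set of convergence through a limsup and a liminf, hence as a measurable
    set. *)
Lemma cvgn_einf_esup (u : nat -> R) :
  `[< cvgn u >] = (limn_esup (EFin \o u) == limn_einf (EFin \o u)) &&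
    (limn_esup (EFin \o u) \is a fin_num).
Proof.
apply/asboolP/andP => [cu|[/eqP e f]].
  have : EFin \o u @ \oo --> (limn u)%:E by apply: cvg_EFin => //; near=> n.
  by move=> /cvg_limn_einf_sup[-> ->].
have : EFin \o u @ \oo --> limn_esup (EFin \o u).
  apply: (@squeeze_cvge _ _ _ _ (einfs (EFin \o u)) _ (esups (EFin \o u))).
  - near=> n; apply/andP; split; first by apply: ereal_inf_lbound; exists n => //=.
    by apply: ereal_sup_ubound; exists n => //=.
  - by rewrite e limn_einf_lim; exact: is_cvg_einfs.
  - by rewrite limn_esup_lim; exact: is_cvg_esups.
by rewrite -(fineK f) => /fine_cvg; exact: cvgP.
Unshelve. all: by end_near. Qed.

(* Where the sequence diverges, [limn] is a junk value; the processes below must nevertheless be measurable everywhere,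
   since a probability is unconstrained on nonmeasurable sets. *)
Lemma measurable_limn (u : nat -> T -> R) :
  (forall n, measurable_fun setT (u n)) ->
  measurable_fun setT (fun w => limn (u ^~ w)).
Proof.
move=> mu.
have meu n : measurable_fun setT (EFin \o u n) by exact/measurable_EFinP.
pose s w := limn_esup (fun n => (u n w)%:E).
pose i w := limn_einf (fun n => (u n w)%:E).
have ms : measurable_fun setT s by apply: measurable_fun_limn_esup => n; exact: meu.
have mi : measurable_fun setT i.
  rewrite (_ : i = fun w => - limn_esup (-%E \o (fun n => (u n w)%:E)))%E.
    apply: measurableT_comp => //; apply: measurable_fun_limn_esup => n.
    by apply: measurableT_comp => //; exact: meu.
  by apply/funext => w; rewrite /i limn_esupN oppeK.
rewrite (_ : (fun _ => _) =
   fun w => if (s w == i w) && (s w \is a fin_num) then fine (s w) else point).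
  apply: measurable_fun_ifT.
  - apply: measurable_and; first exact: measurable_fun_eqe.
    apply: (measurable_fun_bool true).
    by have := emeasurable_fin_num measurableT ms.
  - exact: measurableT_comp.
  - exact: measurable_cst.
apply/funext => w; rewrite -cvgn_einf_esup; case: asboolP => [cu|/dvgP //].
have : (fun n => (u n w)%:E) @ \oo --> (limn (u ^~ w))%:E.
  by apply: cvg_EFin => //; near=> n.
by move=> /cvg_limn_einf_sup[_]; rewrite /s => ->.
Unshelve. all: by end_near. Qed.

End measurability.

Section sub_sigma_algebra.
Import HBNNSimple.
Context d (T : measurableType d) (R : realType) (P : probability T R).
Implicit Types (G : set (set T)).

Definition sub_measurable G := G `<=` @measurable d T.

Lemma sub_measurable_sigma G : sub_measurable G -> <<s G>> `<=` @measurable d T.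
Proof.
move=> GT; apply: smallest_sub => //; split => //.
- by move=> A mA; rewrite setTD; exact: measurableC.
- by move=> F mF; exact: bigcup_measurable.
Qed.

Lemma sub_measurable_fun G (f : g_sigma_algebraType G -> R) : sub_measurable G ->
  measurable_fun setT f -> measurable_fun setT (f : T -> R).
Proof.
move=> GT mf _ B mB; apply: (sub_measurable_sigma GT).
by have := mf measurableT B mB.
Qed.

Local Open Scope ereal_scope.

(** From events to functions: simple functions, then monotone limits. The approximation of [f] is
    taken in the generated sigma-algebra, so that its level sets belong to [<<s G>>] and the
    hypothesis on events applies to them. *)
Lemma integral_indep_lift G (g : T -> R) (f : g_sigma_algebraType G -> R) :
  sub_measurable G -> measurable_fun setT g -> (forall w, 0 <= g w)%R ->
  \int[P]_w (g w)%:E \is a fin_num ->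
  (forall E, <<s G>> E ->
     \int[P]_w (\1_E w * g w)%:E = P E * \int[P]_w (g w)%:E) ->
  measurable_fun setT f -> (forall w, 0 <= f w)%R ->
  \int[P]_w ((f w * g w)%R)%:E = \int[P]_w (f w)%:E * \int[P]_w (g w)%:E.
Proof.
move=> GT mg g0 gfin hE mf f0.
have mef : measurable_fun setT (EFin \o f) by exact/measurable_EFinP.
pose h := nnsfun_approx (@measurableT _ (g_sigma_algebraType G)) mef.
pose k n : T -> R := (h n : g_sigma_algebraType G -> R).
have mh n : measurable_fun setT (k n).
  by apply: (sub_measurable_fun GT); exact: measurable_funP.
have ndh (w : T) : {homo (fun n => k n w) : n m / (n <= m)%N >-> (n <= m)%R}.
  move=> n m nm.
  by have /lefP := nd_nnsfun_approx (@measurableT _ (g_sigma_algebraType G)) mef nm; apply.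
have cvh (w : T) : (k n w)%:E @[n --> \oo] --> (f w)%:E.
  by apply: (@cvg_nnsfun_approx _ _ _ _ _ _ mef) => // x _; rewrite lee_fin f0.
have h0 n (w : T) : (0 <= k n w)%R by [].
have key n : \int[P]_w ((k n w * g w)%R)%:E = \int[P]_w (k n w)%:E * \int[P]_w (g w)%:E.
  have finr : finite_set (range (h n)) by [].
  pose A (y : R) : set T := k n @^-1` [set y].
  have sA y : <<s G>> (A y).
    have := @measurable_funP _ _ (g_sigma_algebraType G) R setT (h n) measurableT [set y] (measurable_set1 y); by rewrite setTI.
  have mA y : measurable (A y) by exact: (sub_measurable_sigma GT).
  have hnE (w : T) : k n w = (\sum_(y <- fset_set (range (h n))) y * \1_(A y) w)%R.
    by rewrite /k {1}fimfunE fsbig_finite.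
  have y0 y : y \in fset_set (range (h n)) -> (0 <= y)%R.
    by rewrite in_fset_set // => /set_mem[w _ <-].
  (* The absolute value changes nothing for values in the range of [h n], and makes every summand
     nonnegative for all [y], as exchanging the sum with the integral requires. *)
  transitivity (\int[P]_w (\sum_(y <- fset_set (range (h n))) (`|y| * (\1_(A y) w * g w))%R%:E)).
    apply: eq_integral => w _; rewrite hnE mulr_suml sumEFin; congr EFin.
    by rewrite big_seq [RHS]big_seq; apply: eq_bigr => y /y0 yy; rewrite ger0_norm// mulrA.
  transitivity ((\int[P]_w (\sum_(y <- fset_set (range (h n))) (`|y| * \1_(A y) w)%R%:E)) * \int[P]_w (g w)%:E); last first.
    congr (_ * _).
    apply: eq_integral => w _; rewrite hnE sumEFin; congr EFin.
    by rewrite big_seq [RHS]big_seq; apply: eq_bigr => y /y0 yy; rewrite ger0_norm.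
  have mA1 y : measurable_fun setT (\1_(A y) : T -> R) by exact: measurable_indic.
  have m1 y : measurable_fun setT (fun w => (`|y| * \1_(A y) w)%R%:E).
    by apply/measurable_EFinP; apply: measurable_funM.
  have m2 y : measurable_fun setT (fun w => (`|y| * (\1_(A y) w * g w))%R%:E).
    by apply/measurable_EFinP; apply: measurable_funM => //; apply: measurable_funM.
  have p1 y w : 0 <= (`|y| * \1_(A y) w)%R%:E by rewrite lee_fin mulr_ge0.
  have p2 y w : 0 <= (`|y| * (\1_(A y) w * g w))%R%:E by rewrite lee_fin !mulr_ge0.
  rewrite (ge0_integral_sum _ _ m1)//= (ge0_integral_sum _ _ m2)//=.
  rewrite ge0_sume_distrl; last by move=> y _; apply: integral_ge0 => w _; rewrite lee_fin mulr_ge0.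
  apply: eq_bigr => y _.
  under eq_integral do rewrite EFinM.
  rewrite ge0_integralZl//=; last 2 first.
  - by apply/measurable_EFinP; apply: measurable_funM.
  - by move=> w _; rewrite lee_fin mulr_ge0.
  rewrite hE//; under [in RHS]eq_integral do rewrite EFinM.
  rewrite ge0_integralZl//=; last exact/measurable_EFinP.
  by rewrite integral_indic// setIT muleA.
have lim1 : \int[P]_w ((k n w * g w)%R)%:E @[n --> \oo] --> \int[P]_w ((f w * g w)%R)%:E.
  have -> : \int[P]_w ((f w * g w)%R)%:E = \int[P]_w limn (fun n => ((k n w * g w)%R)%:E).
    apply: eq_integral => w _; apply/esym/cvg_lim => //.
    rewrite EFinM; under eq_fun do rewrite EFinM.
    by apply: cvgeZr => //; exact: cvh.
  apply: cvg_monotone_convergence => //.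
  - by move=> n; apply/measurable_EFinP; exact: measurable_funM.
  - by move=> n w _; rewrite lee_fin mulr_ge0.
  - by move=> w _ n m nm; rewrite lee_fin ler_wpM2r// ndh.
have lim2 : \int[P]_w (k n w)%:E @[n --> \oo] --> \int[P]_w (f w)%:E.
  have -> : \int[P]_w (f w)%:E = \int[P]_w limn (fun n => (k n w)%:E).
    by apply: eq_integral => w _; apply/esym/cvg_lim => //; exact: cvh.
  apply: cvg_monotone_convergence => //.
  - by move=> n; apply/measurable_EFinP.
  - by move=> n w _; rewrite lee_fin.
  - by move=> w _ n m nm; rewrite lee_fin ndh.
apply: (cvg_unique _ lim1) => //.
rewrite (_ : (fun n => _) = (fun n => \int[P]_w (k n w)%:E * \int[P]_w (g w)%:E)); last exact/funext.
by apply: cvgeZr => //; exact: lim2.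
Qed.

Lemma integral_le1_fin_num (f : T -> R) : measurable_fun setT f ->
  (forall w, 0 <= f w <= 1)%R -> \int[P]_w (f w)%:E \is a fin_num.
Proof.
move=> mf f01; rewrite ge0_fin_numE; last first.
  by apply: integral_ge0 => w _; rewrite lee_fin; case/andP: (f01 w).
apply: (@le_lt_trans _ _ (\int[P]_w (cst 1%:E w))); last first.
  by rewrite integral_cst//= mul1e; apply: (le_lt_trans (probability_le1 P _)); rewrite ?ltry.
apply: ge0_le_integral => //=.
- by move=> w _; rewrite lee_fin; case/andP: (f01 w).
- exact/measurable_EFinP.
- by move=> w _; rewrite lee_fin; case/andP: (f01 w).
Qed.

(** The mixed product of functions and indicators is the form that carries the induction: an index
    moves from [J'] to [J] when its indicator is replaced by a function. *)
Lemma mutual_indep_integral_prod (I : eqType) (F : I -> set (set T)) (J J' : seq I)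
    (f : forall i, g_sigma_algebraType (F i) -> R) (E : I -> set T) :
  mutual_indep P (fun i => <<s F i>>) -> (forall i, sub_measurable (F i)) ->
  uniq (J ++ J') ->
  (forall i, measurable_fun setT (f i)) -> (forall i w, 0 <= f i w <= 1)%R ->
  (forall i, <<s F i>> (E i)) ->
  \int[P]_w ((\prod_(i <- J) f i w) * \prod_(i <- J') \1_(E i) w)%R%:E =
  (\prod_(i <- J) \int[P]_w (f i w)%:E) * \prod_(i <- J') P (E i).
Proof.
move=> ind GF + mf f01; elim: J J' E => [|i J IH] J' E uJ sE.
  rewrite big_nil mul1e -ind//.
  have mE i : measurable (E i) by exact: (sub_measurable_sigma (GF i)).
  rewrite -(setIT (\bigcap_(i in [set` J']) E i)).
  rewrite -integral_indic//; last first.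
    by apply: fin_bigcap_measurable => //; exact: finite_seq.
  apply: eq_integral => w _; congr EFin; rewrite big_nil mul1r.
  rewrite indicE; case: (boolP (w \in _)) => wE.
    move/set_mem: wE => wE; rewrite big_seq big1// => j jJ.
    by rewrite indicE mem_set//; exact: wE.
  have [j jJ nE] : exists2 j, j \in J' & w \notin E j.
    apply: contrapT => h; move/negP: wE; apply; apply/mem_set => j /= jJ.
    by apply: contrapT => nE; apply: h; exists j => //; rewrite notin_setE.
  by rewrite (big_rem j)//= indicE (negPf nE) mul0r.
have fT j : measurable_fun setT (f j : T -> R) by exact: (sub_measurable_fun (GF j)).
pose g w := ((\prod_(i <- J) f i w) * \prod_(i <- J') \1_(E i) w)%R.
have mg : measurable_fun setT g.
  apply: measurable_funM; apply: measurable_prod => // j _.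
  by apply: measurable_indic; exact: (sub_measurable_sigma (GF j)).
have g01 w : (0 <= g w <= 1)%R.
  apply/andP; split.
    by rewrite mulr_ge0// prodr_ge0// => j _; case/andP: (f01 j w).
  rewrite mulr_ile1//; [|exact: prodr_ge0| | ].
  - by rewrite prodr_ge0// => j _; case/andP: (f01 j w).
  - by rewrite prodr_ile1// => j _; exact: f01.
  - by rewrite prodr_ile1// => j _; rewrite indicE; case: (_ \in _); rewrite ?lexx ?ler01.
move: uJ => /= /andP[iJ uJ].
transitivity (\int[P]_w (f i w * g w)%R%:E).
  by apply: eq_integral => w _; rewrite big_cons mulrA.
have hE E0 : <<s F i>> E0 -> \int[P]_w (\1_E0 w * g w)%:E = P E0 * \int[P]_w (g w)%:E.
  move=> sE0.
  (* [E0] joins the indicators as the event of index [i]; since [i] is not in [J'], the other events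
     are unchanged and the induction hypothesis applies to [i :: J']. *)
  pose E' j := if j == i then E0 else E j.
  have sE' j : <<s F j>> (E' j).
    by rewrite /E'; case: (eqVneq j i) => [->|].
  have uJ' : uniq (J ++ i :: J').
    by rewrite (perm_uniq (permEl (perm_catCA J [:: i] J'))) /= iJ.
  have EJ' j : j \in J' -> E' j = E j.
    move=> jJ; rewrite /E'; case: (eqVneq j i) => // ji.
    by move: iJ; rewrite mem_cat -ji jJ orbT.
  transitivity (\int[P]_w ((\prod_(i <- J) f i w) * \prod_(i <- i :: J') \1_(E' i) w)%R%:E).
    apply: eq_integral => w _; congr EFin; rewrite big_cons /g mulrCA; congr (_ * (_ * _))%R.
      by rewrite /E' eqxx.
    by rewrite big_seq [RHS]big_seq; apply: eq_bigr => j /EJ' ->.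
  rewrite (IH _ E')// (IH J' E)// big_cons muleCA; congr (_ * (_ * _)).
    by rewrite /E' eqxx.
  by rewrite big_seq [RHS]big_seq; apply: eq_bigr => j /EJ' ->.
have g0 w : (0 <= g w)%R by case/andP: (g01 w).
have fi0 w : (0 <= f i w)%R by case/andP: (f01 i w).
rewrite (integral_indep_lift (GF i) mg g0 (integral_le1_fin_num mg g01) hE (mf i) fi0).
by rewrite (IH J' E)// big_cons muleA.
Qed.

Lemma indep_integral_prod (I : eqType) (F : I -> set (set T)) (J : seq I)
    (f : forall i, g_sigma_algebraType (F i) -> R) :
  mutual_indep P (fun i => <<s F i>>) -> (forall i, sub_measurable (F i)) ->
  uniq J ->
  (forall i, measurable_fun setT (f i)) -> (forall i w, 0 <= f i w <= 1)%R ->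
  \int[P]_w (\prod_(i <- J) f i w)%R%:E = \prod_(i <- J) \int[P]_w (f i w)%:E.
Proof.
move=> ind GF uJ mf f01.
have sT i : <<s F i>> [set: T].
  by have := @measurableT _ (g_sigma_algebraType (F i)).
have := @mutual_indep_integral_prod I F J [::] f (fun=> setT) ind GF.
rewrite cats0 big_nil mule1 => <- //.
by apply: eq_integral => w _; rewrite big_nil mulr1.
Qed.

End sub_sigma_algebra.

(** * Poisson and compound Poisson increments *)

Lemma exp_series_cvg {R : realType} (x : R) :
  series (fun n => x ^+ n / n`!%:R) @ \oo --> expR x.
Proof. by have := is_cvg_series_exp_coeff x; rewrite -/(expR x); apply. Qed.
Arguments exp_series_cvg {R} x.

Lemma exp_pos_series_cvg {R : realType} (x : R) :
  series (fun n => x ^+ n.+1 / n.+1`!%:R) @ \oo --> expR x - 1.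
Proof.
have h := exp_series_cvg x.
rewrite (_ : series _ = fun n => series (fun n => x ^+ n / n`!%:R) n.+1 - 1).
  by apply: cvgB; [rewrite -cvg_shiftS in h; exact: h|exact: cvg_cst].
apply/funext => n; rewrite /series /= [in RHS]big_nat_recl//= expr0 fact0 divr1.
by rewrite addrC addKr.
Qed.

Arguments exp_pos_series_cvg {R} x.

Section discrete.
Context d (T : measurableType d) (R : realType) (P : probability T R).
Local Open Scope ereal_scope.

(** The masses of the atoms already sum to 1, so nothing is left for the complement. *)
Lemma discrete_support_null (S : T -> R) (s : nat -> R) (p : nat -> R) :
  measurable_fun setT S -> injective s ->
  (forall n, P (S @^-1` [set s n]) = (p n)%:E) -> series p @ \oo --> (1%R : R) ->
  [/\ forall n, measurable (S @^-1` [set s n]),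
     trivIset setT (fun n => S @^-1` [set s n]) &
     P (~` \bigcup_n (S @^-1` [set s n])) = 0].
Proof.
move=> mS injs hp sp.
have mSn n : measurable (S @^-1` [set s n]).
  by rewrite -[X in measurable X]setTI; apply: mS => //; exact: measurable_set1.
have tr : trivIset setT (fun n => S @^-1` [set s n]).
  by move=> i j _ _ [w [/= wi wj]]; apply: injs; rewrite -wi -wj.
split => //; rewrite probability_setC; last exact: bigcup_measurable.
rewrite measure_bigcup//= (_ : \big[_/_]_(0 <= i <oo | _) _ = 1) ?subee//.
apply/cvg_lim => //; rewrite (_ : (fun n => _) = EFin \o series p).
  by apply: cvg_EFin => //; near=> n.
apply/funext => n; rewrite /= -sumEFin.
by apply: eq_big => [i|i _]; rewrite ?in_setT// hp.
Unshelve. all: by end_near. Qed.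

(** [F] is tied to [S] only on the atoms, so an integrand built from [|Y|] can be evaluated with the
    law of [Y]. *)
Lemma integral_discrete (S F : T -> R) (s : nat -> R) (p f : nat -> R) (v : R) :
  measurable_fun setT S -> injective s ->
  (forall n, P (S @^-1` [set s n]) = (p n)%:E) -> series p @ \oo --> (1%R : R) ->
  measurable_fun setT F -> (forall w, 0 <= F w)%R ->
  (forall w n, S w = s n -> F w = f n) ->
  series (fun n => f n * p n)%R @ \oo --> v ->
  \int[P]_w (F w)%:E = v%:E.
Proof.
move=> mS injs hp sp mF F0 SF sv.
have [mSn tr N0] := discrete_support_null mS injs hp sp.
have mD : measurable (\bigcup_n (S @^-1` [set s n])) by exact: bigcup_measurable.
have mEF : measurable_fun setT (EFin \o F) by exact/measurable_EFinP.
rewrite (@ge0_negligible_integral _ _ _ P _ (~` \bigcup_n (S @^-1` [set s n])))//; last 2 first.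
- exact: measurableC.
- by move=> w _; rewrite lee_fin.
rewrite setTD setCK ge0_integral_bigcup//; last 2 first.
- exact: measurable_funTS.
- by move=> w _; rewrite lee_fin.
apply/cvg_lim => //.
rewrite (_ : (fun n => _) = EFin \o series (fun n => f n * p n)%R).
  by apply: cvg_EFin => //; near=> n.
apply/funext => n; rewrite /= -sumEFin; apply: eq_bigr => i _.
rewrite (eq_integral (cst (f i)%:E)); last first.
  by move=> w; rewrite inE => /= /SF ->.
by rewrite integral_cst//= EFinM; congr (_ * _); exact: hp.
Unshelve. all: by end_near. Qed.

End discrete.

Section poisson.
Context d (T : measurableType d) (R : realType) (P : probability T R).
Variables (r : R) (N : T -> R -> R).
Hypothesis hN : poisson_process P r N.
Implicit Types (z : R).

Definition count (w : T) (t : R) : nat := Num.truncn (N w t).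

Lemma poisson_natE w t : 0 <= t -> N w t = (count w t)%:R.
Proof.
case: hN => [_ [_ [+ _]]] t0 => /(_ w t t0)[k hk].
by rewrite /count hk natrK.
Qed.

Lemma poisson_counting w : counting (count w).
Proof.
have [_ [N0 [_ [Nmono [Nrc _]]]]] := hN.
split.
- by rewrite /count N0 truncn0.
- by move=> s t s0 st; apply: le_truncn; exact: Nmono.
move=> s s0; have /cvgrPdist_lt /(_ 1 ltr01) := Nrc w s s0.
rewrite near_withinE => -[e /= e0 he]; exists e => // x sx xse.
have [->//|sltx] := eqVneq s x.
have {}sltx : s < x by rewrite lt_neqAle sltx.
have hb : `|s - x| < e by rewrite distrC ger0_norm ?subr_ge0 // ltrBlDl.
have := he x hb sltx.
have x0 := le_trans s0 sx.
rewrite (poisson_natE w s0) (poisson_natE w x0).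
have := Nmono w s x s0 sx; rewrite (poisson_natE w s0) (poisson_natE w x0) ler_nat.
rewrite leq_eqVlt => /orP[/eqP -> //|sx1].
rewrite distrC ger0_norm ?subr_ge0 ?ler_nat 1?ltnW// ltrBlDr nat1r ltr_nat.
by rewrite ltnS leqNgt sx1.
Qed.

Lemma poisson_incr w s t : 0 <= s -> s <= t ->
  N w t - N w s = (count w t - count w s)%:R.
Proof.
move=> s0 st; rewrite (poisson_natE w s0) (poisson_natE w (le_trans s0 st)) natrB//.
by have [_ + _] := poisson_counting w; apply.
Qed.

Lemma measurable_exp_truncn z : 0 <= z <= 1 ->
  measurable_fun setT (fun x : R => z ^+ Num.truncn x).
Proof.
move=> /andP[z0 z1].
rewrite (_ : (fun _ => _) = (fun x => - (- z ^+ Num.truncn x))); last first.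
  by apply/funext => x; rewrite opprK.
apply: measurable_funN; apply: nondecreasing_measurable => //.
by move=> x y xy; rewrite lerN2 ler_wiXn2l // le_truncn.
Qed.

Lemma poisson_pgf s t z : 0 <= s -> s <= t -> 0 <= z <= 1 ->
  (\int[P]_w (z ^+ (count w t - count w s))%:E)%E = (expR (r * (t - s) * (z - 1)))%:E.
Proof.
move=> s0 st z01; have [mN [_ [_ [_ [_ [_ law]]]]]] := hN.
set x := r * (t - s).
have mS : measurable_fun setT (fun w => N w t - N w s) by exact: measurable_funB.
apply: (@integral_discrete _ _ _ P (fun w => N w t - N w s) _ (fun n => n%:R)
   (fun k => expR (- x) * x ^+ k / k`!%:R) (fun k => z ^+ k)) => //.
- exact: mulrIn.
- by move=> n; rewrite -law.
- rewrite (_ : series _ = fun n => expR (- x) * series (fun n => x ^+ n / n`!%:R) n).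
    rewrite -[X in _ --> X](mulVf (lt0r_neq0 (expR_gt0 x))) -expRN.
    by apply: cvgMr; exact: exp_series_cvg.
  apply/funext => n; rewrite /series /= mulr_sumr; apply: eq_bigr => i _.
  by rewrite mulrA.
- rewrite (_ : (fun w => _) = (fun y => z ^+ Num.truncn y) \o (fun w => N w t - N w s)).
    by apply: measurableT_comp => //; exact: measurable_exp_truncn.
  by apply/funext => w /=; rewrite poisson_incr// natrK.
- by move=> w; rewrite exprn_ge0//; case/andP: z01.
- move=> w n /=; rewrite poisson_incr// => /eqP; rewrite eqr_nat => /eqP -> //.
- rewrite (_ : series _ = fun n => expR (- x) * series (fun n => (x * z) ^+ n / n`!%:R) n).
    rewrite mulrBr mulr1 addrC expRD.
    by apply: cvgMr; exact: exp_series_cvg.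
  apply/funext => n; rewrite /series /= mulr_sumr; apply: eq_bigr => i _.
  have alg (a b c e : R) : a * (e * b * c) = e * (b * a * c) by ring.
  by rewrite [(x * z) ^+ i]exprMn; exact: alg.
Qed.

Lemma poisson_grid_pgf m K (z : nat -> R) : (forall k, 0 <= z k <= 1) ->
  (\int[P]_w (\prod_(k < K) z k ^+ (count w (grid m k.+1) - count w (grid m k)))%:E)%E =
  (\prod_(k < K) expR (r * mesh m * (z k - 1)))%:E.
Proof.
move=> z01; have [mN [_ [_ [_ [_ [ind _]]]]]] := hN.
have := ind (fun k => grid m k) (grid_ge0 m 0) (fun k => le_grid m (leqnSn k)).
set F := (fun k : nat => sigma_gen _) => indF.
pose G k := [set A | exists (u : unit) (B : set R), measurable B /\
   A = (fun w => N w (grid m k.+1) - N w (grid m k)) @^-1` B].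
pose f k : g_sigma_algebraType (G k) -> R :=
  fun w => z k ^+ Num.truncn (N w (grid m k.+1) - N w (grid m k)).
have fE k w : f k w = z k ^+ (count w (grid m k.+1) - count w (grid m k)).
  by rewrite /f poisson_incr ?grid_ge0 ?le_grid// natrK.
have GT k : sub_measurable (G k).
  move=> A [_ [B [mB ->]]]; rewrite -[X in measurable X]setTI.
  by apply: measurable_funB.
have mX k : measurable_fun setT ((fun w => N w (grid m k.+1) - N w (grid m k)) : g_sigma_algebraType (G k) -> R).
  by move=> _ B mB; rewrite setTI; apply: sub_sigma_algebra; exists tt, B.
have mf k : measurable_fun setT (f k).
  apply: (measurableT_comp (measurable_exp_truncn (z01 k))); exact: mX.
have f01 k w : 0 <= f k w <= 1.
  by have /andP[z0 z1] := z01 k; rewrite exprn_ge0// exprn_ile1.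
have H := indep_integral_prod indF GT (iota_uniq 0 (K - 0)) mf f01.
transitivity (\int[P]_w (\prod_(0 <= k < K) f k w)%:E)%E.
  by apply: eq_integral => w _; rewrite big_mkord; congr EFin; apply: eq_bigr => k _; rewrite fE.
rewrite [LHS]H -/(index_iota 0 K).
rewrite big_mkord -prodEFin; apply: eq_bigr => k _.
rewrite -(_ : grid m k.+1 - grid m k = mesh m); last by rewrite gridS addrC addKr.
rewrite -poisson_pgf ?grid_ge0 ?le_grid//.
by apply: eq_integral => w _; rewrite fE.
Qed.

End poisson.

Section bounded_convergence.
Context d (T : measurableType d) (R : realType) (P : probability T R).

Lemma ae_dominated_cvg (u : nat -> T -> R) (f g : T -> R) :
  (forall n, measurable_fun setT (u n)) -> measurable_fun setT f ->
  measurable_fun setT g -> (forall w, 0 <= g w) ->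
  (\int[P]_w (g w)%:E < +oo)%E ->
  (forall n w, `|u n w| <= g w) ->
  (\forall w \ae P, u n w @[n --> \oo] --> f w) ->
  (\int[P]_w (u n w)%:E)%E @[n --> \oo] --> (\int[P]_w (f w)%:E)%E.
Proof.
move=> mu mf mg g0 gi ug uf.
have [] // := @dominated_convergence _ _ _ P setT measurableT
  (fun n => EFin \o u n) (EFin \o f) (EFin \o g).
- by move=> n; exact/measurable_EFinP.
- exact/measurable_EFinP.
- apply: filterS uf => w uf _; apply: cvg_EFin => //; by near=> n.
- apply/integrableP; split; first exact/measurable_EFinP.
  apply: le_lt_trans gi; rewrite le_eqVlt; apply/orP; left; apply/eqP.
  by apply: eq_integral => w _; rewrite /= ger0_norm.
- by apply: aeW => w n _; rewrite /= lee_fin.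
Unshelve. all: by end_near. Qed.

Lemma ae_bounded_cvg (u : nat -> T -> R) (f : T -> R) :
  (forall n, measurable_fun setT (u n)) -> measurable_fun setT f ->
  (forall n w, `|u n w| <= 1) ->
  (\forall w \ae P, u n w @[n --> \oo] --> f w) ->
  (\int[P]_w (u n w)%:E)%E @[n --> \oo] --> (\int[P]_w (f w)%:E)%E.
Proof.
move=> mu mf u1 uf; apply: (@ae_dominated_cvg _ _ (cst 1)) => //.
rewrite [ltLHS](_ : _ = \int[P]_w cst 1%:E w)%E// integral_cst//= mul1e.
by rewrite (le_lt_trans (probability_le1 P _)) ?ltry.
Qed.

End bounded_convergence.

Definition gen {T : Type} {R : realType} {K : Type} (X : K -> T -> R) : set (set T) :=
  [set A | exists k (B : set R), measurable B /\ A = X k @^-1` B].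

Section generated.
Context d (T : measurableType d) (R : realType).

Lemma sub_measurable_gen (K : Type) (X : K -> T -> R) :
  (forall k, measurable_fun setT (X k)) -> sub_measurable (gen X).
Proof.
move=> mX A [k [B [mB ->]]]; rewrite -[X in measurable X]setTI.
exact: (mX k).
Qed.

Lemma measurable_gen (K : Type) (X : K -> T -> R) k :
  measurable_fun setT (X k : g_sigma_algebraType (gen X) -> R).
Proof. by move=> _ B mB; rewrite setTI; apply: sub_sigma_algebra; exists k, B. Qed.

Lemma mutual_indep_inj (P : probability T R) (I K : eqType) (F : K -> set (set T))
  (f : I -> K) : injective f ->
  mutual_indep P F -> mutual_indep P (F \o f).
Proof.
move=> injf ind J E uJ FE.
(* By injectivity this intersection involves at most one index: it is [E i] at [f i], and the whole
   space away from the image. *)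
pose E' k := \bigcap_(i in [set i | f i = k]) E i.
have EE i : E' (f i) = E i.
  apply/seteqP; split => w; first by apply.
  by move=> Ew j /= /injf ->.
have := ind (map f J) E'; rewrite map_inj_uniq// big_map.
have -> : \bigcap_(i in [set i | i \in map f J]) E' i = \bigcap_(i in [set i | i \in J]) E i.
  apply/seteqP; split => w wE i /=.
    by move=> iJ; rewrite -EE; apply: wE; rewrite /= map_f.
  by move=> /mapP[j jJ ->]; rewrite EE; exact: wE.
move=> -> //; first by apply: eq_bigr => i _; rewrite EE.
by move=> k /mapP[i iJ ->]; rewrite EE; exact: FE.
Qed.

End generated.

(** One formula for all components and all cells of a grid encodes independence of the components,
    independence and stationarity of the increments, and the Laplace exponent [psi e] per unit time.
    It is the form in which the laws of both sides enter the comparison. *)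
Definition laplace_system {d} {T : measurableType d} {R : realType}
  (P : probability T R) (I : finType) (L : I -> T -> R -> R) (psi : I -> R -> R) :=
  forall m K (a : I -> nat -> R), (forall e k, 0 <= a e k) ->
    (\int[P]_w (expR (- \sum_e \sum_(k < K) a e k *
        (L e w (grid m k.+1) - L e w (grid m k))))%:E)%E =
    (expR (- \sum_e \sum_(k < K) mesh m * psi e (a e k)))%:E.

Lemma poisson_system_pgf d (T : measurableType d) (R : realType)
    (P : probability T R) (I : finType) (N : I -> T -> R -> R) (r : I -> R)
    (m K : nat) (z : I -> nat -> R) :
  (forall e, poisson_process P (r e) (N e)) ->
  mutual_indep P (fun e => sigma_gen (fun t => N e ^~ t)) ->
  (forall e k, 0 <= z e k <= 1) ->
  (\int[P]_w (\prod_e \prod_(k < K)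
     z e k ^+ (count (N e) w (grid m k.+1) - count (N e) w (grid m k)))%:E)%E =
  (\prod_e \prod_(k < K) expR (r e * mesh m * (z e k - 1)))%:E.
Proof.
move=> hN ind z01.
pose f e w := \prod_(k < K) z e k ^+ (count (N e) w (grid m k.+1) - count (N e) w (grid m k)).
have mN e t : measurable_fun setT (N e ^~ t) by case: (hN e).
transitivity (\int[P]_w (\prod_(e <- enum I) f e w)%:E)%E.
  by apply: eq_integral => w _; congr EFin; rewrite big_enum.
have -> := @indep_integral_prod _ _ _ P I (fun e => gen (fun t => N e ^~ t)) (enum I) f ind.
- rewrite big_enum -prodEFin; apply: eq_bigr => e _.
  by rewrite (poisson_grid_pgf (hN e)).
- by move=> e; apply: sub_measurable_gen.
- exact: enum_uniq.
- move=> e; apply: measurable_prod => k _.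
  rewrite (_ : (fun x => _) = (fun x => z e k ^+ Num.truncn x) \o
     (fun w => N e w (grid m k.+1) - N e w (grid m k))); last first.
    by apply/funext => w /=; rewrite (poisson_incr (hN e)) ?grid_ge0 ?le_grid// natrK.
  apply: measurableT_comp; first exact: measurable_exp_truncn.
  apply: measurable_funB.
    exact: (@measurable_gen _ _ _ _ (fun t => N e ^~ t) (grid m k.+1)).
  exact: (@measurable_gen _ _ _ _ (fun t => N e ^~ t) (grid m k)).
- move=> e w; apply/andP; split.
    by apply: prodr_ge0 => k _; rewrite exprn_ge0//; case/andP: (z01 e k).
  apply: prodr_ile1 => k _; case/andP: (z01 e k) => ? ?.
  by rewrite exprn_ge0 //= exprn_ile1.
Qed.

Lemma poisson_laplace_system d (T : measurableType d) (R : realType)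
    (P : probability T R) (I : finType) (N : I -> T -> R -> R) (r c : I -> R) :
  (forall e, 0 <= c e) ->
  (forall e, poisson_process P (r e) (N e)) ->
  mutual_indep P (fun e => sigma_gen (fun t => N e ^~ t)) ->
  laplace_system P (fun e w s => c e * N e w s)
    (fun e x => r e * (1 - expR (- (c e * x)))).
Proof.
move=> c0 hN ind m K a a0.
pose z e k := expR (- (c e * a e k)).
have z01 e k : 0 <= z e k <= 1.
  by rewrite expR_ge0 /z -[leRHS]expR0 ler_expR oppr_le0 mulr_ge0.
transitivity (\int[P]_w (\prod_e \prod_(k < K)
     z e k ^+ (count (N e) w (grid m k.+1) - count (N e) w (grid m k)))%:E)%E.
  apply: eq_integral => w _; congr EFin.
  rewrite -sumrN expR_sum; apply: eq_bigr => e _.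
  rewrite -sumrN expR_sum; apply: eq_bigr => k _.
  rewrite -mulrBr (poisson_incr (hN e)) ?grid_ge0 ?le_grid//.
  rewrite /z -expRM_natr; congr expR; ring.
rewrite (poisson_system_pgf _ _ hN ind z01); congr EFin.
rewrite -sumrN expR_sum; apply: eq_bigr => e _.
rewrite -sumrN expR_sum; apply: eq_bigr => k _; congr expR.
rewrite /z; ring.
Qed.

(** * Jumps grouped by grid cell *)

Section blocks.
Context {R : realType}.
Implicit Types (a y : nat -> R) (v : nat -> nat).

(** If [v k] is the number of jumps up to grid point [k], this is the weight of the cell in which
    jump number [i] occurs, and 0 if it occurs in none of them. *)
Definition block_coef (K : nat) a v (i : nat) : R :=
  \sum_(k < K) if (v k <= i < v k.+1)%N then a k else 0.

Lemma block_coef_sum K a v y I :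
  (forall k, (k < K)%N -> (v k <= v k.+1)%N) -> (forall k, (k <= K)%N -> (v k <= I)%N) ->
  \sum_(k < K) a k * (\sum_(i < v k.+1) y i - \sum_(i < v k) y i) =
  \sum_(i < I) block_coef K a v i * y i.
Proof.
move=> vm vI; under [RHS]eq_bigr do rewrite mulr_suml.
rewrite exchange_big /=; apply: eq_bigr => k _.
have kK := ltn_ord k.
rewrite (big_ord_widen I y (vI _ kK)) (big_ord_widen I y (vI _ (ltnW kK))).
rewrite big_mkcond [X in _ - X]big_mkcond -sumrB mulr_sumr; apply: eq_bigr => i _.
have [vki|ivk] /= := leqP (v k) i.
  by rewrite subr0; case: ifP; rewrite ?mul0r ?mulr0.
by rewrite (leq_trans ivk (vm _ kK)) subrr mulr0 mul0r.
Qed.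

(** The blocks are disjoint, so at most one term of each coefficient survives; an index outside all
    blocks contributes [g 0 = 1]. *)
Lemma block_coef_prod K a v I (g : R -> R) : g 0 = 1 ->
  (forall k, (k < K)%N -> (v k <= v k.+1)%N) -> (forall k, (k <= K)%N -> (v k <= I)%N) ->
  \prod_(i < I) g (block_coef K a v i) = \prod_(k < K) g (a k) ^+ (v k.+1 - v k).
Proof.
move=> g0 vm vI.
have vmono i j : (i <= j)%N -> (j <= K)%N -> (v i <= v j)%N.
  elim: j => [|j IH]; first by rewrite leqn0 => /eqP ->.
  rewrite leq_eqVlt => /orP[/eqP -> //|]; rewrite ltnS => ij jK.
  by rewrite (leq_trans (IH ij (ltnW jK)))// vm.
have gE i : g (block_coef K a v i) =
    \prod_(k < K) if (v k <= i < v k.+1)%N then g (a k) else 1.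
  rewrite /block_coef.
  have [/existsP[k hk]|/existsPn h] := boolP [exists k : 'I_K, (v k <= i < v k.+1)%N].
    rewrite (bigD1 k)//= hk big1 ?addr0; last first.
      move=> j jk; case: ifPn => // /andP[v1 v2]; exfalso.
      move: hk => /andP[v3 v4].
      have [jlk|klj|/val_inj e] := ltngtP j k; last by rewrite e eqxx in jk.
        by have := leq_trans v2 (leq_trans (vmono _ _ jlk (ltnW (ltn_ord k))) v3); rewrite ltnn.
      by have := leq_trans v4 (leq_trans (vmono _ _ klj (ltnW (ltn_ord j))) v1); rewrite ltnn.
    rewrite (bigD1 k)//= hk big1 ?mulr1// => j jk; case: ifPn => // /andP[v1 v2]; exfalso.
    move: hk => /andP[v3 v4].
    have [jlk|klj|/val_inj e] := ltngtP j k; last by rewrite e eqxx in jk.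
      by have := leq_trans v2 (leq_trans (vmono _ _ jlk (ltnW (ltn_ord k))) v3); rewrite ltnn.
    by have := leq_trans v4 (leq_trans (vmono _ _ klj (ltnW (ltn_ord j))) v1); rewrite ltnn.
  rewrite !big1 ?g0// => k _; first by rewrite (negPf (h k)).
  by rewrite (negPf (h k)).
under eq_bigr do rewrite gE.
rewrite exchange_big /=; apply: eq_bigr => k _.
rewrite -prodr_const_nat -big_mkcond /=.
rewrite (big_nat_widen _ _ I); last by apply: vI; exact: ltn_ord.
by rewrite (big_nat_widenl (v k) 0)// big_mkord; apply: eq_bigl => i; rewrite /= andbC.
Qed.

End blocks.

(** The random number of summands is removed by writing the sum as an eventually constant limit of
    sums of fixed length with indicators. *)
Lemma measurable_cp_path d (T : measurableType d) (R : realType)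
    (n : T -> R) (y : nat -> T -> R) :
  measurable_fun setT n -> (forall i, measurable_fun setT (y i)) ->
  measurable_fun setT (fun w => \sum_(i < Num.truncn (n w)) y i w).
Proof.
move=> mn my.
apply: (@measurable_fun_cvg _ _ _ _ (fun I w => \sum_(i < I) if i.+1%:R <= n w then y i w else 0)).
  move=> I; apply: measurable_sum => i.
  by apply: measurable_fun_ifT => //; apply: measurable_fun_ler.
move=> w _; apply: cvg_near_cst; near=> I.
rewrite (big_ord_widen I (fun i => y i w)); last by near: I; exact: nbhs_infty_ge.
by rewrite [RHS]big_mkcond; apply: eq_bigr => i _; rewrite truncn_gt_nat.
Unshelve. all: by end_near. Qed.

(** * Laplace transform of compound Poisson increments *)

Section compound_poisson.
Context d (T : measurableType d) (R : realType) (P : probability T R).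
Variables (N : bool -> T -> R -> R) (Y : bool -> nat -> T -> R) (r : R) (g : R -> R).
Hypothesis hN : forall b, poisson_process P r (N b).
Hypothesis mY : forall b i, measurable_fun setT (Y b i).
Hypothesis Y0 : forall b i w, 0 <= Y b i w.
Hypothesis hg : forall b i a, 0 <= a ->
  (\int[P]_w (expR (- (a * Y b i w)))%:E)%E = (g a)%:E.

Let F (c : bool + bool * nat) : set (set T) := match c with
  | inl b => gen (fun t : R => N b ^~ t)
  | inr bi => gen (fun _ : unit => Y bi.1 bi.2) end.

Hypothesis ind : mutual_indep P (fun c => <<s F c>>).

Lemma jump_laplace0 : g 0 = 1.
Proof.
have := hg true 0 (lexx 0).
under eq_integral do rewrite mul0r oppr0 expR0.
have -> : (\int[P]_x 1%:E = 1)%E.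
  rewrite [LHS](_ : _ = \int[P]_x (cst 1%:E x))%E// integral_cst//= mul1e.
  exact: probability_setT.
by case.
Qed.

Lemma jump_laplace_itv a : 0 <= a -> 0 <= g a <= 1.
Proof.
move=> a0; rewrite -!lee_fin -(hg true 0 a0); apply/andP; split.
  by apply: integral_ge0 => w _; rewrite lee_fin expR_ge0.
rewrite -jump_laplace0 -(hg true 0 (lexx 0)); apply: ge0_le_integral => //.
- apply/measurable_EFinP; apply: measurableT_comp => //.
  by apply: measurable_funN; apply: measurable_funM.
- apply/measurable_EFinP; apply: measurableT_comp => //.
  by apply: measurable_funN; apply: measurable_funM.
- move=> w _; rewrite lee_fin ler_expR mul0r oppr0 oppr_le0.
  by rewrite mulr_ge0.
Qed.

Variables (m K : nat) (a : bool -> nat -> R).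
Hypothesis a0 : forall b k, 0 <= a b k.

Let n b k w := count (N b) w (grid m k).

Let nmono b i j w : (i <= j)%N -> (n b i w <= n b j w)%N.
Proof.
move=> ij; have [_ + _] := poisson_counting (hN b) w; apply; first exact: grid_ge0.
exact: le_grid.
Qed.

(* On the event [n b K <= I] the counts take finitely many values [v]; on each of them the increments are sums of the jumps
   over fixed blocks of indices. *)
Let bnd I w : R := [forall b, n b K w <= I]%N%:R.

Let V I := {ffun bool * 'I_K.+1 -> 'I_I.+1}.
Let vn I (v : V I) b k : nat := v (b, inord k).
Let sel I (v : V I) b w : R := \prod_(k < K.+1) ((n b k w)%:R == (v (b, k))%:R :> R)%:R.

(** A finite partition of the event of bounded counts: there only the actual vector of counts is
    selected. Off that event some last count exceeds [I], a value no [v] can take, so every product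
    of selectors vanishes. *)
Let sel_sum I (H : V I -> R) w :
  \sum_(v : V I) (\prod_b sel v b w) * H v =
  bnd I w * H [ffun p : bool * 'I_K.+1 => inord (n p.1 p.2 w)].
Proof.
rewrite /bnd; case: forallP => [bd|nbd]; last first.
  rewrite mul0r big1// => v _; rewrite (_ : \prod_b _ = 0) ?mul0r//.
  have /existsP[b hb] : [exists b, ~~ (n b K w <= I)%N].
    by apply: contrapT => /negP/existsPn h; apply: nbd => b; have := h b; rewrite negbK.
  rewrite (bigD1 b)//= (_ : sel v b w = 0) ?mul0r// /sel big_ord_recr /=.
  rewrite eqr_nat (_ : (_ == _) = false) ?mulr0//; apply: contraNF hb => /eqP ->.
  by rewrite -ltnS.
have nI (p : bool * 'I_K.+1) : (n p.1 p.2 w <= I)%N.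
  by case: p => b k /=; apply: leq_trans (bd b); apply: nmono; rewrite -ltnS.
set v0 : V I := finfun _.
rewrite (bigD1 v0)//= mul1r [X in _ + X]big1 ?addr0.
  rewrite (_ : \prod_b _ = 1) ?mul1r// big1// => b _; rewrite /sel big1// => k _.
  by rewrite ffunE/= inordK ?ltnS ?(nI (b, k))// eqxx.
move=> v vv0; rewrite (_ : \prod_b _ = 0) ?mul0r//.
have /existsP[p hp] : [exists p, v p != v0 p].
  apply: contrapT => /negP/existsPn h; move/eqP: vv0; apply; apply/ffunP => p.
  by have := h p; rewrite negbK => /eqP.
case: p hp => b k hp; rewrite (bigD1 b)//= (_ : sel v b w = 0) ?mul0r//.
rewrite /sel (bigD1 k)//= eqr_nat (_ : (_ == _) = false) ?mul0r//.
apply: contraNF hp => /eqP e; rewrite -val_eqE /= ffunE /= inordK ?ltnS ?(nI (b, k))//.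
by rewrite e.
Qed.

Let vn0 I w b k : bnd I w != 0 -> (k <= K)%N ->
  vn [ffun p : bool * 'I_K.+1 => (inord (n p.1 p.2 w) : 'I_I.+1)] b k = n b k w.
Proof.
rewrite /bnd; case: forallP => [bd _ kK|_]; last by rewrite eqxx.
rewrite /vn ffunE /= inordK// inordK// ltnS.
by apply: leq_trans (bd b); exact: nmono.
Qed.

Let expo I (v : V I) (bi : bool * nat) w : R :=
  expR (- (block_coef K (a bi.1) (vn v bi.1) bi.2 * Y bi.1 bi.2 w)).

Let coef0 I (v : V I) b i : 0 <= block_coef K (a b) (vn v b) i.
Proof. by apply: sumr_ge0 => k _; case: ifP. Qed.

Let f I (v : V I) (c : bool + bool * nat) : T -> R :=
  match c with inl b => sel v b | inr bi => expo v bi end.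

Let mF c : sub_measurable (F c).
Proof.
case: c => [b|[b i]]; apply: sub_measurable_gen => //.
by move=> t; case: (hN b).
Qed.

Let mf I (v : V I) c : measurable_fun setT (f v c : g_sigma_algebraType (F c) -> R).
Proof.
case: c => [b|[b i]] /=.
  apply: measurable_prod => k _.
  rewrite (_ : (fun _ => _) = (fun x : R => if (Num.truncn x)%:R == (v (b, k))%:R :> R then 1 else 0) \o (N b ^~ (grid m k))); last first.
    by apply/funext => w /=; rewrite /n /count; case: (_ == _).
  apply: measurableT_comp; last exact: (@measurable_gen _ _ _ _ (fun t => N b ^~ t) (grid m k)).
  apply: measurable_fun_ifT => //; apply: measurable_fun_eqr => //.
  apply: nondecreasing_measurable => // x y xy; by rewrite ler_nat le_truncn.
apply: measurableT_comp => //; apply: measurable_funN; apply: measurable_funM => //.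
exact: (@measurable_gen _ _ _ _ (fun _ : unit => Y b i) tt).
Qed.

Let f01 I (v : V I) c w : 0 <= f v c w <= 1.
Proof.
case: c => [b|[b i]] /=.
  rewrite prodr_ge0//= prodr_ile1// => k _.
  by case: (_ == _); rewrite ?lexx ?ler01.
by rewrite expR_ge0 /= -[leRHS]expR0 ler_expR oppr_le0 mulr_ge0.
Qed.

Let idx I : seq (bool + bool * nat) :=
  [seq inl b | b <- index_enum bool] ++ [seq inr bi | bi <- [seq (b, i) | b <- index_enum bool, i <- iota 0 I]].

Let uniq_idx I : uniq (idx I).
Proof.
have i1 : injective (fun b : bool => inl b : bool + bool * nat) by move=> x y [].
have i2 : injective (fun b : bool * nat => inr b : bool + bool * nat) by move=> x y [].
rewrite cat_uniq (map_inj_uniq i1) (map_inj_uniq i2) index_enum_uniq /=.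
rewrite allpairs_uniq ?index_enum_uniq ?iota_uniq ?andbT//; last by move=> [? ?] [? ?].
by apply/negP => /hasP[x /mapP[y _ ->] /mapP[z _]].
Qed.

Let prod_idx I (S : Type) (x0 : S) (op : Monoid.com_law x0) (u : bool + bool * nat -> S) :
  \big[op/x0]_(c <- idx I) u c =
  op (\big[op/x0]_b u (inl b)) (\big[op/x0]_b \big[op/x0]_(i < I) u (inr (b, nat_of_ord i))).
Proof.
rewrite /idx big_cat !big_map big_allpairs_dep /=; congr (op _ _); apply: eq_bigr => b _.
by rewrite -(big_mkord xpredT (fun i : nat => u (inr (b, i)))) /index_iota subn0.
Qed.

(** Independence is used twice, for counts together with jumps and for counts alone; comparing the
    two factorizations separates the selectors from the jumps without computing the law of the
    counts. *)
Let int_sel I (v : V I) :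
  (\int[P]_w ((\prod_b sel v b w) * \prod_b \prod_(i < I) expo v (b, nat_of_ord i) w)%:E)%E =
  ((\int[P]_w (\prod_b sel v b w)%:E) *
   (\prod_b \prod_(i < I) g (block_coef K (a b) (vn v b) i))%:E)%E.
Proof.
have h1 := indep_integral_prod ind mF (uniq_idx I) (mf v) (f01 v).
have u1 : uniq [seq inl b : bool + bool * nat | b <- index_enum bool].
  by rewrite map_inj_uniq ?index_enum_uniq// => x y [].
have h2 := indep_integral_prod ind mF u1 (mf v) (f01 v).
transitivity (\int[P]_w (\prod_(c <- idx I) f v c w)%:E)%E.
  by apply: eq_integral => w _; rewrite prod_idx.
rewrite [LHS]h1 prod_idx /=; congr (_ * _)%E.
  transitivity (\int[P]_w (\prod_(c <- [seq inl b : bool + bool * nat | b <- index_enum bool]) f v c w)%:E)%E.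
    by rewrite [RHS]h2 big_map.
  by apply: eq_integral => w _; rewrite big_map.
rewrite -prodEFin; apply: eq_bigr => b _.
by rewrite -prodEFin; apply: eq_bigr => i _; rewrite hg.
Qed.

Let incr b w := \sum_(k < K) a b k *
  (cp_path (N b w) (fun i => Y b i w) (grid m k.+1) - cp_path (N b w) (fun i => Y b i w) (grid m k)).

Let zpow w := \prod_b \prod_(k < K) g (a b k) ^+ (n b k.+1 w - n b k w).

(** The counterpart of conditioning on the counts: for each fixed [v] the jumps are integrated out,
    and resumming over [v] leaves powers of [g (a b k)] whose exponents are the numbers of jumps in
    the cells. *)
Let truncated I :
  (\int[P]_w (bnd I w * expR (- \sum_b incr b w))%:E =
   \int[P]_w (bnd I w * zpow w)%:E)%E.
Proof.
pose c (v : V I) := \prod_b \prod_(i < I) g (block_coef K (a b) (vn v b) i).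
have c0 v : 0 <= c v.
  apply: prodr_ge0 => b _; apply: prodr_ge0 => i _.
  by case/andP: (jump_laplace_itv (coef0 v b i)).
have msel (v : V I) b : measurable_fun setT (sel v b).
  exact: (sub_measurable_fun (@mF (inl b)) (@mf I v (inl b))).
have mexpo (v : V I) bi : measurable_fun setT (expo v bi).
  exact: (sub_measurable_fun (@mF (inr bi)) (@mf I v (inr bi))).
have sel0 (v : V I) b w : 0 <= sel v b w by case/andP: (f01 v (inl b) w).
have vnK b (w : T) : bnd I w != 0 -> let v := vn [ffun p : bool * 'I_K.+1 => (inord (n p.1 p.2 w) : 'I_I.+1)] b in
  (forall k, (k < K)%N -> (v k <= v k.+1)%N) /\ (forall k, (k <= K)%N -> (v k <= I)%N).
  move=> bw v; split => k kK; last by rewrite /v /vn -ltnS.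
  by rewrite /v !vn0 ?nmono// ltnW.
transitivity (\int[P]_w (\sum_(v : V I) ((\prod_b sel v b w) * \prod_b \prod_(i < I) expo v (b, nat_of_ord i) w)%:E))%E.
  apply: eq_integral => w _; rewrite sumEFin; congr EFin.
  rewrite (sel_sum (fun v => \prod_b \prod_(i < I) expo v (b, nat_of_ord i) w)).
  have [->|bw] := eqVneq (bnd I w) 0; first by rewrite !mul0r.
  congr (_ * _); rewrite -sumrN expR_sum; apply: eq_bigr => b _.
  rewrite -expR_sum; congr expR; rewrite sumrN; congr (- _).
  have [v1 v2] := vnK b w bw.
  apply: etrans (@block_coef_sum _ _ (a b) _ (fun i => Y b i w) I v1 v2).
  by apply: eq_bigr => k _; rewrite !vn0 // ltnW.
rewrite ge0_integral_sum//=; last 2 first.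
- move=> v; apply/measurable_EFinP; apply: measurable_funM; first exact: measurable_prod.
  by apply: measurable_prod => b _; exact: measurable_prod.
- move=> v w _; rewrite lee_fin mulr_ge0 ?prodr_ge0// => b _; rewrite prodr_ge0// => i _.
  exact: expR_ge0.
transitivity (\int[P]_w (\sum_(v : V I) ((c v)%:E * (\prod_b sel v b w)%:E)))%E; last first.
  apply: eq_integral => w _; under eq_bigr do rewrite -EFinM mulrC.
  rewrite sumEFin (sel_sum c); congr EFin.
  have [->|bw] := eqVneq (bnd I w) 0; first by rewrite !mul0r.
  congr (_ * _); rewrite /c /zpow; apply: eq_bigr => b _.
  have [v1 v2] := vnK b w bw.
  rewrite (@block_coef_prod _ _ (a b) _ _ g jump_laplace0 v1 v2).
  by apply: eq_bigr => k _; rewrite !vn0 // ltnW.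
rewrite ge0_integral_sum//=; last 2 first.
- move=> v; apply: emeasurable_funM => //; apply/measurable_EFinP; exact: measurable_prod.
- by move=> v w _; rewrite mule_ge0 ?lee_fin// prodr_ge0.
apply: eq_bigr => v _; rewrite int_sel ge0_integralZl//=.
- by rewrite muleC.
- by apply/measurable_EFinP; exact: measurable_prod.
- by move=> w _; rewrite lee_fin prodr_ge0.
- by rewrite lee_fin.
Qed.

Let bnd_cvg (G : T -> R) w : bnd I w * G w @[I --> \oo] --> G w.
Proof.
apply: cvg_near_cst; near=> I; rewrite /bnd (_ : [forall b, _]) ?mul1r//.
apply/forallP => b; apply: (@leq_trans (n true K w + n false K w)).
  by case: b; rewrite ?leq_addr ?leq_addl.
by near: I; exact: nbhs_infty_ge.
Unshelve. all: by end_near. Qed.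

Let mn b k : measurable_fun setT (fun w => (n b k w)%:R : R).
Proof.
have mt : measurable_fun setT (fun x : R => (Num.truncn x)%:R : R).
  by apply: nondecreasing_measurable => // x y xy; rewrite ler_nat le_truncn.
by apply: (measurableT_comp mt); case: (hN b).
Qed.

Let mbnd I : measurable_fun setT (bnd I).
Proof.
rewrite (_ : bnd I = fun w => \prod_b if (n b K w)%:R <= I%:R :> R then 1 else 0).
  apply: measurable_prod => b _; apply: measurable_fun_ifT => //.
  exact: measurable_fun_ler.
apply/funext => w; rewrite /bnd; case: forallP => [h|/forallP/forallPn[b hb]].
  by rewrite big1// => b _; rewrite ler_nat h.
by rewrite (bigD1 b)//= ler_nat (negPf hb) mul0r.
Qed.

(** As [I] grows the truncation disappears by bounded convergence; what remains is the Poisson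
    generating function at [g (a b k)]. *)
Lemma compound_poisson_grid_laplace :
  (\int[P]_w (expR (- \sum_b incr b w))%:E =
   (expR (- \sum_(b : bool) \sum_(k < K) mesh m * (r * (1 - g (a b k)))))%:E)%E.
Proof.
have mincr : measurable_fun setT (fun w => expR (- \sum_b incr b w)).
  apply: measurableT_comp => //; apply: measurable_funN; apply: measurable_sum => b.
  apply: measurable_sum => k; apply: measurable_funM => //.
  by apply: measurable_funB; apply: measurable_cp_path => //; case: (hN b).
have incr0 w : 0 <= \sum_b incr b w.
  apply: sumr_ge0 => b _; apply: sumr_ge0 => k _; rewrite mulr_ge0// subr_ge0.
  rewrite /cp_path (big_ord_widen _ (fun i => Y b i w) (nmono b w (leqnSn k))).
  by rewrite big_mkcond; apply: ler_sum => i _; case: ifP.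
have g01 b k := jump_laplace_itv (a0 b k).
have mz : measurable_fun setT zpow.
  apply: measurable_prod => b _; apply: measurable_prod => k _.
  rewrite (_ : (fun w => _) = (fun x => g (a b k) ^+ Num.truncn x) \o
     (fun w => N b w (grid m k.+1) - N b w (grid m k))); last first.
    by apply/funext => w /=; rewrite (poisson_incr (hN b)) ?grid_ge0 ?le_grid// natrK.
  apply: measurableT_comp; first exact: measurable_exp_truncn.
  by case: (hN b) => mNb _; exact: measurable_funB.
have z01 w : 0 <= zpow w <= 1.
  rewrite /zpow; apply/andP; split.
    apply: prodr_ge0 => b _; apply: prodr_ge0 => k _; rewrite exprn_ge0//.
    by case/andP: (g01 b k).
  apply: prodr_ile1 => b _; apply/andP; split.
    by apply: prodr_ge0 => k _; rewrite exprn_ge0//; case/andP: (g01 b k).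
  apply: prodr_ile1 => k _; case/andP: (g01 b k) => ? ?.
  by rewrite exprn_ge0 //= exprn_ile1.
have bnd01 I w : 0 <= bnd I w <= 1 by rewrite /bnd; case: [forall b, _]; rewrite ?lexx ler01.
have b1 (G : T -> R) I w : 0 <= G w <= 1 -> `|bnd I w * G w| <= 1.
  move=> /andP[G0 G1]; case/andP: (bnd01 I w) => B0 B1.
  by rewrite ger0_norm ?mulr_ge0// mulr_ile1.
have h1 := @ae_bounded_cvg _ _ _ P (fun I w => bnd I w * expR (- \sum_b incr b w))
  (fun w => expR (- \sum_b incr b w)).
have h2 := @ae_bounded_cvg _ _ _ P (fun I w => bnd I w * zpow w) zpow.
have e1 w : 0 <= expR (- \sum_b incr b w) <= 1.
  by rewrite expR_ge0 /= -[leRHS]expR0 ler_expR oppr_le0.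
transitivity (\int[P]_w (zpow w)%:E)%E.
  have H1 : (\int[P]_w (bnd I w * expR (- \sum_b incr b w))%:E)%E @[I --> \oo] -->
      (\int[P]_w (expR (- \sum_b incr b w))%:E)%E.
    apply: h1 => //.
    - by move=> I; apply: measurable_funM.
    - by move=> I w; apply: (b1 (fun w => expR (- \sum_b incr b w))).
    - by apply: aeW => w; exact: (@bnd_cvg (fun w => expR (- \sum_b incr b w)) w).
  have H2 : (\int[P]_w (bnd I w * zpow w)%:E)%E @[I --> \oo] --> (\int[P]_w (zpow w)%:E)%E.
    apply: h2 => //.
    - by move=> I; apply: measurable_funM.
    - by move=> I w; apply: (b1 zpow).
    - by apply: aeW => w; exact: (@bnd_cvg zpow w).
  apply: (cvg_unique _ H1) => //.
  by rewrite (_ : (fun I => _) = (fun I => \int[P]_w (bnd I w * zpow w)%:E)%E)//; exact/funext.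
have indN : mutual_indep P (fun b => sigma_gen (fun t => N b ^~ t)).
  by apply: (@mutual_indep_inj _ _ _ P bool _ _ inl) ind => x y [].
rewrite (poisson_system_pgf _ _ hN indN g01); congr EFin.
rewrite -sumrN expR_sum; apply: eq_bigr => b _.
rewrite -sumrN expR_sum; apply: eq_bigr => k _; congr expR.
ring.
Qed.

End compound_poisson.

Lemma compound_poisson_laplace_system d (T : measurableType d) (R : realType)
    (P : probability T R) (N : bool -> T -> R -> R) (Y : bool -> nat -> T -> R)
    (r : R) (g : R -> R) :
  (forall b, poisson_process P r (N b)) ->
  (forall b i, measurable_fun setT (Y b i)) -> (forall b i w, 0 <= Y b i w) ->
  (forall b i a, 0 <= a -> (\int[P]_w (expR (- (a * Y b i w)))%:E)%E = (g a)%:E) ->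
  mutual_indep P (fun c : bool + (bool * nat) =>
     match c with
     | inl b => sigma_gen (fun t : R => N b ^~ t)
     | inr bi => sigma_gen (fun _ : unit => Y bi.1 bi.2)
     end) ->
  laplace_system P (fun b w s => cp_path (N b w) (fun i => Y b i w) s)
    (fun _ x => r * (1 - g x)).
Proof.
move=> hN mY Y0 hg ind m K a a0.
apply: compound_poisson_grid_laplace => //.
move: ind; congr mutual_indep; apply/funext => -[b|bi] //.
Qed.

(** * Limits of shot noise functionals *)

Section means.
Context d (T : measurableType d) (R : realType) (P : probability T R).

(** [fine] would turn an infinite expectation into 0; [mean] is therefore applied to bounded
    functions, here transforms with values in [0, 1] and their differences. *)
Definition mean (f : T -> R) : R := fine (\int[P]_w (f w)%:E).

Lemma meanE (f : T -> R) : measurable_fun setT f -> (forall w, 0 <= f w <= 1) ->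
  (\int[P]_w (f w)%:E)%E = (mean f)%:E.
Proof. by move=> mf f01; rewrite fineK// integral_le1_fin_num. Qed.

Lemma mean_bounded_cvg (u : nat -> T -> R) (f : T -> R) :
  (forall n, measurable_fun setT (u n)) -> measurable_fun setT f ->
  (forall n w, 0 <= u n w <= 1) -> (forall w, 0 <= f w <= 1) ->
  (\forall w \ae P, u n w @[n --> \oo] --> f w) ->
  mean (u n) @[n --> \oo] --> mean f.
Proof.
move=> mu mf u01 f01 uf; apply: fine_cvg; rewrite -meanE//.
apply: ae_bounded_cvg => // n w; case/andP: (u01 n w) => u0 u1.
by rewrite ger0_norm.
Qed.

Lemma fatou_le (u : nat -> T -> R) (f : T -> R) (C : R) :
  (forall n, measurable_fun setT (u n)) -> (forall n w, 0 <= u n w) ->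
  (forall w, u n w @[n --> \oo] --> f w) ->
  (forall n, (\int[P]_w (u n w)%:E <= C%:E)%E) -> (\int[P]_w (f w)%:E <= C%:E)%E.
Proof.
move=> mu u0 uf uC.
have -> : (\int[P]_w (f w)%:E = \int[P]_w limn_einf (fun n => (u n w)%:E))%E.
  apply: eq_integral => w _.
  have : (u n w)%:E @[n --> \oo] --> (f w)%:E.
    by apply: cvg_EFin; [near=> n|exact: (uf w)].
  by move=> /cvg_limn_einf_sup[].
apply: (le_trans (fatou P measurableT _ _)).
- by move=> n; apply/measurable_EFinP.
- by move=> n w _; rewrite lee_fin.
rewrite limn_einf_lim; apply: lime_le; first exact: is_cvg_einfs.
near=> n; apply: le_trans (uC n).
by apply: ereal_inf_lbound; exists n => //=.
Unshelve. all: by end_near. Qed.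

(** The monotone limit always exists in the extended reals and has integral at most [C]; being
    integrable, it is finite almost everywhere, and there it is the real limit. *)
Lemma ae_cvgn_of_bounded_mean (V : nat -> T -> R) (C : R) :
  (forall n, measurable_fun setT (V n)) -> (forall n w, 0 <= V n w) ->
  (forall w, {homo V ^~ w : n m / (n <= m)%N >-> n <= m}) ->
  (forall n, (\int[P]_w (V n w)%:E <= C%:E)%E) ->
  (\forall w \ae P, cvgn (V ^~ w)) /\ (\int[P]_w (limn (V ^~ w))%:E <= C%:E)%E.
Proof.
move=> mV V0 ndV VC.
have mEV n : measurable_fun setT (EFin \o V n) by exact/measurable_EFinP.
pose S w := limn (fun n => (V n w)%:E).
have cS w : (V n w)%:E @[n --> \oo] --> S w.
  by apply: ereal_nondecreasing_is_cvgn => n m nm; rewrite lee_fin ndV.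
have mS : measurable_fun setT S.
  exact: (@emeasurable_fun_cvg _ _ _ _ (fun n w => (V n w)%:E)).
have S0 w : (0 <= S w)%E.
  by apply: lime_ge; [exact: cvgP (cS w)|near=> n; rewrite lee_fin].
have intS : (\int[P]_w S w <= C%:E)%E.
  rewrite (monotone_convergence P measurableT)//.
  - apply: lime_le; last by near=> n; exact: VC.
    apply: ereal_nondecreasing_is_cvgn => n m nm; apply: ge0_le_integral => //.
    + by move=> w _; rewrite lee_fin.
    + exact: mEV.
    + exact: mEV.
    + by move=> w _; rewrite lee_fin ndV.
  - by move=> n w _; rewrite lee_fin.
  - by move=> w _ n m nm; rewrite lee_fin ndV.
have iS : P.-integrable setT S.
  apply/integrableP; split => //; under eq_integral do rewrite gee0_abs//.
  by apply: (le_lt_trans intS); rewrite ltry.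
have finS : \forall w \ae P, S w \is a fin_num.
  by have := integrable_ae measurableT iS; apply: filterS => w; apply.
have cV w : S w \is a fin_num -> V n w @[n --> \oo] --> fine (S w).
  by move=> fS; have := cS w; rewrite -[X in _ --> X](fineK fS) => /fine_cvg.
split; first by apply: filterS finS => w /cV; exact: cvgP.
apply: le_trans intS; rewrite le_eqVlt; apply/orP; left; apply/eqP.
apply: ae_eq_integral => //.
  by apply/measurable_EFinP; exact: measurable_limn.
apply: filterS finS => w fS _ /=.
by rewrite (cvg_lim _ (cV w fS))// fineK.
Unshelve. all: by end_near. Qed.

End means.

Section chord.
Context {R : realType}.

(* [chord p x] increases to [x]; its mean is read off the Laplace transform *)
Definition chord (p : nat) (x : R) : R := p.+1%:R * (1 - expR (- (p.+1%:R^-1 * x))).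

Lemma chord_ge0 p x : 0 <= x -> 0 <= chord p x.
Proof.
move=> x0; rewrite mulr_ge0// subr_ge0 -[leRHS]expR0 ler_expR oppr_le0.
by rewrite mulr_ge0 ?invr_ge0.
Qed.

Lemma chord_le p x : chord p x <= x.
Proof.
have := expR_ge1Dx (- (p.+1%:R^-1 * x)) => h.
rewrite /chord -ler_pdivlMl// lerBlDl; apply: le_trans (lerD h (lexx _)).
by rewrite subrK.
Qed.

Lemma chord_cvg x : 0 <= x -> chord p x @[p --> \oo] --> x.
Proof.
move=> x0.
pose iv (p : nat) : R := p.+1%:R^-1.
have iv0 : iv p @[p --> \oo] --> 0 by exact: cvg_harmonic.
(* The lower bound is 1 - e^(-y) >= y / (1 + y) at y = x / (p + 1), which is e^y >= 1 + y
   rearranged. *)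
apply: (@squeeze_cvgr _ _ _ _ (fun p => x / (1 + iv p * x)) (fun=> x)).
- near=> p; rewrite chord_le andbT.
  have ip : 0 < iv p by rewrite invr_gt0.
  have y0 : 0 < 1 + iv p * x by rewrite ltr_pwDl// mulr_ge0// ltW.
  rewrite ler_pdivrMr// /chord -/(iv p).
  have -> : p.+1%:R = (iv p)^-1 by rewrite invrK.
  rewrite -mulrA ler_pdivlMl// mulrBl mul1r lerBrDr -lerBrDl [leRHS](_ : _ = 1); last by ring.
  by rewrite -ler_pdivlMr// div1r expRN lef_pV2 ?posrE ?expR_gt0// expR_ge1Dx.
- rewrite -[X in _ --> X]divr1; apply: cvgM; first exact: cvg_cst.
  apply: cvgV; first exact: oner_neq0.
  rewrite -[X in _ --> X]addr0; apply: cvgD; first exact: cvg_cst.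
  by rewrite -[X in _ --> X](mul0r x); apply: cvgMl.
- exact: cvg_cst.
Unshelve. all: by end_near. Qed.

End chord.

(** Monotonicity is kept apart, in [step_system]: the process with signed jumps has step paths, and
    that gives its measurability, while nonnegativity is reserved for absolute values. *)
Definition step_paths {d} {T : measurableType d} {R : realType} (I : finType)
    (L : I -> T -> R -> R) (nu : I -> T -> R -> nat) (g : I -> T -> nat -> R) :=
  [/\ forall e w, counting (nu e w),
      forall e w s, 0 <= s -> L e w s = g e w (nu e w s) &
      forall e s, 0 <= s -> measurable_fun setT (L e ^~ s)].

Definition step_system {d} {T : measurableType d} {R : realType} (I : finType)
    (L : I -> T -> R -> R) (nu : I -> T -> R -> nat) (g : I -> T -> nat -> R) :=
  step_paths L nu g /\ (forall e w i, g e w i <= g e w i.+1).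

Section step_paths_theory.
Context d (T : measurableType d) (R : realType) (I : finType).
Variables (L : I -> T -> R -> R) (nu : I -> T -> R -> nat) (g : I -> T -> nat -> R).
Hypothesis sp : step_paths L nu g.
Implicit Types h : I -> R -> R.

Definition shot h (n : nat) (w : T) : R := \sum_e asum (h e) (nu e w) (g e w) n.
Definition shot_grid h (n m : nat) (w : T) : R := \sum_e rsum (h e) (L e w) n m.

Lemma shot_grid_cvg h n w : (forall e, left_cts (h e)) ->
  shot_grid h n m w @[m --> \oo] --> shot h n w.
Proof.
have [cnu HL _] := sp => hl.
by apply: cvg_sumr => e; apply: rsum_cvg => // x x0; exact: HL.
Qed.

Lemma measurable_shot_grid h n m : measurable_fun setT (shot_grid h n m).
Proof.
have [_ _ mL] := sp.
apply: measurable_sum => e; apply: measurable_sum => k; apply: measurable_funM => //.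
by apply: measurable_funB; apply: mL; exact: grid_ge0.
Qed.

Lemma measurable_shot h n : (forall e, left_cts (h e)) -> measurable_fun setT (shot h n).
Proof.
move=> hl; apply: (@measurable_fun_cvg _ _ _ _ (shot_grid h n)).
  by move=> m; exact: measurable_shot_grid.
by move=> w _; exact: shot_grid_cvg.
Qed.

End step_paths_theory.

Section step_system_theory.
Context d (T : measurableType d) (R : realType) (P : probability T R) (I : finType).
Variables (L : I -> T -> R -> R) (nu : I -> T -> R -> nat) (g : I -> T -> nat -> R).
Hypothesis sys : step_system L nu g.
Implicit Types h : I -> R -> R.

Local Notation shot := (shot nu g).
Local Notation shot_grid := (shot_grid L).
Let sp := sys.1.

Lemma shot_ge0 h n w : (forall e s, 0 <= h e s) -> 0 <= shot h n w.
Proof.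
have [_ gm] := sys => h0.
by apply: sumr_ge0 => e _; apply: sumr_ge0 => i _; rewrite mulr_ge0 ?subr_ge0.
Qed.

Lemma shot_grid_ge0 h n m w : (forall e s, 0 <= h e s) -> 0 <= shot_grid h n m w.
Proof.
have [[cnu HL _] gm] := sys => h0.
have gmono e i j : (i <= j)%N -> g e w i <= g e w j.
  elim: j => [|j IH]; first by rewrite leqn0 => /eqP ->.
  by rewrite leq_eqVlt => /orP[/eqP -> //|/IH]; move/le_trans; apply.
apply: sumr_ge0 => e _; apply: sumr_ge0 => i _; rewrite mulr_ge0// subr_ge0.
rewrite !HL ?grid_ge0// gmono//.
by have [_ + _] := cnu e w; apply; [exact: grid_ge0|exact: le_grid].
Qed.

Lemma shot_nondecreasing h w : (forall e s, 0 <= h e s) ->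
  {homo (fun n => shot h n w) : n m / (n <= m)%N >-> n <= m}.
Proof.
have [[cnu _ _] gm] := sys => h0 n m nm.
apply: ler_sum => e _; rewrite /asum.
have nn : (nu e w n%:R <= nu e w m%:R)%N.
  by have [_ + _] := cnu e w; apply; rewrite ?ler0n ?ler_nat.
rewrite (big_ord_widen _ (fun i => h e (arrival (nu e w) i) * (g e w i.+1 - g e w i)) nn).
rewrite big_mkcond; apply: ler_sum => i _; case: ifP => // _.
by rewrite mulr_ge0 ?subr_ge0.
Qed.

Lemma shotZ c h n w : shot (fun e s => c * h e s) n w = c * shot h n w.
Proof.
rewrite /shot mulr_sumr; apply: eq_bigr => e _; rewrite /asum mulr_sumr.
by apply: eq_bigr => i _; rewrite mulrA.
Qed.

Lemma shot_sum (J : Type) (r : seq J) (c : J -> R) (hh : J -> I -> R -> R) n w :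
  shot (fun e s => \sum_(j <- r) c j * hh j e s) n w = \sum_(j <- r) c j * shot (hh j) n w.
Proof.
under [RHS]eq_bigr do rewrite -shotZ /shot.
rewrite exchange_big /=; apply: eq_bigr => e _; rewrite /asum exchange_big /=.
by apply: eq_bigr => i _; rewrite mulr_suml.
Qed.

Variable psi : I -> R -> R.
Hypothesis lap : laplace_system P L psi.

Definition grid_exponent h n m : R :=
  \sum_e \sum_(k < n * 2 ^ m) mesh m * psi e (h e (grid m k)).

Lemma expN_itv (x : R) : 0 <= x -> 0 <= expR (- x) <= 1.
Proof. by move=> x0; rewrite expR_ge0 /= -[leRHS]expR0 ler_expR oppr_le0. Qed.

Lemma measurable_expN (f : T -> R) : measurable_fun setT f ->
  measurable_fun setT (fun w => expR (- f w)).
Proof. by move=> mf; apply: measurableT_comp => //; apply: measurable_funN. Qed.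

Lemma shot_laplace h n : (forall e, left_cts (h e)) -> (forall e s, 0 <= h e s) ->
  expR (- grid_exponent h n m) @[m --> \oo] --> mean P (fun w => expR (- shot h n w)).
Proof.
move=> hl h0.
have -> : (fun m => expR (- grid_exponent h n m)) =
    (fun m => mean P (fun w => expR (- shot_grid h n m w))).
  apply/funext => m; rewrite /mean /shot_grid /rsum.
  by rewrite (@lap m (n * 2 ^ m)%N (fun e k => h e (grid m k)))//.
apply: mean_bounded_cvg.
- by move=> m; apply: measurable_expN; exact: (measurable_shot_grid sp).
- by apply: measurable_expN; exact: (measurable_shot sp).
- by move=> m w; apply: expN_itv; exact: shot_grid_ge0.
- by move=> w; apply: expN_itv; exact: shot_ge0.
- apply: aeW => w; apply: continuous_cvg; first exact: continuous_expR.
  by apply: cvgN; exact: (shot_grid_cvg sp).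
Qed.

Variable kappa : I -> R.
Hypothesis psi_le : forall e x, 0 <= x -> psi e x <= kappa e * x.
Hypothesis kappa0 : forall e, 0 <= kappa e.

(** A linear bound on the exponents gives a bound on the means of [chord p] that is uniform in [p];
    Fatou removes [p]. *)
Lemma shot_mean_le h (C : I -> R) n :
  (forall e, left_cts (h e)) -> (forall e s, 0 <= h e s) ->
  (forall e m, \sum_(k < n * 2 ^ m) mesh m * h e (grid m k) <= C e) ->
  (\int[P]_w (shot h n w)%:E <= (\sum_e kappa e * C e)%:E)%E.
Proof.
move=> hl h0 hC.
have mS := measurable_shot sp n hl.
have S0 w := shot_ge0 n w h0.
apply: (@fatou_le _ _ _ P (fun p w => chord p (shot h n w))).
- move=> p; apply: measurable_funM => //; apply: measurable_funB => //.
  by apply: measurable_expN; exact: measurable_funM.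
- by move=> p w; exact: chord_ge0.
- by move=> w; exact: chord_cvg.
move=> p; set c : R := p.+1%:R^-1.
have c0 : 0 <= c by rewrite invr_ge0.
have me : measurable_fun setT (fun w => expR (- (c * shot h n w))).
  by apply: measurable_expN; exact: measurable_funM.
have e01 w : 0 <= expR (- (c * shot h n w)) <= 1.
  by apply: expN_itv; rewrite mulr_ge0.
have -> : (\int[P]_w (chord p (shot h n w))%:E =
   (p.+1%:R * (1 - mean P (fun w => expR (- (c * shot h n w)))))%:E)%E.
  under eq_integral do rewrite EFinM.
  rewrite ge0_integralZl//=; last 2 first.
  - by apply/measurable_EFinP; apply: measurable_funB.
  - by move=> w _; rewrite lee_fin subr_ge0; case/andP: (e01 w).
  rewrite EFinM; congr (_ * _)%E.
  under eq_integral do rewrite EFinB.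
  rewrite integralB//=.
  - rewrite EFinB -meanE//; congr (_ - _)%E.
    rewrite [LHS](_ : _ = \int[P]_x (cst 1%:E x))%E// integral_cst//= mul1e.
    exact: probability_setT.
  - exact: (finite_measure_integrable_cst P 1).
  - apply/integrableP; split; first exact/measurable_EFinP.
    under eq_integral do rewrite gee0_abs ?lee_fin ?expR_ge0//.
    by rewrite meanE// ltry.
(* By e^(-x) >= 1 - x at the grid exponent. The factor [c] gained here cancels the [p.+1%:R] in
   front of the chord. *)
have hmean : 1 - c * \sum_e kappa e * C e <= mean P (fun w => expR (- (c * shot h n w))).
  have := @shot_laplace (fun e s => c * h e s) n.
  have hl' e : left_cts (fun s => c * h e s).
    by move=> s s0; apply: cvgMr; exact: (hl e s s0).
  have h0' e s : 0 <= c * h e s by rewrite mulr_ge0.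
  move=> /(_ hl' h0'); under [in X in _ --> X]eq_fun do rewrite shotZ.
  move=> hc; apply: (@ler_cvg_to _ \oo _ _ (fun=> 1 - c * \sum_e kappa e * C e) _ _ _ _ hc).
    exact: cvg_cst.
  near=> m; apply: (@le_trans _ _ (1 - grid_exponent (fun e s => c * h e s) n m)).
    rewrite lerD2l lerN2 /grid_exponent mulr_sumr; apply: ler_sum => e _.
    apply: (@le_trans _ _ (c * (kappa e * \sum_(k < n * 2 ^ m) mesh m * h e (grid m k)))).
      rewrite !mulr_sumr; apply: ler_sum => k _.
      apply: (@le_trans _ _ (mesh m * (kappa e * (c * h e (grid m k))))).
        by rewrite ler_wpM2l ?(ltW (mesh_gt0 m))// psi_le.
      by rewrite le_eqVlt; apply/orP; left; apply/eqP; ring.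
    by rewrite ler_wpM2l// ler_wpM2l.
  exact: expR_ge1Dx.
rewrite lee_fin -ler_pdivlMl// -/c lerBlDr addrC -lerBlDr.
exact: hmean.
Unshelve. all: by end_near. Qed.

End step_system_theory.

(** * Comparison with the superposition of DOU processes *)

Section kernels.
Context {R : realType}.

(** The index [true] carries the jumps at nonnegative times and [false] those of the reflected
    past. *)
Definition kernel (u : R) (b : bool) : R -> R := if b then hpos u else hneg u.

Lemma kernel_left_cts u b : left_cts (kernel u b).
Proof. by case: b; [exact: hpos_left_cts|exact: hneg_left_cts]. Qed.

Lemma kernel_ge0 u b s : 0 <= kernel u b s.
Proof. by case: b; rewrite /= ?/hpos ?/hneg; [case: ifP => _|]; rewrite ?expR_ge0. Qed.

Lemma half_le_1_expRN (x : R) : 0 <= x -> x <= 1 -> x <= 2 * (1 - expR (- x)).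
Proof.
move=> x0 x1; have y0 : 0 < 1 + x by rewrite ltr_wpDr.
have h : expR (- x) <= (1 + x)^-1.
  by rewrite expRN lef_pV2 ?posrE ?expR_gt0// expR_ge1Dx.
apply: (@le_trans _ _ (2 * (1 - (1 + x)^-1))); last by rewrite ler_pM2l// lerD2l lerN2.
have -> : 1 - (1 + x)^-1 = x / (1 + x) by field; rewrite gt_eqF.
rewrite mulrA ler_pdivlMr//; nra.
Qed.

(** The bound [u + 2] serves both halves: the future half is at most [u + 1], the cells starting
    before [u] lying in [0, u + 1]; the past half is at most 2, by comparison with twice a
    telescoping sum of exponentials. *)
Lemma kernel_mass u b n m : 0 <= u ->
  \sum_(k < n * 2 ^ m) mesh m * kernel u b (grid m k) <= u + 2.
Proof.
move=> u0; have m0 := @mesh_gt0 R m; have m1 := @mesh_le1 R m.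
set q := (n * 2 ^ m)%N; case: b => /=.
  (* A cell whose left end is at most [u] ends before [u + 1], since the mesh is at most 1; the
     minimum leaves such cells intact. *)
  pose f k : R := Num.min (grid m k) (u + 1).
  apply: (@le_trans _ _ (\sum_(k < q) (f k.+1 - f k))); last first.
    rewrite -(big_mkord xpredT (fun k => f k.+1 - f k)) telescope_sumr//.
    rewrite /f grid0 [Num.min 0 _]min_l ?addr_ge0// subr0.
    by rewrite ge_min lerD2l ler1n orbT.
  apply: ler_sum => k _; rewrite /hpos /f; case: ifPn => ku.
    rewrite !min_l ?gridS; last 2 first.
    - by rewrite (le_trans ku)// lerDl.
    - by rewrite lerD.
    rewrite [leRHS]addrAC subrr add0r ler_piMr// ?(ltW m0)//.
    by rewrite -[leRHS]expR0 ler_expR subr_le0.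
  rewrite mulr0 subr_ge0 gridS le_min ge_min ge_min lexx orbT andbT.
  by rewrite lerDl (ltW m0).
pose f k : R := - expR (- grid m k).
apply: (@le_trans _ _ (2 * \sum_(k < q) (f k.+1 - f k))); last first.
  rewrite -(big_mkord xpredT (fun k => f k.+1 - f k)) telescope_sumr//.
  rewrite /f grid0 oppr0 expR0 opprK mulrDr mulr1 lerD2r mulrN.
  by apply: le_trans u0; rewrite oppr_le0 mulr_ge0 ?expR_ge0.
rewrite mulr_sumr; apply: ler_sum => k _; rewrite /hneg /f opprK.
rewrite gridS opprD !expRD.
have := half_le_1_expRN (ltW m0) m1; have := @expR_ge0 R (- grid m k).
have : expR (- u) <= 1 by rewrite -[leRHS]expR0 ler_expR oppr_le0.
have := @expR_ge0 R (- u).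
move: m0; move: (mesh m) (expR (- mesh m)) (expR (- grid m k)) (expR (- u)) => s e c a s0 a0 a1 c0 h.
apply: (@le_trans _ _ (s * c)); first by rewrite ler_wpM2l ?(ltW s0)// ler_piMr.
have := ler_wpM2r c0 h; lra.
Qed.

End kernels.

Section step_instances.
Context d (T : measurableType d) (R : realType) (P : probability T R).

Lemma compound_poisson_step_paths (r : R) (N : bool -> T -> R -> R) (Y : bool -> nat -> T -> R) :
  (forall b, poisson_process P r (N b)) ->
  (forall b i, measurable_fun setT (Y b i)) ->
  step_paths (fun b w s => cp_path (N b w) (fun i => Y b i w) s)
   (fun b => count (N b)) (fun b w k => \sum_(i < k) Y b i w).
Proof.
move=> hN mY; split => //; first by move=> b w; exact: (poisson_counting (hN b)).
move=> b s s0; apply: measurable_cp_path => //.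
by case: (hN b).
Qed.

Lemma compound_poisson_step_system (r : R) (N : bool -> T -> R -> R) (Y : bool -> nat -> T -> R) :
  (forall b, poisson_process P r (N b)) ->
  (forall b i, measurable_fun setT (Y b i)) -> (forall b i w, 0 <= Y b i w) ->
  step_system (fun b w s => cp_path (N b w) (fun i => Y b i w) s)
   (fun b => count (N b)) (fun b w k => \sum_(i < k) Y b i w).
Proof.
move=> hN mY Y0; split; first exact: compound_poisson_step_paths hN mY.
by move=> b w i; rewrite big_ord_recr lerDl.
Qed.

Lemma poisson_step_system (I : finType) (N : I -> T -> R -> R) (r c : I -> R) :
  (forall e, 0 <= c e) -> (forall e, poisson_process P (r e) (N e)) ->
  step_system (fun e w s => c e * N e w s)
   (fun e => count (N e)) (fun e w k => c e * k%:R).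
Proof.
move=> c0 hN; split; last by move=> e w i; rewrite ler_wpM2l// ler_nat.
split; first by move=> b w; exact: (poisson_counting (hN b)).
- by move=> e w s s0; rewrite (poisson_natE (hN e)).
- by move=> e s s0; apply: measurable_funM => //; case: (hN e).
Qed.

Lemma XBT_shot (r lam t : R) (N : bool -> T -> R -> R) (Y : bool -> nat -> T -> R) w :
  (forall b, poisson_process P r (N b)) -> 0 <= lam * t ->
  XBT lam N Y t w = limn (fun n => shot (fun b => count (N b))
     (fun b w k => \sum_(i < k) Y b i w) (kernel (lam * t)) n w).
Proof.
move=> hN lt0; rewrite /XBT.
rewrite (@ou_integralE _ (count (N true) w) (count (N false) w)
  (fun k => \sum_(i < k) Y true i w) (fun k => \sum_(i < k) Y false i w)) ?big_ord0//.
- by congr (limn _); apply/funext => n; rewrite /shot big_bool.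
- exact: (poisson_counting (hN true)).
- exact: (poisson_counting (hN false)).
Qed.

Lemma DOU_shot (r lam t a : R) (N : bool -> T -> R -> R) w :
  (forall b, poisson_process P r (N b)) -> 0 <= lam * t ->
  DOU lam a N t w = limn (fun n => shot (fun b : bool => count (N b))
     (fun b w k => a * k%:R) (kernel (lam * t)) n w).
Proof.
move=> hN lt0; rewrite /DOU.
rewrite (@ou_integralE _ (count (N true) w) (count (N false) w)
  (fun k => a * k%:R) (fun k => a * k%:R)) ?mulr0//.
- by congr (limn _); apply/funext => n; rewrite /shot big_bool.
- exact: (poisson_counting (hN true)).
- exact: (poisson_counting (hN false)).
- by move=> x x0; rewrite (poisson_natE (hN true)).
- by move=> x x0; rewrite (poisson_natE (hN false)).
Qed.

End step_instances.

(** * The Laplace exponent as a superposition *)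

Section bell_touchard_exponent.
Context {R : realType}.
Variables alpha nu : R.
Hypotheses (halpha : 0 < alpha) (hnu : 0 < nu).

Definition bt_exponent (x : R) : R := alpha * (expR nu - expR (nu * expR (- x))).
(** Index [j] stands for jump size [j.+1], so that sums over components start at 0. *)
Definition rate (j : nat) : R := alpha * nu ^+ j.+1 / j.+1`!%:R.
Definition dou_exponent (j : nat) (x : R) : R := rate j * (1 - expR (- (j.+1%:R * x))).
Definition dou_mean (j : nat) : R := rate j * j.+1%:R.
(** The sum of [dou_mean j] over j >= J, written as total minus partial sum. The total comes from
    the exponential series, since the factor j + 1 cancels against the factorial in the rate. *)
Definition mean_tail (J : nat) : R := alpha * nu * expR nu - \sum_(j < J) dou_mean j.

Lemma rate_ge0 j : 0 <= rate j.
Proof. by rewrite /rate !mulr_ge0 ?invr_ge0 ?exprn_ge0// ltW. Qed.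

Lemma dou_mean_ge0 j : 0 <= dou_mean j.
Proof. by rewrite mulr_ge0 ?rate_ge0. Qed.

Lemma dou_exponent_ge0 j x : 0 <= x -> 0 <= dou_exponent j x.
Proof.
move=> x0; rewrite mulr_ge0 ?rate_ge0// subr_ge0 -[leRHS]expR0 ler_expR oppr_le0.
by rewrite mulr_ge0.
Qed.

Lemma dou_exponent_le j x : dou_exponent j x <= dou_mean j * x.
Proof.
rewrite /dou_exponent /dou_mean -mulrA ler_wpM2l ?rate_ge0//.
by have := expR_ge1Dx (- (j.+1%:R * x)); lra.
Qed.

(** The inequality 1 - e^(-y) <= y is used twice, at y = nu (1 - e^(-x)) and at y = x. *)
Lemma bt_exponent_le x : bt_exponent x <= alpha * nu * expR nu * x.
Proof.
rewrite /bt_exponent -!mulrA ler_pM2l//.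
have -> : nu * expR (- x) = nu + (- (nu * (1 - expR (- x)))) by ring.
rewrite expRD; have e0 := @expR_gt0 R nu.
have h1 := expR_ge1Dx (- (nu * (1 - expR (- x)))).
have h2 := expR_ge1Dx (- x).
rewrite mulrCA -[X in X - _]mulr1 -mulrBr ler_pM2l//.
apply: (@le_trans _ _ (nu * (1 - expR (- x)))); first lra.
by rewrite ler_pM2l//; lra.
Qed.

Lemma dou_meanE j : dou_mean j = alpha * nu * (nu ^+ j / j`!%:R).
Proof.
have h1 : j.+1%:R != 0 :> R by rewrite pnatr_eq0.
have h2 : j`!%:R != 0 :> R by rewrite pnatr_eq0 -lt0n fact_gt0.
rewrite /dou_mean /rate factS natrM exprS.
move: (j.+1%:R) (j`!%:R) (nu ^+ j) h1 h2 => x y z h1 h2.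
by field; rewrite h1 h2.
Qed.

Lemma dou_exponent_series x :
  \sum_(j < J) dou_exponent j x @[J --> \oo] --> bt_exponent x.
Proof.
have h1 := exp_pos_series_cvg nu.
have h2 := exp_pos_series_cvg (nu * expR (- x)).
have -> : (fun J => \sum_(j < J) dou_exponent j x) = (fun J =>
   alpha * (series (fun n => nu ^+ n.+1 / n.+1`!%:R) J -
            series (fun n => (nu * expR (- x)) ^+ n.+1 / n.+1`!%:R) J)).
  apply/funext => J; rewrite /series /= !big_mkord -sumrB mulr_sumr.
  apply: eq_bigr => j _; rewrite /dou_exponent /rate exprMn -mulrN -expRM_natl.
  by rewrite mulrBr mulr1 -!mulrA -mulrBr; congr (_ * (_ - _ * _)); rewrite mulrC.
rewrite /bt_exponent (_ : expR nu - expR (nu * expR (- x)) =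
  expR nu - 1 - (expR (nu * expR (- x)) - 1)); last by ring.
by apply: cvgMr; apply: cvgB.
Qed.

Lemma mean_tail_cvg : mean_tail J @[J --> \oo] --> 0.
Proof.
rewrite -(subrr (alpha * nu * expR nu)); apply: cvgB; first exact: cvg_cst.
have -> : (fun J => \sum_(j < J) dou_mean j) = (fun J =>
   alpha * nu * series (fun n => nu ^+ n / n`!%:R) J).
  apply/funext => J; rewrite /series /= big_mkord mulr_sumr.
  by apply: eq_bigr => j _; rewrite dou_meanE.
by apply: cvgMr; exact: exp_series_cvg.
Qed.

Lemma mean_tail_ge J q : (J <= q)%N -> \sum_(J <= j < q) dou_mean j <= mean_tail J.
Proof.
move=> Jq; rewrite /mean_tail lerBrDl -(big_mkord xpredT) -big_cat_nat//=.
have h : \sum_(j < n) dou_mean j @[n --> \oo] --> alpha * nu * expR nu.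
  rewrite (_ : (fun n => _) = (fun n => alpha * nu * expR nu - mean_tail n)).
    rewrite -[X in _ --> X]subr0; apply: cvgB; [exact: cvg_cst|exact: mean_tail_cvg].
  by apply/funext => n; rewrite /mean_tail subKr.
rewrite big_mkord.
apply: (@ler_cvg_to _ \oo _ _ (fun=> \sum_(j < q) dou_mean j) _ _ _ _ h); first exact: cvg_cst.
near=> n; have qn : (q <= n)%N by near: n; exact: nbhs_infty_ge.
rewrite (big_ord_widen _ (fun j => dou_mean j) qn) big_mkcond; apply: ler_sum => i _.
by case: ifP => // _; exact: dou_mean_ge0.
Unshelve. all: by end_near. Qed.

Lemma bt_exponent_tail J x : 0 <= x ->
  0 <= bt_exponent x - \sum_(j < J) dou_exponent j x <= mean_tail J * x.
Proof.
move=> x0.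
have h : \sum_(j < n) dou_exponent j x - \sum_(j < J) dou_exponent j x @[n --> \oo] -->
   bt_exponent x - \sum_(j < J) dou_exponent j x.
  by apply: cvgB; [exact: dou_exponent_series|exact: cvg_cst].
have E n : (J <= n)%N -> \sum_(j < n) dou_exponent j x - \sum_(j < J) dou_exponent j x =
   \sum_(J <= j < n) dou_exponent j x.
  move=> Jn; rewrite -!(big_mkord xpredT (fun j => dou_exponent j x)).
  by rewrite (@big_cat_nat _ _ _ J)//= addrAC subrr add0r.
apply/andP; split.
  apply: (@ler_cvg_to _ \oo _ _ (fun=> 0) _ _ _ _ h); first exact: cvg_cst.
  near=> n; rewrite E; last by near: n; exact: nbhs_infty_ge.
  by apply: sumr_ge0 => j _; exact: dou_exponent_ge0.
apply: (@ler_cvg_to _ \oo _ _ _ (fun=> mean_tail J * x) _ _ h); first exact: cvg_cst.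
near=> n; have Jn : (J <= n)%N by near: n; exact: nbhs_infty_ge.
rewrite E//; apply: (@le_trans _ _ ((\sum_(J <= j < n) dou_mean j) * x)).
  by rewrite mulr_suml; apply: ler_sum => j _; exact: dou_exponent_le.
by rewrite ler_wpM2r// mean_tail_ge.
Unshelve. all: by end_near. Qed.

End bell_touchard_exponent.

(** A divergent sequence receives the default value 0, so nonnegativity holds on every path,
    including those where the limit fails to exist. *)
Lemma limn_ge0 {R : realType} (u : nat -> R) : (forall n, 0 <= u n) -> 0 <= limn u.
Proof.
move=> u0; case: (pselect (cvgn u)) => [cu|/dvgP ->]; last by [].
by apply: limr_ge => //; near=> n.
Unshelve. all: by end_near. Qed.

Lemma cvgn_dist_le {R : realType} (f g b : nat -> R) (x y z : R) :
  f @ \oo --> x -> g @ \oo --> y -> b @ \oo --> z ->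
  (\forall n \near \oo, `|f n - g n| <= b n) -> `|x - y| <= z.
Proof.
move=> fx gy bz fgb.
have h : `|f n - g n| @[n --> \oo] --> `|x - y| by apply: cvg_norm; exact: cvgB.
exact: (ler_cvg_to h bz fgb).
Qed.

Section kernel_limits.
Context d (T : measurableType d) (R : realType) (P : probability T R).
Variables (L : bool -> T -> R -> R) (nu : bool -> T -> R -> nat) (g : bool -> T -> nat -> R).
Variables (psi : bool -> R -> R) (kappa : R).
Hypotheses (sys : step_system L nu g) (lap : laplace_system P L psi).
Hypotheses (psi_le : forall b x, 0 <= x -> psi b x <= kappa * x) (kappa0 : 0 <= kappa).

Definition kernel_limit (nu1 : bool -> T -> R -> nat) (g1 : bool -> T -> nat -> R) u w :=
  limn (fun n => shot nu1 g1 (kernel u) n w).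

Lemma kernel_limit_ge0 u w : 0 <= kernel_limit nu g u w.
Proof. by apply: limn_ge0 => n; apply: (shot_ge0 sys) => b s; exact: kernel_ge0. Qed.

Lemma measurable_kernel_limit u : measurable_fun setT (kernel_limit nu g u).
Proof.
apply: measurable_limn => n; apply: (measurable_shot sys.1) => b.
exact: kernel_left_cts.
Qed.

(** Truncated shot noise increases with the horizon, and each of the two time directions has kernel
    mass at most [u + 2]. *)
Lemma kernel_limit_ae u : 0 <= u ->
  (\forall w \ae P, shot nu g (kernel u) n w @[n --> \oo] --> kernel_limit nu g u w) /\
  (\int[P]_w (kernel_limit nu g u w)%:E <= (kappa * (2 * (u + 2)))%:E)%E.
Proof.
move=> u0; apply: (ae_cvgn_of_bounded_mean (V := fun n w => shot nu g (kernel u) n w)).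
- by move=> n; apply: (measurable_shot sys.1) => b; exact: kernel_left_cts.
- by move=> n w; apply: (shot_ge0 sys) => b s; exact: kernel_ge0.
- by move=> w; apply: (shot_nondecreasing sys) => b s; exact: kernel_ge0.
move=> n; have := @shot_mean_le _ _ _ _ _ _ _ _ sys _ lap (fun=> kappa) psi_le
  (fun=> kappa0) (kernel u) (fun=> u + 2) n.
rewrite (_ : \sum_(b : bool) kappa * (u + 2) = kappa * (2 * (u + 2))); last first.
  by rewrite big_bool /=; ring.
apply.
- by move=> b; exact: kernel_left_cts.
- by move=> b s; exact: kernel_ge0.
- by move=> b m; exact: kernel_mass.
Qed.

End kernel_limits.

Lemma expRN_lip {R : realType} (a b : R) : 0 <= a -> a <= b ->
  `|expR (- b) - expR (- a)| <= b - a.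
Proof.
move=> a0 ab; rewrite distrC ger0_norm ?subr_ge0 ?ler_expR ?lerN2//.
have -> : - b = - a + - (b - a) by ring.
rewrite expRD -[X in X - _]mulr1 -mulrBr.
have h := expR_ge1Dx (- (b - a)).
apply: (@le_trans _ _ (1 * (1 - expR (- (b - a))))); last lra.
rewrite ler_wpM2r//.
  by rewrite subr_ge0 -[leRHS]expR0 ler_expR oppr_le0 subr_ge0.
by rewrite -[leRHS]expR0 ler_expR oppr_le0.
Qed.

(** * Equality of the joint Laplace transforms *)

Section laplace_comparison.
Context d d' (T : measurableType d) (T' : measurableType d') (R : realType)
  (P : probability T R) (P' : probability T' R).
Variables (alpha nu : R).
Hypotheses (halpha : 0 < alpha) (hnu : 0 < nu).
Variables (L : bool -> T -> R -> R) (nu1 : bool -> T -> R -> nat) (g1 : bool -> T -> nat -> R).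
Hypotheses (sys : step_system L nu1 g1)
  (lap : laplace_system P L (fun _ => bt_exponent alpha nu)).
Variable M : nat -> bool -> T' -> R -> R.
Hypotheses (hM : forall j b, poisson_process P' (rate alpha nu j) (M j b))
  (ind : mutual_indep P' (fun jb : nat * bool => sigma_gen (fun t : R => M jb.1 jb.2 ^~ t))).

Let nu2 j (b : bool) := count (M j b).
Let g2 j (b : bool) (w : T') (k : nat) : R := j.+1%:R * k%:R.

(** The first [J] components in both time directions form one finite system, so the transform of the
    truncated superposition comes from a single computation. *)
Let sysJ J := @poisson_step_system _ T' R P' ('I_J * bool)%type
  (fun e => M e.1 e.2) (fun e => rate alpha nu e.1) (fun e => e.1.+1%:R)
  (fun e => ler0n R _) (fun e => hM e.1 e.2).

Let lapJ J := @poisson_laplace_system _ T' R P' ('I_J * bool)%type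
  (fun e => M e.1 e.2) (fun e => rate alpha nu e.1) (fun e => e.1.+1%:R)
  (fun e => ler0n R _) (fun e => hM e.1 e.2).

Let indJ J : mutual_indep P' (fun e : 'I_J * bool => sigma_gen (fun t => M e.1 e.2 ^~ t)).
Proof.
apply: (@mutual_indep_inj _ T' R P' ('I_J * bool)%type _
  (fun jb : nat * bool => sigma_gen (fun t : R => M jb.1 jb.2 ^~ t))
  (fun e => (val e.1, e.2))) => //.
by move=> [i b] [j b'] /= [/val_inj -> ->].
Qed.

Let sys2 j := @poisson_step_system _ T' R P' bool
  (M j) (fun=> rate alpha nu j) (fun=> j.+1%:R) (fun=> ler0n R _) (hM j).

Let lap2 j : laplace_system P' (fun b w s => j.+1%:R * M j b w s)
   (fun _ => dou_exponent alpha nu j).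
Proof.
have i2 : mutual_indep P' (fun b => sigma_gen (fun t => M j b ^~ t)).
  apply: (@mutual_indep_inj _ T' R P' bool _
    (fun jb : nat * bool => sigma_gen (fun t : R => M jb.1 jb.2 ^~ t)) (fun b => (j, b))) => //.
  by move=> b b' [].
exact: (@poisson_laplace_system _ T' R P' bool (M j) (fun=> rate alpha nu j)
  (fun=> j.+1%:R) (fun=> ler0n R _) (hM j) i2).
Qed.

Let shotJ J (h : bool -> R -> R) n w :
  shot (fun e : 'I_J * bool => count (M e.1 e.2))
    (fun e _ k => e.1.+1%:R * k%:R) (fun e => h e.2) n w =
  \sum_(j < J) shot (nu2 j) (g2 j) h n w.
Proof. by rewrite /shot pair_big_dep. Qed.

(** Cell by cell the two exponents differ by at most [mean_tail] times the kernel value, and e^(-x)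
    is 1-Lipschitz for x >= 0. The bound involves the kernel only through its mass [C]. *)
Lemma laplace_gap J (h : bool -> R -> R) (C : R) n :
  (forall b, left_cts (h b)) -> (forall b s, 0 <= h b s) ->
  (forall m, \sum_b \sum_(k < n * 2 ^ m) mesh m * h b (grid m k) <= C) ->
  `|mean P (fun w => expR (- shot nu1 g1 h n w)) -
    mean P' (fun w => expR (- \sum_(j < J) shot (nu2 j) (g2 j) h n w))| <=
  mean_tail alpha nu J * C.
Proof.
move=> hl h0 hC.
have l1 := @shot_laplace _ T R P bool L nu1 g1 sys _ lap h n hl h0.
have l2 : expR (- grid_exponent
      (fun (e : 'I_J * bool) x => rate alpha nu e.1 * (1 - expR (- (e.1.+1%:R * x))))
      (fun e => h e.2) n m) @[m --> \oo] -->
    mean P' (fun w => expR (- \sum_(j < J) shot (nu2 j) (g2 j) h n w)).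
  rewrite [X in mean _ X](_ : _ = fun w => expR (- shot (fun e : 'I_J * bool => count (M e.1 e.2))
    (fun e _ k => e.1.+1%:R * k%:R) (fun e => h e.2) n w)).
    exact: (@shot_laplace _ T' R P' _ _ _ _ (sysJ J) _ (@lapJ J (@indJ J))
      (fun e => h e.2) n (fun e => hl e.2) (fun e => h0 e.2)).
  by apply/funext => w; rewrite shotJ.
apply: (cvgn_dist_le l1 l2 (@cvg_cst _ (mean_tail alpha nu J * C) _ _ _)).
near=> m.
have -> : grid_exponent (fun e : 'I_J * bool => fun x => rate alpha nu e.1 * (1 - expR (- (e.1.+1%:R * x))))
    (fun e => h e.2) n m =
  \sum_b \sum_(k < n * 2 ^ m) mesh m * \sum_(j < J) dou_exponent alpha nu j (h b (grid m k)).
  rewrite /grid_exponent.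
  transitivity (\sum_(j < J) \sum_b \sum_(k < n * 2 ^ m) mesh m * dou_exponent alpha nu j (h b (grid m k))).
    by rewrite [RHS]pair_big_dep.
  rewrite exchange_big; apply: eq_bigr => b _; rewrite exchange_big; apply: eq_bigr => k _.
  by rewrite mulr_sumr.
have m0 := ltW (@mesh_gt0 R m).
have tl b k := bt_exponent_tail halpha hnu J (h0 b (grid m k)).
apply: le_trans (expRN_lip _ _) _.
- apply: sumr_ge0 => b _; apply: sumr_ge0 => k _; rewrite mulr_ge0// sumr_ge0// => j _.
  exact: dou_exponent_ge0.
- apply: ler_sum => b _; apply: ler_sum => k _; rewrite ler_wpM2l//.
  by have /andP[+ _] := tl b k; rewrite subr_ge0.
have mt0 : 0 <= mean_tail alpha nu J.
  have := bt_exponent_tail halpha hnu J (@ler01 R).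
  by rewrite mulr1 => /andP[]; exact: le_trans.
apply: le_trans (ler_wpM2l mt0 (hC m)).
rewrite /grid_exponent -sumrB mulr_sumr; apply: ler_sum => b _.
rewrite -sumrB mulr_sumr; apply: ler_sum => k _.
rewrite -mulrBr mulrCA ler_wpM2l//.
by have /andP[_] := tl b k.
Unshelve. all: by end_near. Qed.

Variables (q : nat) (c u : 'I_q -> R).
Hypotheses (c0 : forall i, 0 <= c i) (u0 : forall i, 0 <= u i).

(** By linearity the joint transform at [q] times is the transform of a single shot noise with this
    combined kernel. *)
Let h b s := \sum_(i < q) c i * kernel (u i) b s.

Let hl b : left_cts (h b).
Proof. by move=> s s0; apply: cvg_sumr => i; apply: cvgMr; exact: kernel_left_cts. Qed.

Let h0 b s : 0 <= h b s.
Proof. by apply: sumr_ge0 => i _; rewrite mulr_ge0// kernel_ge0. Qed.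

Let C := \sum_(b : bool) \sum_(i < q) c i * (u i + 2).

Let hC n m : \sum_b \sum_(k < n * 2 ^ m) mesh m * h b (grid m k) <= C.
Proof.
apply: ler_sum => b _; rewrite /h; under eq_bigr do rewrite mulr_sumr.
rewrite exchange_big; apply: ler_sum => i _.
under eq_bigr do rewrite mulrCA.
by rewrite -mulr_sumr ler_wpM2l// kernel_mass.
Qed.

Let W1 w := \sum_(i < q) c i * kernel_limit nu1 g1 (u i) w.
Let W2 J w := \sum_(i < q) c i * \sum_(j < J) kernel_limit (nu2 j) (g2 j) (u i) w.

Let K := alpha * nu * expR nu.
Let K0 : 0 <= K. Proof. by rewrite !mulr_ge0 ?expR_ge0// ltW. Qed.

Let ae1 v : 0 <= v ->
  (\forall w \ae P, shot nu1 g1 (kernel v) n w @[n --> \oo] --> kernel_limit nu1 g1 v w).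
Proof.
move=> uu; have [] := kernel_limit_ae sys lap (kappa := K) _ K0 uu => //.
by move=> b x _; exact: bt_exponent_le.
Qed.

Let ae2 j v : 0 <= v ->
  (\forall w \ae P', shot (nu2 j) (g2 j) (kernel v) n w @[n --> \oo] --> kernel_limit (nu2 j) (g2 j) v w) /\
  (\int[P']_w (kernel_limit (nu2 j) (g2 j) v w)%:E <= (dou_mean alpha nu j * (2 * (v + 2)))%:E)%E.
Proof.
move=> uu; apply: (kernel_limit_ae (sys2 j) (@lap2 j) _ _ uu).
  by move=> b x _; exact: dou_exponent_le.
exact: dou_mean_ge0.
Qed.

Let W1_ge0 w : 0 <= W1 w.
Proof. by apply: sumr_ge0 => i _; rewrite mulr_ge0// (kernel_limit_ge0 sys). Qed.

Let W2_ge0 J w : 0 <= W2 J w.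
Proof.
apply: sumr_ge0 => i _; rewrite mulr_ge0// sumr_ge0// => j _.
exact: (kernel_limit_ge0 (sys2 j)).
Qed.

Let mW1 : measurable_fun setT W1.
Proof.
apply: measurable_sum => i; apply: measurable_funM => //.
exact: (measurable_kernel_limit sys).
Qed.

Let mW2 J : measurable_fun setT (W2 J).
Proof.
apply: measurable_sum => i; apply: measurable_funM => //; apply: measurable_sum => j.
exact: (measurable_kernel_limit (sys2 j)).
Qed.

Let limit1 : mean P (fun w => expR (- shot nu1 g1 h n w)) @[n --> \oo] -->
  mean P (fun w => expR (- W1 w)).
Proof.
apply: mean_bounded_cvg.
- by move=> n; apply: measurable_expN; exact: (measurable_shot sys.1).
- exact: measurable_expN.
- by move=> n w; apply: expN_itv; exact: (shot_ge0 sys).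
- by move=> w; exact: expN_itv.
have H : \forall w \ae P, forall i, shot nu1 g1 (kernel (u i)) n w @[n --> \oo] --> kernel_limit nu1 g1 (u i) w.
  by apply: filter_forall => i; exact: ae1.
apply: filterS H => w aew.
apply: continuous_cvg; first exact: continuous_expR.
apply: cvgN; under eq_fun do rewrite /h shot_sum.
by apply: cvg_sumr => i; apply: cvgMr; exact: aew.
Qed.

Let limit2 J : mean P' (fun w => expR (- \sum_(j < J) shot (nu2 j) (g2 j) h n w)) @[n --> \oo] -->
  mean P' (fun w => expR (- W2 J w)).
Proof.
apply: mean_bounded_cvg.
- move=> n; apply: measurable_expN; apply: measurable_sum => j.
  exact: (measurable_shot (sys2 j).1).
- exact: measurable_expN.
- move=> n w; apply: expN_itv; apply: sumr_ge0 => j _; exact: (shot_ge0 (sys2 j)).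
- by move=> w; exact: expN_itv.
have H : \forall w \ae P', forall p : 'I_q * 'I_J,
    shot (nu2 p.2) (g2 p.2) (kernel (u p.1)) n w @[n --> \oo] --> kernel_limit (nu2 p.2) (g2 p.2) (u p.1) w.
  by apply: filter_forall => p; have [] := ae2 p.2 (u0 p.1).
apply: filterS H => w aew.
apply: continuous_cvg; first exact: continuous_expR.
apply: cvgN; rewrite /W2.
under [X in _ --> X]eq_bigr do rewrite mulr_sumr.
rewrite exchange_big /=; apply: cvg_sumr => j.
under eq_fun do rewrite /h shot_sum.
by apply: cvg_sumr => i; apply: cvgMr; exact: (aew (i, j)).
Qed.

Lemma laplace_limit_gap J :
  `|mean P (fun w => expR (- W1 w)) - mean P' (fun w => expR (- W2 J w))| <=
  mean_tail alpha nu J * C.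
Proof.
apply: (cvgn_dist_le limit1 (@limit2 J) (@cvg_cst _ (mean_tail alpha nu J * C) _ _ _)).
by near=> n; exact: laplace_gap.
Unshelve. all: by end_near. Qed.

Let Z v w := limn (fun J => \sum_(j < J) kernel_limit (nu2 j) (g2 j) v w).

(** The partial sums increase in [J], and their means stay below a constant because the [dou_mean j]
    sum to at most [K]. *)
Lemma series_kernel_limit_ae v : 0 <= v ->
  \forall w \ae P', \sum_(j < J) kernel_limit (nu2 j) (g2 j) v w @[J --> \oo] --> Z v w.
Proof.
move=> v0.
have mk j := measurable_kernel_limit (sys2 j) v.
have k0 j w := kernel_limit_ge0 (sys2 j) v w.
have [] // := @ae_cvgn_of_bounded_mean _ _ _ P'
  (fun J w => \sum_(j < J) kernel_limit (nu2 j) (g2 j) v w) (K * (2 * (v + 2))).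
- by move=> J; apply: measurable_sum => j; exact: mk.
- by move=> J w; apply: sumr_ge0 => j _; exact: k0.
- move=> w J J' JJ'.
  rewrite (big_ord_widen _ (fun j => kernel_limit (nu2 j) (g2 j) v w) JJ') big_mkcond.
  by apply: ler_sum => j _; case: ifP => // _; exact: k0.
move=> J; under eq_integral do rewrite -sumEFin.
rewrite ge0_integral_sum//; last 2 first.
- by move=> j; apply/measurable_EFinP; exact: mk.
- by move=> j w _; rewrite lee_fin; exact: k0.
apply: (@le_trans _ _ (\sum_(j < J) (dou_mean alpha nu j * (2 * (v + 2)))%:E)%E).
  by apply: lee_sum => j _; have [] := ae2 j v0.
rewrite sumEFin lee_fin -mulr_suml ler_wpM2r ?mulr_ge0 ?addr_ge0//.
have := mean_tail_ge halpha hnu (leqnn J); rewrite big_geq// /mean_tail subr_ge0.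
by apply.
Qed.

Lemma series_laplace_eq :
  mean P (fun w => expR (- \sum_(i < q) c i * kernel_limit nu1 g1 (u i) w)) =
  mean P' (fun w => expR (- \sum_(i < q) c i * Z (u i) w)).
Proof.
have mZ v : measurable_fun setT (Z v).
  apply: measurable_limn => J; apply: measurable_sum => j.
  exact: (measurable_kernel_limit (sys2 j)).
have Z0 v w : 0 <= Z v w.
  by apply: limn_ge0 => J; apply: sumr_ge0 => j _; exact: (kernel_limit_ge0 (sys2 j)).
have l2 : mean P' (fun w => expR (- W2 J w)) @[J --> \oo] -->
    mean P' (fun w => expR (- \sum_(i < q) c i * Z (u i) w)).
  apply: mean_bounded_cvg.
  - by move=> J; exact: measurable_expN.
  - apply: measurable_expN; apply: measurable_sum => i; exact: measurable_funM.
  - by move=> J w; exact: expN_itv.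
  - by move=> w; apply: expN_itv; apply: sumr_ge0 => i _; rewrite mulr_ge0.
  have H : \forall w \ae P', forall i,
      \sum_(j < J) kernel_limit (nu2 j) (g2 j) (u i) w @[J --> \oo] --> Z (u i) w.
    by apply: filter_forall => i; exact: series_kernel_limit_ae.
  apply: filterS H => w aew.
  apply: continuous_cvg; first exact: continuous_expR.
  by apply: cvgN; apply: cvg_sumr => i; apply: cvgMr; exact: aew.
have l4 : mean_tail alpha nu J * C @[J --> \oo] --> 0 * C.
  by apply: cvgMl; exact: mean_tail_cvg.
have : `|mean P (fun w => expR (- W1 w)) - mean P' (fun w => expR (- \sum_(i < q) c i * Z (u i) w))| <= 0 * C.
  apply: (cvgn_dist_le (@cvg_cst _ _ _ _ _) l2 l4); near=> J; exact: laplace_limit_gap.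
by rewrite mul0r normr_le0 subr_eq0 => /eqP.
Unshelve. all: by end_near. Qed.

End laplace_comparison.

(** * Uniqueness of joint Laplace transforms *)

Section one_dimensional_uniqueness.
Context d d' (T : measurableType d) (T' : measurableType d') (R : realType)
  (P : probability T R) (P' : probability T' R).

Lemma integrable_itv01 (dd : measure_display) (TT : measurableType dd) (Q : probability TT R)
  (f : TT -> R) : measurable_fun setT f -> (forall w, 0 <= f w <= 1) ->
  Q.-integrable setT (EFin \o f).
Proof.
move=> mf f01; apply/integrableP; split; first exact/measurable_EFinP.
under eq_integral => w _ do rewrite /= ger0_norm ?(proj1 (andP (f01 w)))//.
by rewrite meanE// ltry.
Qed.

Lemma meanB (dd : measure_display) (TT : measurableType dd) (Q : probability TT R)
  (f g : TT -> R) : measurable_fun setT f -> measurable_fun setT g ->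
  (forall w, 0 <= f w <= 1) -> (forall w, 0 <= g w <= 1) ->
  mean Q (fun w => f w - g w) = mean Q f - mean Q g.
Proof.
move=> mf mg f01 g01; rewrite /mean.
under eq_integral do rewrite EFinB.
rewrite integralB//=; [|exact: integrable_itv01|exact: integrable_itv01].
by rewrite !meanE.
Qed.

Variables (X G : T -> R) (X' G' : T' -> R).
Hypotheses (mX : measurable_fun setT X) (mX' : measurable_fun setT X')
  (mG : measurable_fun setT G) (mG' : measurable_fun setT G')
  (X0 : forall w, 0 <= X w) (X0' : forall w, 0 <= X' w)
  (G01 : forall w, 0 <= G w <= 1) (G01' : forall w, 0 <= G' w <= 1).
Hypothesis same_laplace : forall c, 0 <= c ->
  mean P (fun w => expR (- (c * X w)) * G w) = mean P' (fun w => expR (- (c * X' w)) * G' w).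

Definition ray_poly (n N : nat) (x : R) : R := (1 - expR (- (n%:R * x))) ^+ N.

Lemma ray_poly_itv n N x : 0 <= x -> 0 <= ray_poly n N x <= 1.
Proof.
move=> x0; have /andP[e0 e1] : 0 <= expR (- (n%:R * x)) <= 1.
  by apply: expN_itv; rewrite mulr_ge0.
by rewrite exprn_ge0 ?exprn_ile1 ?subr_ge0// lerBlDr lerDl.
Qed.

Let mulG01 (x y : R) : 0 <= x <= 1 -> 0 <= y <= 1 -> 0 <= x * y <= 1.
Proof. by move=> /andP[? ?] /andP[? ?]; rewrite mulr_ge0// mulr_ile1. Qed.

Let mexp (dd : measure_display) (TT : measurableType dd) (f : TT -> R) c :
  measurable_fun setT f -> measurable_fun setT (fun w => expR (- (c * f w))).
Proof. by move=> mf; apply: measurable_expN; exact: measurable_funM. Qed.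

Let mray (dd : measure_display) (TT : measurableType dd) (f : TT -> R) n N :
  measurable_fun setT f -> measurable_fun setT (fun w => ray_poly n N (f w)).
Proof.
move=> mf; apply: measurable_funX; apply: measurable_funB => //; exact: mexp.
Qed.

(** A binomial expansion done by induction: expanding one factor produces e^(-n x), which is
    absorbed by raising [c] to [c + n]. Hence the statement for all [c]. *)
Lemma ray_poly_mean n N c : 0 <= c ->
  mean P (fun w => expR (- (c * X w)) * ray_poly n N (X w) * G w) =
  mean P' (fun w => expR (- (c * X' w)) * ray_poly n N (X' w) * G' w).
Proof.
elim: N c => [|N IH] c c0.
  have := same_laplace c0; rewrite /ray_poly.
  by under eq_fun do rewrite -[expR _]mulr1; under [in RHS]eq_fun do rewrite -[expR _]mulr1.
have E (x y : R) : expR (- (c * x)) * ray_poly n N.+1 x * y =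
   expR (- (c * x)) * ray_poly n N x * y - expR (- ((c + n%:R) * x)) * ray_poly n N x * y.
  rewrite /ray_poly exprSr mulrDl opprD expRD; ring.
under eq_fun do rewrite E; under [in RHS]eq_fun do rewrite E.
have cn : 0 <= c + n%:R by rewrite addr_ge0.
have b (x y : R) e : 0 <= e -> 0 <= x -> 0 <= y <= 1 -> 0 <= expR (- (e * x)) * ray_poly n N x * y <= 1.
  by move=> e0 x0 y01; rewrite !mulG01// ?ray_poly_itv// expN_itv// mulr_ge0.
rewrite !meanB ?IH//.
- by apply: measurable_funM => //; apply: measurable_funM; [exact: mexp|exact: mray].
- by apply: measurable_funM => //; apply: measurable_funM; [exact: mexp|exact: mray].
- by move=> w; exact: b.
- by move=> w; exact: b.
- by apply: measurable_funM => //; apply: measurable_funM; [exact: mexp|exact: mray].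
- by apply: measurable_funM => //; apply: measurable_funM; [exact: mexp|exact: mray].
- by move=> w; exact: b.
- by move=> w; exact: b.
Qed.

(* an exponent of larger order than e^{na} kills the value 1/e that N = e^{na} would give at a itself *)
Definition ray_exponent (a : R) (n : nat) : nat := (Num.truncn (n%:R * expR (n%:R * a))).+1.

(** Put y = e^(-n x) and N the exponent. For x > a, Bernoulli bounds 1 - (1 - y)^N by N y, of order
    n e^(-n (x - a)). For x <= a, (1 - y)^N <= e^(-N y) <= e^(-n). *)
Lemma ray_poly_cvg a x : 0 <= a -> 0 <= x ->
  ray_poly n (ray_exponent a n) x @[n --> \oo] --> ((a < x)%R%:R : R).
Proof.
move=> a0 x0.
have N1 n : n%:R * expR (n%:R * a) <= (ray_exponent a n)%:R.
  by rewrite ltW// /ray_exponent truncnS_gt.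
have N2 n : (ray_exponent a n)%:R <= n%:R * expR (n%:R * a) + 1.
  rewrite /ray_exponent -natr1 lerD2r truncn_le.
  by rewrite mulr_ge0 ?expR_ge0.
have iv0 : (n.+1%:R^-1 : R) @[n --> \oo] --> 0 by exact: cvg_harmonic.
case: (ltP a x) => ax /=.
  have dd : 0 < x - a by rewrite subr_gt0.
  have bern (y : R) N : 0 <= y -> y <= 1 -> 1 - N%:R * y <= (1 - y) ^+ N.
    move=> y0 y1; elim: N => [|N IH]; first by rewrite mul0r subr0 expr0.
    rewrite exprS; apply: le_trans (ler_wpM2l _ IH); last by rewrite subr_ge0.
    rewrite -natr1; have : 0 <= N%:R :> R by []. nra.
  pose b n : R := n%:R * expR (- (n%:R * (x - a))) + expR (- (n%:R * (x - a))).
  have b0 : b n @[n --> \oo] --> 0.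
    pose z := x - a.
    (* From e^y >= y^2 / 2. Quadratic decay is enough to beat the factor n coming from the
       exponent. *)
    have e1 n : expR (- (n.+1%:R * z)) <= 2 / (n.+1%:R * z) ^+ 2.
      have p0 : 0 < n.+1%:R * z by rewrite mulr_gt0.
      rewrite expRN -[2 / _]invrK lef_pV2 ?posrE ?expR_gt0 ?invr_gt0 ?divr_gt0 ?exprn_gt0//.
      rewrite invf_div; have := expR_ge1Dxn 1 (ltW p0); rewrite /= -[2`!]/2%N.
      by move=> h; apply: le_trans h; rewrite lerDr.
    rewrite -(cvg_shiftS b).
    apply: (@squeeze_cvgr _ _ _ _ (fun=> 0) (fun n : nat => (2 * z ^- 2 + 2 * z ^- 2) * n.+1%:R^-1)).
    - near=> n; rewrite /b -/z addr_ge0 ?mulr_ge0 ?expR_ge0//=.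
      have h := e1 n; have n1 : 1 <= n.+1%:R :> R by rewrite ler1n.
      rewrite -[X in _ + X]mul1r -mulrDl.
      apply: (@le_trans _ _ ((n.+1%:R + n.+1%:R) * (2 / (n.+1%:R * z) ^+ 2))).
        by apply: ler_pM => //; rewrite ?addr_ge0 ?expR_ge0// lerD2l.
      rewrite exprMn invfM; have n0 : n.+1%:R != 0 :> R by [].
      rewrite le_eqVlt; apply/orP; left; apply/eqP.
      move: (n.+1%:R) n0 => y n0; field; rewrite n0 /=.
      by rewrite gt_eqF.
    - exact: cvg_cst.
    - by rewrite -[X in _ --> X](mulr0 (2 * z ^- 2 + 2 * z ^- 2)); apply: cvgMr.
  apply: (@squeeze_cvgr _ _ _ _ (fun n => 1 - b n) (fun=> 1)).
  - near=> n; have /andP[_ ->] := ray_poly_itv n (ray_exponent a n) x0; rewrite andbT.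
    have /andP[e0 e1] : 0 <= expR (- (n%:R * x)) <= 1.
      by apply: expN_itv; rewrite mulr_ge0.
    apply: le_trans (bern _ _ e0 e1); rewrite lerD2l lerN2 /b.
    apply: le_trans (ler_wpM2r e0 (N2 n)) _.
    rewrite mulrDl mul1r -mulrA -expRD.
    have -> : n%:R * a + - (n%:R * x) = - (n%:R * (x - a)) by ring.
    rewrite lerD2l ler_expR lerN2 ler_wpM2l// gerBl//.
  - by rewrite -[X in _ --> X]subr0; apply: cvgB; [exact: cvg_cst|].
  - exact: cvg_cst.
apply: (@squeeze_cvgr _ _ _ _ (fun=> 0) (fun n => expR (- n%:R))).
- near=> n; have /andP[-> _] := ray_poly_itv n (ray_exponent a n) x0; rewrite /=.
  have /andP[e0 e1] : 0 <= expR (- (n%:R * x)) <= 1.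
    by apply: expN_itv; rewrite mulr_ge0.
  apply: (@le_trans _ _ (expR (- expR (- (n%:R * x))) ^+ ray_exponent a n)).
    by rewrite lerXn2r ?nnegrE ?subr_ge0 ?expR_ge0// expR_ge1Dx.
  rewrite -expRM_natr ler_expR mulNr lerN2.
  apply: (@le_trans _ _ (expR (- (n%:R * x)) * (n%:R * expR (n%:R * a)))); last first.
    by rewrite ler_wpM2l.
  rewrite mulrCA -expRD -[leLHS]mulr1 ler_wpM2l// -[leLHS]expR0 ler_expR.
  by rewrite addrC -mulrBr mulr_ge0// subr_ge0.
- exact: cvg_cst.
- have e n : expR (- n%:R) <= n.+1%:R^-1 :> R.
    by rewrite expRN lef_pV2 ?posrE ?expR_gt0// -nat1r expR_ge1Dx.
  apply: (@squeeze_cvgr _ _ _ _ (fun=> 0) (fun n => n.+1%:R^-1)) iv0.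
    by near=> n; rewrite expR_ge0 e.
  exact: cvg_cst.
Unshelve. all: by end_near. Qed.

Let mind (dd : measure_display) (TT : measurableType dd) (f : TT -> R) (A : set R) :
  measurable A -> measurable_fun setT f -> measurable_fun setT (fun w => \1_A (f w) : R).
Proof. by move=> mA mf; apply: measurableT_comp => //; exact: measurable_indic. Qed.

Let ind01 (A : set R) x : 0 <= (\1_A x : R) <= 1.
Proof. by rewrite indicE; case: (_ \in _); rewrite ?lexx ler01. Qed.

Let same (A : set R) :=
  mean P (fun w => \1_A (X w) * G w) = mean P' (fun w => \1_A (X' w) * G' w).

Let same_setT : same setT.
Proof.
have := same_laplace (lexx 0); rewrite /same.
have e (x : R) : expR (- (0 * x)) = \1_setT x by rewrite mul0r oppr0 expR0 indicT.
by under eq_fun do rewrite e; under [in RHS]eq_fun do rewrite e.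
Qed.

Let same_ray a : same `]a, +oo[.
Proof.
have e (y : R) : \1_(`]a, +oo[%classic) y = (a < y)%R%:R :> R.
  by rewrite indicE mem_setE in_itv /= andbT.
(* A ray starting below 0 contains every value of [X] and [X'], so it reduces to the full line; the
   polynomials handle the remaining rays. *)
case: (leP 0 a) => a0; last first.
  rewrite -/(same _); have := same_setT; rewrite /same.
  have e' (x y : R) : 0 <= x -> \1_(`]a, +oo[%classic) x * y = \1_setT x * y.
    by move=> x0; rewrite e indicT (lt_le_trans a0).
  by under [in X in _ -> X]eq_fun do rewrite e'//; under [in X in _ -> _ = X]eq_fun do rewrite e'//.
have cv (dd : measure_display) (TT : measurableType dd) (Q : probability TT R) (x y : TT -> R) :
    measurable_fun setT x -> measurable_fun setT y -> (forall w, 0 <= x w) ->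
    (forall w, 0 <= y w <= 1) ->
    mean Q (fun w => expR (- (0 * x w)) * ray_poly n (ray_exponent a n) (x w) * y w) @[n --> \oo] -->
    mean Q (fun w => \1_(`]a, +oo[%classic) (x w) * y w).
  move=> mx my x0 y01; apply: mean_bounded_cvg.
  - by move=> n; apply: measurable_funM => //; apply: measurable_funM; [exact: mexp|exact: mray].
  - by apply: measurable_funM => //; exact: mind.
  - by move=> n w; rewrite !mulG01 ?ray_poly_itv ?expN_itv ?mul0r.
  - by move=> w; exact: mulG01.
  - apply: aeW => w; apply: cvgMl; under eq_fun do rewrite mul0r oppr0 expR0 mul1r.
    by rewrite e; exact: ray_poly_cvg.
have h1 := cv _ _ P _ _ mX mG X0 G01.
have h2 := cv _ _ P' _ _ mX' mG' X0' G01'.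
apply: (cvg_unique _ h1) => //.
rewrite (_ : (fun n => _) = (fun n => mean P' (fun w => expR (- (0 * X' w)) * ray_poly n (ray_exponent a n) (X' w) * G' w)))//.
by apply/funext => n; exact: ray_poly_mean.
Qed.

(** Rays form a generating pi-system, and the sets on which the weighted laws agree form a
    lambda-system. The weights [G] and [G'] hold the remaining coordinates, which lets the joint law
    be treated one coordinate at a time. *)
Lemma laplace_unique (A : set R) : measurable A ->
  mean P (fun w => \1_A (X w) * G w) = mean P' (fun w => \1_A (X' w) * G' w).
Proof.
pose H := [set A : set R | measurable A /\ same A].
suff : @measurable _ R `<=` H by move=> h /h[].
rewrite [X in X `<=` _]RGenOInfty.measurableE.
apply: lambda_system_subset => //.
- move=> _ _ [a ->] [b ->]; exists (Num.max a b).
  apply/seteqP; split => x /=; rewrite !in_itv /= !andbT gt_max; first by move=> [-> ->].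
  by move=> /andP[].
- split => //.
  + move=> A1 B BA [mA sA] [mB sB]; split; first exact: measurableD.
    have e (x y : R) : \1_(A1 `\` B) x * y = \1_A1 x * y - \1_B x * y.
      rewrite -mulrBl; congr (_ * _); rewrite !indicE in_setD.
      case: (boolP (x \in B)) => xB /=; last by rewrite andbT subr0.
      by rewrite (mem_set (BA _ (set_mem xB))) subrr.
    rewrite /same; under eq_fun do rewrite e; under [in RHS]eq_fun do rewrite e.
    rewrite !meanB; first by rewrite sA sB.
    all: try (by apply: measurable_funM => //; exact: mind).
    all: try by move=> w; exact: mulG01.
  + move=> F ndF HF; split; first by apply: bigcup_measurable => k _; case: (HF k).
    have cvI x : \1_(F n) x @[n --> \oo] --> (\1_(\bigcup_n F n) x : R).
      rewrite indicE; case: (boolP (x \in _)) => [/set_mem[k _ Fkx]|nx].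
        apply: cvg_near_cst; near=> n; rewrite indicE mem_set//.
        have kn : (k <= n)%N by near: n; exact: nbhs_infty_ge.
        by have /subsetPset := ndF _ _ kn; apply.
      apply: cvg_near_cst; near=> n; rewrite indicE (_ : (x \in F n) = false)//.
      by apply: contraNF nx => /set_mem Fx; apply/mem_set; exists n.
    have mF k : measurable (F k) by case: (HF k).
    have cv (dd : measure_display) (TT : measurableType dd) (Q : probability TT R) (x y : TT -> R) :
        measurable_fun setT x -> measurable_fun setT y ->
        (forall w, 0 <= y w <= 1) ->
        mean Q (fun w => \1_(F n) (x w) * y w) @[n --> \oo] -->
        mean Q (fun w => \1_(\bigcup_n F n) (x w) * y w).
      move=> mx my y01; apply: mean_bounded_cvg.
      - by move=> n; apply: measurable_funM => //; exact: mind.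
      - by apply: measurable_funM => //; apply: mind => //; exact: bigcup_measurable.
      - by move=> n w; exact: mulG01.
      - by move=> w; exact: mulG01.
      - by apply: aeW => w; apply: cvgMl; exact: cvI.
    have h1 := cv _ _ P _ _ mX mG G01.
    have h2 := cv _ _ P' _ _ mX' mG' G01'.
    apply: (cvg_unique _ h1) => //.
    rewrite (_ : (fun n => _) = (fun n => mean P' (fun w => \1_(F n) (X' w) * G' w)))//.
    by apply/funext => n; case: (HF n).
- move=> _ [a ->]; split; [exact: measurable_itv|exact: same_ray].
Unshelve. all: by end_near. Qed.

End one_dimensional_uniqueness.

(** * From one coordinate to the joint law *)

Section joint_uniqueness.
Context d d' (T : measurableType d) (T' : measurableType d') (R : realType)
  (P : probability T R) (P' : probability T' R).
Variables (q : nat) (X : 'I_q -> T -> R) (X' : 'I_q -> T' -> R).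
Hypotheses (mX : forall i, measurable_fun setT (X i)) (mX' : forall i, measurable_fun setT (X' i))
  (X0 : forall i w, 0 <= X i w) (X0' : forall i w, 0 <= X' i w).
Hypothesis same_laplace : forall c : 'I_q -> R, (forall i, 0 <= c i) ->
  mean P (fun w => expR (- \sum_(i < q) c i * X i w)) =
  mean P' (fun w => expR (- \sum_(i < q) c i * X' i w)).

Variable A : 'I_q -> set R.
Hypothesis mA : forall i, measurable (A i).

(** Interpolates between the joint transform at k = 0 and the probability of a product set at k =
    q. *)
Let phi (k : nat) (c : 'I_q -> R) (i : 'I_q) (x : R) : R :=
  if (i < k)%N then \1_(A i) x else expR (- (c i * x)).

Let phi01 k c i x : (forall i, 0 <= c i) -> 0 <= x -> 0 <= phi k c i x <= 1.
Proof.
move=> c0 x0; rewrite /phi; case: ifP => _; last by apply: expN_itv; rewrite mulr_ge0.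
by rewrite indicE; case: (_ \in _); rewrite ?lexx ler01.
Qed.

Let mphi (dd : measure_display) (TT : measurableType dd) (f : TT -> R) k c i :
  measurable_fun setT f -> measurable_fun setT (fun w => phi k c i (f w)).
Proof.
move=> mf; rewrite /phi; case: (i < k)%N.
  have mI : measurable_fun setT (\1_(A i) : R -> R) by exact: measurable_indic.
  exact: (measurableT_comp mI mf).
by apply: measurable_expN; exact: measurable_funM.
Qed.

Let mixed k : (k <= q)%N -> forall c : 'I_q -> R, (forall i, 0 <= c i) ->
  mean P (fun w => \prod_(i < q) phi k c i (X i w)) =
  mean P' (fun w => \prod_(i < q) phi k c i (X' i w)).
Proof.
elim: k => [_ c c0|k IH kq c c0].
  have := same_laplace c0; congr (mean P _ = mean P' _); apply/funext => w.
    by rewrite -sumrN expR_sum; apply: eq_bigr.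
  by rewrite -sumrN expR_sum; apply: eq_bigr.
pose k' := Ordinal kq.
pose G w := \prod_(i < q | i != k') phi k c i (X i w).
pose G' w := \prod_(i < q | i != k') phi k c i (X' i w).
have step x i : i != k' -> phi k.+1 c i x = phi k c i x.
  move=> ik; rewrite /phi ltnS leq_eqVlt; case: eqP => //= ik'.
  by move: ik; rewrite -val_eqE /= ik' eqxx.
have mG : measurable_fun setT G.
  rewrite (_ : G = fun w => \prod_(i < q) if i != k' then phi k c i (X i w) else 1).
    by apply: measurable_prod => i _; case: (i != k') => //; exact: mphi.
  by apply/funext => w; rewrite /G big_mkcond.
have mG' : measurable_fun setT G'.
  rewrite (_ : G' = fun w => \prod_(i < q) if i != k' then phi k c i (X' i w) else 1).
    by apply: measurable_prod => i _; case: (i != k') => //; exact: mphi.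
  by apply/funext => w; rewrite /G' big_mkcond.
have G01 w : 0 <= G w <= 1.
  rewrite prodr_ge0 ?prodr_ile1// => i _; first exact: phi01.
  by have /andP[] := phi01 k i c0 (X0 i w).
have G01' w : 0 <= G' w <= 1.
  rewrite prodr_ge0 ?prodr_ile1// => i _; first exact: phi01.
  by have /andP[] := phi01 k i c0 (X0' i w).
have sl b : 0 <= b ->
    mean P (fun w => expR (- (b * X k' w)) * G w) = mean P' (fun w => expR (- (b * X' k' w)) * G' w).
  (* The induction hypothesis holds for all coefficients, so the one of coordinate [k'] may vary
     freely while the others stay fixed inside [G]; this is the one-dimensional Laplace
     hypothesis. *)
  move=> b0; pose c' i := if i == k' then b else c i.
  have c'0 i : 0 <= c' i by rewrite /c'; case: ifP.
  have := IH (ltnW kq) c' c'0; congr (mean P _ = mean P' _); apply/funext => w.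
    rewrite (bigD1 k')//=; congr (_ * _); first by rewrite /phi ltnn /c' eqxx.
    by apply: eq_bigr => i /negPf ik; rewrite /phi /c' ik.
  rewrite (bigD1 k')//=; congr (_ * _); first by rewrite /phi ltnn /c' eqxx.
  by apply: eq_bigr => i /negPf ik; rewrite /phi /c' ik.
have := laplace_unique (mX k') (mX' k') mG mG' (X0 k') (X0' k') G01 G01' sl (mA k').
congr (mean P _ = mean P' _); apply/funext => w.
  rewrite (bigD1 k')//=; congr (_ * _); first by rewrite /phi ltnSn.
  by apply: eq_bigr => i ik; rewrite step.
rewrite (bigD1 k')//=; congr (_ * _); first by rewrite /phi ltnSn.
by apply: eq_bigr => i ik; rewrite step.
Qed.

Lemma joint_laplace_unique :
  P [set w | forall i, A i (X i w)] = P' [set w | forall i, A i (X' i w)].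
Proof.
have c0 (i : 'I_q) : (0 : R) <= (fun=> 0) i by [].
have E (dd : measure_display) (TT : measurableType dd) (Q : probability TT R) (x : 'I_q -> TT -> R) :
    (forall i, measurable_fun setT (x i)) ->
    Q [set w | forall i, A i (x i w)] = (mean Q (fun w => \prod_(i < q) phi q (fun=> 0) i (x i w)))%:E.
  move=> mx.
  have mS : measurable [set w | forall i, A i (x i w)].
    rewrite (_ : mkset _ = \bigcap_(i in [set: 'I_q]) (x i @^-1` A i)).
      apply: fin_bigcap_measurable => // i _.
      by rewrite -[X in measurable X]setTI; exact: mx.
    by apply/seteqP; split => [w h i _|w h i]; exact: h.
  rewrite /mean.
  have -> : (\int[Q]_w (\prod_(i < q) phi q (fun=> 0) i (x i w))%:E =
     \int[Q]_w (\1_[set w | forall i, A i (x i w)] w)%:E)%E.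
    apply: eq_integral => w _; congr EFin; rewrite indicE.
    case: (boolP (w \in _)) => [/set_mem wA|nw].
      by rewrite big1// => i _; rewrite /phi ltn_ord indicE mem_set.
    have /existsNP[i nAi] : ~ forall i, A i (x i w).
      by move=> h; move/negP: nw; apply; apply/mem_set.
    by rewrite (bigD1 i)//= /phi ltn_ord indicE memNset// mul0r.
  rewrite integral_indic// setIT fineK//.
  exact: fin_num_measure.
by rewrite !E// mixed.
Qed.

End joint_uniqueness.

(** * The Bell-Touchard process *)

Section bell_touchard_process.
Context d (T : measurableType d) (R : realType) (P : probability T R).
Variables (alpha nu lam : R).
Hypotheses (halpha : 0 < alpha) (hnu : 0 < nu) (hlam : 0 < lam).
Variables (N : bool -> T -> R -> R) (Y : bool -> nat -> T -> R).
Hypotheses (hN : forall b, poisson_process P (alpha * (expR nu - 1)) (N b))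
  (hYm : forall b i, measurable_fun setT (Y b i))
  (hYlaw : forall b i (n : nat), (0 < n)%N ->
     P (Y b i @^-1` [set n%:R]) = ((expR nu - 1)^-1 * nu ^+ n / n`!%:R)%:E)
  (hind : mutual_indep P (fun c : bool + (bool * nat) =>
     match c with
     | inl b => sigma_gen (fun t : R => N b ^~ t)
     | inr bi => sigma_gen (fun _ : unit => Y bi.1 bi.2)
     end)).

(* The jumps are positive only almost surely; with [|Y|] every path is monotone. *)
Let absY b i w := `|Y b i w|.

Let enu : 0 < expR nu - 1.
Proof. by rewrite subr_gt0 expR_gt1. Qed.

Let succ_inj : injective (fun n : nat => n.+1%:R : R).
Proof. by move=> m n /eqP; rewrite eqr_nat eqSS => /eqP. Qed.

Let law_cvg : series (fun n => (expR nu - 1)^-1 * nu ^+ n.+1 / n.+1`!%:R) @ \oo --> (1 : R).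
Proof.
rewrite (_ : series _ = fun n => (expR nu - 1)^-1 * series (fun n => nu ^+ n.+1 / n.+1`!%:R) n).
  by rewrite -[X in _ --> X](mulVf (lt0r_neq0 enu)); apply: cvgMr; exact: exp_pos_series_cvg.
apply/funext => n; rewrite /series /= mulr_sumr; apply: eq_bigr => i _.
by rewrite mulrA.
Qed.

Let mabsY b i : measurable_fun setT (absY b i).
Proof. exact: measurableT_comp. Qed.

Let absY_ge0 b i w : 0 <= absY b i w. Proof. exact: normr_ge0. Qed.

(** The atoms 1, 2, ... carry all the mass of each jump, and there are only countably many jumps. *)
Lemma jump_ge0_ae : \forall w \ae P, forall b i, 0 <= Y b i w.
Proof.
have h b i : \forall w \ae P, 0 <= Y b i w.
  have [mS _ S0] := discrete_support_null (hYm b i) succ_inj (fun n => hYlaw b i (ltn0Sn n)) law_cvg.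
  exists (~` \bigcup_n (Y b i @^-1` [set n.+1%:R])); split => //.
    by apply: measurableC; exact: bigcup_measurable.
  by move=> w /= nY [n _ /= Yn]; apply: nY; rewrite Yn ler0n.
have h' b : \forall w \ae P, forall i, 0 <= Y b i w by apply: ae_foralln => i; exact: h.
apply: filterS2 (h' true) (h' false) => w h1 h2 [] i; [exact: h1|exact: h2].
Qed.

Lemma jump_laplace b i a : 0 <= a ->
  (\int[P]_w (expR (- (a * absY b i w)))%:E)%E =
  ((expR nu - 1)^-1 * (expR (nu * expR (- a)) - 1))%:E.
Proof.
move=> a0; apply: (@integral_discrete _ _ _ P (Y b i) _ (fun n => n.+1%:R)
   (fun n => (expR nu - 1)^-1 * nu ^+ n.+1 / n.+1`!%:R) (fun n => expR (- (a * n.+1%:R)))) => //.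
- by move=> n; exact: hYlaw.
- by apply: measurable_expN; exact: measurable_funM.
- by move=> w n Yn; rewrite /absY Yn ger0_norm.
rewrite (_ : series _ = fun n => (expR nu - 1)^-1 *
    series (fun n => (nu * expR (- a)) ^+ n.+1 / n.+1`!%:R) n).
  by apply: cvgMr; exact: exp_pos_series_cvg.
apply/funext => n; rewrite /series /= mulr_sumr; apply: eq_bigr => j _.
rewrite exprMn -expRM_natr mulNr.
have alg (x y z t : R) : x * (y * z * t) = y * (z * x * t) by ring.
exact: alg.
Qed.

(** The sigma-algebra generated by [|Y|] is contained in that of [Y]. *)
Let ind_abs : mutual_indep P (fun c : bool + (bool * nat) =>
     match c with
     | inl b => sigma_gen (fun t : R => N b ^~ t)
     | inr bi => sigma_gen (fun _ : unit => absY bi.1 bi.2)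
     end).
Proof.
move=> J E uJ JE; apply: hind => // -[b|[b i]] jJ; first exact: (JE _ jJ).
have /= := JE _ jJ; apply: smallest_sub; first exact: smallest_sigma_algebra.
move=> A [u [B [mB ->]]]; apply: sub_sigma_algebra; exists tt, ((fun x : R => `|x|) @^-1` B); split => //.
by rewrite -[X in measurable X]setTI; exact: normr_measurable.
Qed.

Let L b w s := cp_path (N b w) (fun i => absY b i w) s.
Let n1 b := count (N b).
Let g1 b w k : R := \sum_(i < k) absY b i w.

Lemma bt_step_system : step_system L n1 g1.
Proof. exact: (compound_poisson_step_system hN mabsY absY_ge0). Qed.

(** The normalisation [expR nu - 1] of the jump law cancels against the same factor in the Poisson
    rate. *)
Lemma bt_laplace_system : laplace_system P L (fun _ => bt_exponent alpha nu).
Proof.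
have := compound_poisson_laplace_system hN mabsY absY_ge0 jump_laplace ind_abs.
rewrite (_ : (fun _ => _) = (fun _ => bt_exponent alpha nu))//.
apply/funext => _; apply/funext => x; rewrite /bt_exponent.
by field; rewrite gt_eqF.
Qed.

Lemma measurable_XBT t : 0 <= t -> measurable_fun setT (XBT lam N Y t).
Proof.
move=> t0; have lt0 : 0 <= lam * t by rewrite mulr_ge0// ltW.
rewrite (_ : XBT lam N Y t = fun w => limn (fun n => shot n1
     (fun b w k => \sum_(i < k) Y b i w) (kernel (lam * t)) n w)); last first.
  by apply/funext => w; exact: (XBT_shot _ _ hN lt0).
apply: measurable_limn => n.
apply: (measurable_shot (compound_poisson_step_paths hN hYm)) => b.
exact: kernel_left_cts.
Qed.

(** The exceptional set is where some jump is negative; it does not depend on [t], so one null set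
    serves all times. *)
Lemma XBT_ae : \forall w \ae P, forall t, 0 <= t ->
  XBT lam N Y t w = kernel_limit n1 g1 (lam * t) w.
Proof.
apply: filterS jump_ge0_ae => w Y0 t t0.
have lt0 : 0 <= lam * t by rewrite mulr_ge0// ltW.
rewrite (XBT_shot _ _ hN lt0); congr (limn _); apply/funext => n.
rewrite /shot; apply: eq_bigr => b _; congr asum; apply/funext => k.
by apply: eq_bigr => i _; rewrite /absY ger0_norm.
Qed.

Lemma ae_eq_probability (A B : set T) : measurable A -> measurable B ->
  (\forall w \ae P, A w <-> B w) -> P A = P B.
Proof.
move=> mA mB AB; rewrite -[A]setIT -[B]setIT -!integral_indic//.
apply: ae_eq_integral => //.
- by apply/measurable_EFinP; exact: measurable_indic.
- by apply/measurable_EFinP; exact: measurable_indic.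
apply: filterS AB => w AB _; congr EFin; rewrite !indicE; congr ((nat_of_bool _)%:R).
by apply/idP/idP => /set_mem/AB/mem_set.
Qed.

Lemma measurable_forall_in q (X : 'I_q -> T -> R) (A : 'I_q -> set R) :
  (forall i, measurable_fun setT (X i)) -> (forall i, measurable (A i)) ->
  measurable [set w | forall i, A i (X i w)].
Proof.
move=> mX mA; rewrite (_ : mkset _ = \bigcap_(i in [set: 'I_q]) (X i @^-1` A i)).
  apply: fin_bigcap_measurable => // i _.
  by rewrite -[X in measurable X]setTI; exact: mX.
by apply/seteqP; split => [w h i _|w h i]; exact: h.
Qed.

(** The DOU side is rewritten as shot noise on every path, as its jumps are nonnegative by
    construction; the Bell-Touchard side agrees with its version in [|Y|] only almost surely, so
    that step compares probabilities of measurable events. *)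
Lemma XBT_fdd (d' : measure_display) (T' : measurableType d') (P' : probability T' R)
     (M : nat -> bool -> T' -> R -> R) :
  (forall j b, poisson_process P' (alpha * nu ^+ j.+1 / j.+1`!%:R) (M j b)) ->
  mutual_indep P' (fun jb : nat * bool => sigma_gen (fun t : R => M jb.1 jb.2 ^~ t)) ->
  fdd_eq P P' (XBT lam N Y)
       (fun t w => limn (fun n : nat =>
          \sum_(j < n) DOU lam (j.+1)%:R (M j) t w)).
Proof.
move=> hM indM q t A t0 mA.
have lt0 i : 0 <= lam * t i by rewrite mulr_ge0// ltW.
pose n2 j (b : bool) := count (M j b).
pose g2 j (b : bool) (w : T') (k : nat) : R := j.+1%:R * k%:R.
pose X i := kernel_limit n1 g1 (lam * t i).
pose Z i w := limn (fun J => \sum_(j < J) kernel_limit (n2 j) (g2 j) (lam * t i) w).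
have sys2 j := @poisson_step_system _ T' R P' bool
  (M j) (fun=> rate alpha nu j) (fun=> j.+1%:R) (fun=> ler0n R _) (hM j).
have ZE i w : limn (fun n => \sum_(j < n) DOU lam j.+1%:R (M j) (t i) w) = Z i w.
  congr (limn _); apply/funext => n; apply: eq_bigr => j _.
  exact: (DOU_shot _ _ (hM j) (lt0 i)).
have mX i : measurable_fun setT (X i) by exact: (measurable_kernel_limit bt_step_system).
have mZ i : measurable_fun setT (Z i).
  apply: measurable_limn => J; apply: measurable_sum => j.
  exact: (measurable_kernel_limit (sys2 j)).
transitivity (P [set w | forall i, A i (X i w)]).
  apply: ae_eq_probability.
  - by apply: measurable_forall_in => // i; exact: measurable_XBT.
  - exact: measurable_forall_in.
  apply: filterS XBT_ae => w H; split => h i; have := h i; by rewrite /= H.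
transitivity (P' [set w | forall i, A i (Z i w)]); last first.
  by congr (P' _); apply/seteqP; split => w h i; have := h i; rewrite /= ZE.
apply: joint_laplace_unique => //.
- by move=> i w; exact: (kernel_limit_ge0 bt_step_system).
- move=> i w; apply: limn_ge0 => J; apply: sumr_ge0 => j _.
  exact: (kernel_limit_ge0 (sys2 j)).
move=> c c0.
exact: (series_laplace_eq halpha hnu bt_step_system bt_laplace_system hM indM c0 lt0).
Qed.

End bell_touchard_process.

(** * Second order moments *)

Section exponential_limits.
Context {R : realType}.

(** First-order expansion at the scale of [b]: for x < 1, x <= e^x - 1 <= x / (1 - x). *)
Lemma expm1_cvg (x b : nat -> R) (l : R) : (forall n, 0 <= b n) ->
  x @ \oo --> 0 -> x n * b n @[n --> \oo] --> l ->
  (expR (x n) - 1) * b n @[n --> \oo] --> l.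
Proof.
move=> b0 x0 xb.
apply: (@squeeze_cvgr _ _ _ _ (fun n => x n * b n) (fun n => x n * b n / (1 - x n))) => //.
- have x1 : \forall n \near \oo, x n < 1 by apply: (cvgr_lt 0 x0); exact: ltr01.
  near=> n; have xn1 : 0 < 1 - x n by rewrite subr_gt0; near: n.
  rewrite ler_wpM2r//=; last by rewrite lerBrDl expR_ge1Dx.
  rewrite mulrAC ler_wpM2r// ler_pdivlMr//.
  have h : expR (x n) * (1 - x n) <= 1.
    rewrite -[leRHS](@expRxMexpNx_1 R (x n)) ler_wpM2l ?expR_ge0//.
    exact: expR_ge1Dx.
  lra.
- rewrite -[X in _ --> X]divr1; apply: cvgM => //; apply: cvgV; first exact: oner_neq0.
  by rewrite -[X in _ --> X]subr0; apply: cvgB => //; exact: cvg_cst.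
Unshelve. all: by end_near. Qed.

(** The scale of the chords: [chord n x] is the quotient of 1 - e^(-s x) by s at s = [step n]. *)
Definition step (n : nat) : R := n.+1%:R^-1.

Lemma step_gt0 n : 0 < step n. Proof. by rewrite invr_gt0. Qed.
Lemma stepV n : step n * n.+1%:R = 1. Proof. by rewrite mulVf. Qed.
Lemma step_cvg : step n @[n --> \oo] --> 0. Proof. exact: cvg_harmonic. Qed.

Let ratio_cvg0 (x : nat -> R) (l : R) : x n * n.+1%:R @[n --> \oo] --> l -> x @ \oo --> 0.
Proof.
move=> xl; rewrite (_ : x = fun n => x n * n.+1%:R * step n).
  by rewrite -[X in _ --> X](mulr0 l); apply: cvgM => //; exact: step_cvg.
by apply/funext => n; rewrite -mulrA [_ * step n]mulrC stepV mulr1.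
Qed.

Variables alpha nu : R.

Lemma jump_rate_cvg : nu * (expR (- step n) - 1) * n.+1%:R @[n --> \oo] --> - nu.
Proof.
rewrite -[X in _ --> X]mulrN1.
under eq_fun do rewrite -mulrA.
apply: cvgMr; apply: expm1_cvg => //.
  by rewrite -oppr0; apply: cvgN; exact: step_cvg.
under eq_fun do rewrite mulNr stepV.
exact: cvg_cst.
Qed.

Let v n := nu * (expR (- step n) - 1).

Let v_exp : (expR (v n) - 1) * n.+1%:R @[n --> \oo] --> - nu.
Proof. by apply: expm1_cvg => //; [exact: ratio_cvg0 jump_rate_cvg|exact: jump_rate_cvg]. Qed.

Let exponentE n : bt_exponent alpha nu (step n) = - (alpha * expR nu) * (expR (v n) - 1).
Proof.
rewrite /bt_exponent; have -> : nu * expR (- step n) = nu + v n by rewrite /v; ring.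
by rewrite expRD; ring.
Qed.

Lemma bt_exponent_rate : bt_exponent alpha nu (step n) * n.+1%:R @[n --> \oo] -->
  alpha * nu * expR nu.
Proof.
rewrite (_ : alpha * nu * expR nu = - (alpha * expR nu) * - nu); last by ring.
under eq_fun do rewrite exponentE -mulrA.
by apply: cvgMr.
Qed.

(** As the exponent vanishes at 0, the left side is minus its second difference quotient there, and
    the limit is minus its second derivative at 0: the variance per unit time. *)
Lemma bt_exponent_curvature :
  (2 * bt_exponent alpha nu (step n) - bt_exponent alpha nu (2 * step n)) * n.+1%:R ^+ 2
    @[n --> \oo] --> alpha * expR nu * (nu * (nu + 1)).
Proof.
pose y n := expR (- step n) - 1 : R.
(* With y = e^(-s) - 1 and v = nu y, one has nu e^(-2 s) = nu + 2 v + nu y^2, and e^(2 v + nu y^2) -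
   2 e^v + 1 = (e^v - 1)^2 + e^(2 v) (e^(nu y^2) - 1). Both terms have order s^2. *)
have E n : (2 * bt_exponent alpha nu (step n) - bt_exponent alpha nu (2 * step n)) * n.+1%:R ^+ 2 =
   alpha * expR nu * ((expR (v n) - 1) * n.+1%:R * ((expR (v n) - 1) * n.+1%:R) +
     expR (v n) * expR (v n) * ((expR (nu * y n ^+ 2) - 1) * n.+1%:R ^+ 2)).
  rewrite exponentE /bt_exponent.
  have -> : nu * expR (- (2 * step n)) = nu + v n + v n + nu * y n ^+ 2.
    have -> : - (2 * step n) = - step n + - step n by ring.
    rewrite expRD /v /y; ring.
  rewrite !expRD; ring.
under eq_fun do rewrite E.
have y1 : y n * n.+1%:R @[n --> \oo] --> (- 1 : R).
  apply: expm1_cvg => //.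
    by rewrite -oppr0; apply: cvgN; exact: step_cvg.
  by under eq_fun do rewrite mulNr stepV; exact: cvg_cst.
have y2 : nu * y n ^+ 2 * n.+1%:R ^+ 2 @[n --> \oo] --> nu.
  rewrite [X in _ --> X](_ : nu = nu * (- 1 * - 1)); last by rewrite mulrNN !mulr1.
  rewrite (_ : (fun n => _) = (fun n => nu * (y n * n.+1%:R * (y n * n.+1%:R)))).
    by apply: cvgMr; apply: cvgM.
  by apply/funext => n; ring.
have y0 : nu * y n ^+ 2 @[n --> \oo] --> (0 : R).
  rewrite [X in _ --> X](_ : 0 = nu * (0 * 0)); last by rewrite !mulr0.
  by under eq_fun do rewrite expr2; apply: cvgMr; apply: cvgM; exact: ratio_cvg0 y1.
have ev : expR (v n) @[n --> \oo] --> (1 : R).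
  rewrite -expR0; apply: continuous_cvg; first exact: continuous_expR.
  exact: ratio_cvg0 jump_rate_cvg.
rewrite (_ : nu * (nu + 1) = - nu * - nu + 1 * 1 * nu); last by ring.
apply: cvgMr; apply: cvgD; first exact: cvgM.
apply: cvgM; first exact: cvgM.
by apply: expm1_cvg => // n; rewrite exprn_ge0.
Qed.

Variable delta : R.
Hypothesis delta0 : 0 <= delta.

Let E n := expR (- (delta * bt_exponent alpha nu (step n))).

Lemma laplace_rate : n.+1%:R * (1 - E n) @[n --> \oo] --> alpha * nu * expR nu * delta.
Proof.
rewrite (_ : (fun n => _) = (fun n => - ((E n - 1) * n.+1%:R))).
  rewrite -[X in _ --> X]opprK; apply: cvgN.
  have h : - (delta * bt_exponent alpha nu (step n)) * n.+1%:R @[n --> \oo] --> - (alpha * nu * expR nu * delta).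
    rewrite (_ : (fun n => _) = (fun n => (bt_exponent alpha nu (step n) * n.+1%:R) * - delta)).
      by rewrite -mulrN; apply: cvgMl; exact: bt_exponent_rate.
    by apply/funext => n; ring.
  by apply: expm1_cvg => //; exact: ratio_cvg0 h.
by apply/funext => n; ring.
Qed.

(** For an increment X over time [delta], the left side is the mean of the squared chord; the limit
    is thus E X^2, squared mean plus variance. *)
Lemma laplace_curvature :
  n.+1%:R ^+ 2 * (1 - E n - E n + expR (- (delta * bt_exponent alpha nu (2 * step n))))
   @[n --> \oo] -->
  (alpha * nu * expR nu * delta) ^+ 2 + alpha * expR nu * (nu * (nu + 1)) * delta.
Proof.
pose z n := delta * (2 * bt_exponent alpha nu (step n) - bt_exponent alpha nu (2 * step n)).
have F n : n.+1%:R ^+ 2 * (1 - E n - E n + expR (- (delta * bt_exponent alpha nu (2 * step n)))) =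
   n.+1%:R * (1 - E n) * (n.+1%:R * (1 - E n)) + E n * E n * ((expR (z n) - 1) * n.+1%:R ^+ 2).
  have -> : - (delta * bt_exponent alpha nu (2 * step n)) =
    - (delta * bt_exponent alpha nu (step n)) + - (delta * bt_exponent alpha nu (step n)) + z n.
    by rewrite /z; ring.
  rewrite !expRD /E; ring.
under eq_fun do rewrite F.
have zl : z n * n.+1%:R ^+ 2 @[n --> \oo] --> alpha * expR nu * (nu * (nu + 1)) * delta.
  rewrite (_ : (fun n => _) = (fun n => ((2 * bt_exponent alpha nu (step n) - bt_exponent alpha nu (2 * step n)) * n.+1%:R ^+ 2) * delta)).
    by apply: cvgMl; exact: bt_exponent_curvature.
  by apply/funext => n; rewrite /z; ring.
have z0 : z @ \oo --> (0 : R).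
  apply: (@ratio_cvg0 _ 0); rewrite (_ : (fun n => _) = (fun n => z n * n.+1%:R ^+ 2 * step n)).
    by rewrite -[X in _ --> X](mulr0 (alpha * expR nu * (nu * (nu + 1)) * delta)); apply: cvgM => //; exact: step_cvg.
  by apply/funext => n; rewrite expr2 -!mulrA [n.+1%:R * step n]mulrC stepV mulr1.
have e1 : E n @[n --> \oo] --> (1 : R).
  have h : 1 - E n @[n --> \oo] --> (0 : R).
    by apply: (@ratio_cvg0 _ _); under eq_fun do rewrite mulrC; exact: laplace_rate.
  rewrite (_ : (fun n => _) = (fun n => 1 - (1 - E n))); last by apply/funext => n; ring.
  by rewrite -[X in _ --> X]subr0; apply: cvgB => //; exact: cvg_cst.
apply: cvgD; first by rewrite expr2; apply: cvgM; exact: laplace_rate.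
rewrite [X in _ --> X](_ : _ = 1 * 1 * (alpha * expR nu * (nu * (nu + 1)) * delta)); last by rewrite !mul1r.
apply: cvgM; first exact: cvgM.
by apply: expm1_cvg => // n; rewrite exprn_ge0.
Qed.

End exponential_limits.

Section expectation_limits.
Context d (T : measurableType d) (R : realType) (P : probability T R).

(** Fatou gives one inequality and the domination [u n <= f] the other. *)
Lemma fatou_cvg (u : nat -> T -> R) (f : T -> R) (v : nat -> R) (l : R) :
  (forall n, measurable_fun setT (u n)) -> measurable_fun setT f ->
  (forall n w, 0 <= u n w <= f w) ->
  (forall w, u n w @[n --> \oo] --> f w) ->
  (forall n, (\int[P]_w (u n w)%:E)%E = (v n)%:E) -> v @ \oo --> l ->
  (\int[P]_w (f w)%:E)%E = l%:E.
Proof.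
move=> mu mf uf ucv uv vl.
have u0 n w : 0 <= u n w by case/andP: (uf n w).
have f0 w : 0 <= f w by case/andP: (uf 0%N w) => ?; exact: le_trans.
apply/eqP; rewrite eq_le; apply/andP; split.
  have -> : (\int[P]_w (f w)%:E = \int[P]_w limn_einf (fun n => (u n w)%:E))%E.
    apply: eq_integral => w _.
    have : (u n w)%:E @[n --> \oo] --> (f w)%:E.
      by apply: cvg_EFin; [near=> n|exact: (ucv w)].
    by move=> /cvg_limn_einf_sup[].
  apply: (le_trans (fatou P measurableT _ _)).
  - by move=> n; apply/measurable_EFinP.
  - by move=> n w _; rewrite lee_fin.
  have : (v n)%:E @[n --> \oo] --> l%:E by apply: cvg_EFin; [near=> n|exact: vl].
  move=> /cvg_limn_einf_sup[<- _].
  by under eq_fun do rewrite uv.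
have vl' : (v n)%:E @[n --> \oo] --> l%:E by apply: cvg_EFin; [near=> n|exact: vl].
rewrite -(cvg_lim _ vl')//; apply: lime_le; first exact: cvgP vl'.
near=> n; rewrite -uv; apply: ge0_le_integral => //.
- by move=> w _; rewrite lee_fin.
- exact/measurable_EFinP.
- exact/measurable_EFinP.
- by move=> w _; rewrite lee_fin; case/andP: (uf n w).
Unshelve. all: by end_near. Qed.

Lemma monotone_cvg (V : nat -> T -> R) (W : T -> R) (v : nat -> R) (l : R) :
  (forall n, measurable_fun setT (V n)) -> measurable_fun setT W ->
  (forall n w, 0 <= V n w) ->
  (forall w, {homo V ^~ w : n m / (n <= m)%N >-> n <= m}) ->
  (\forall w \ae P, V n w @[n --> \oo] --> W w) -> (forall w, 0 <= W w) ->
  (forall n, (\int[P]_w (V n w)%:E)%E = (v n)%:E) -> v @ \oo --> l ->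
  (\int[P]_w (W w)%:E)%E = l%:E.
Proof.
move=> mV mW V0 ndV VW W0 Vv vl.
have mEV n : measurable_fun setT (fun w => (V n w)%:E) by exact/measurable_EFinP.
have h := @cvg_monotone_convergence _ _ _ P setT measurableT (fun n w => (V n w)%:E) mEV.
have : (\int[P]_w (V n w)%:E)%E @[n --> \oo] --> (\int[P]_w limn (fun n => (V n w)%:E))%E.
  by apply: h => [n w _|w _ n m nm]; rewrite lee_fin// ndV.
rewrite (_ : (fun n => _) = (fun n => (v n)%:E)); last exact/funext.
have vl' : (v n)%:E @[n --> \oo] --> l%:E by apply: cvg_EFin; [near=> n|exact: vl].
move=> h1; have -> : l%:E = (\int[P]_w limn (fun n => (V n w)%:E))%E by apply: (cvg_unique _ vl' h1).
apply: ae_eq_integral => //.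
- exact/measurable_EFinP.
- apply: (@emeasurable_fun_cvg _ _ _ _ (fun n w => (V n w)%:E)) => // w _.
  by apply: ereal_nondecreasing_is_cvgn => n m nm; rewrite lee_fin ndV.
apply: filterS VW => w VWw _; apply/esym/cvg_lim => //.
by apply: cvg_EFin; [near=> n|exact: VWw].
Unshelve. all: by end_near. Qed.

End expectation_limits.

(** * Moments of increments over grid cells *)

Section increment_moments.
Context d (T : measurableType d) (R : realType) (P : probability T R).
Variables (L : bool -> T -> R -> R) (nu1 : bool -> T -> R -> nat) (g1 : bool -> T -> nat -> R).
Variables alpha nu : R.
Hypotheses (halpha : 0 < alpha) (hnu : 0 < nu).
Hypotheses (sys : step_system L nu1 g1)
  (lap : laplace_system P L (fun _ => bt_exponent alpha nu)).
Variables (m K : nat).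

Definition bt_mean := alpha * nu * expR nu.
Definition bt_var := alpha * expR nu * (nu * (nu + 1)).

Let delta : R := mesh m.
Let delta0 : 0 <= delta. Proof. exact: ltW (mesh_gt0 m). Qed.

Definition incr (p : bool * nat) (w : T) : R :=
  L p.1 w (grid m p.2.+1) - L p.1 w (grid m p.2).

Lemma incr_ge0 p w : 0 <= incr p w.
Proof.
have [[cnu HL _] gm] := sys.
have gmono i j : (i <= j)%N -> g1 p.1 w i <= g1 p.1 w j.
  elim: j => [|j IH]; first by rewrite leqn0 => /eqP ->.
  by rewrite leq_eqVlt => /orP[/eqP -> //|/IH]; move/le_trans; apply.
rewrite subr_ge0 !HL ?grid_ge0// gmono//.
by have [_ + _] := cnu p.1 w; apply; [exact: grid_ge0|exact: le_grid].
Qed.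

Lemma measurable_incr p : measurable_fun setT (incr p).
Proof.
have [[_ _ mL] _] := sys.
by apply: measurable_funB; apply: mL; exact: grid_ge0.
Qed.

Lemma bt_exponent0 : bt_exponent alpha nu 0 = 0.
Proof. by rewrite /bt_exponent oppr0 expR0 mulr1 subrr mulr0. Qed.

Let pick_sum (p : bool * nat) (F : bool -> nat -> R) : (p.2 < K)%N ->
  \sum_(e : bool) \sum_(k < K) (if (e, nat_of_ord k) == p then F e k else 0) = F p.1 p.2.
Proof.
case: p => e0 k0 /= kK; rewrite (bigD1 e0)//= [X in _ + X]big1 ?addr0; last first.
  by move=> e /negPf ee; rewrite big1// => k _; rewrite xpair_eqE ee.
rewrite (bigD1 (Ordinal kK))//= eqxx big1 ?addr0// => k kk.
rewrite xpair_eqE eqxx /= (_ : (_ == _) = false)//.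
by apply/negbTE; move: kk; rewrite -val_eqE.
Qed.

Lemma incr_laplace p c : (p.2 < K)%N -> 0 <= c ->
  mean P (fun w => expR (- (c * incr p w))) = expR (- (delta * bt_exponent alpha nu c)).
Proof.
move=> pK c0.
have := @lap m K (fun e k => if (e, k) == p then c else 0).
have -> : \sum_(e : bool) \sum_(k < K) mesh m * bt_exponent alpha nu (if (e, nat_of_ord k) == p then c else 0) =
   delta * bt_exponent alpha nu c.
  rewrite -[RHS](pick_sum (fun _ _ => delta * bt_exponent alpha nu c) pK).
  apply: eq_bigr => e _; apply: eq_bigr => k _.
  by case: ifP => // _; rewrite bt_exponent0 mulr0.
rewrite /mean => h; under eq_integral => w _.
  rewrite (_ : c * incr p w = \sum_(e : bool) \sum_(k < K) (if (e, nat_of_ord k) == p then c else 0) *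
        (L e w (grid m k.+1) - L e w (grid m k))); first over.
  rewrite -(pick_sum (fun e k => c * (L e w (grid m k.+1) - L e w (grid m k))) pK).
  apply: eq_bigr => e _; apply: eq_bigr => k _.
  by case: ifP => // _; rewrite mul0r.
by rewrite h// => e k; case: ifP.
Qed.

Lemma incr_laplace2 p q c : (p.2 < K)%N -> (q.2 < K)%N -> p != q -> 0 <= c ->
  mean P (fun w => expR (- (c * incr p w)) * expR (- (c * incr q w))) =
  expR (- (delta * bt_exponent alpha nu c)) * expR (- (delta * bt_exponent alpha nu c)).
Proof.
move=> pK qK pq c0.
pose F (x : R) := fun (e : bool) (k : nat) => if (e, k) == p then x else 0.
pose G (x : R) := fun (e : bool) (k : nat) => if (e, k) == q then x else 0.
have := @lap m K (fun e k => F c e k + G c e k).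
have -> : \sum_(e : bool) \sum_(k < K) mesh m * bt_exponent alpha nu (F c e k + G c e k) =
   delta * bt_exponent alpha nu c + delta * bt_exponent alpha nu c.
  rewrite -[X in X + _](pick_sum (fun _ _ => delta * bt_exponent alpha nu c) pK).
  rewrite -[X in _ + X](pick_sum (fun _ _ => delta * bt_exponent alpha nu c) qK).
  rewrite -big_split; apply: eq_bigr => e _; rewrite -big_split; apply: eq_bigr => k _ /=.
  rewrite /F /G /=; case: eqP => [->|_]; case: eqP => [e1|_]; rewrite ?addr0 ?add0r//.
  - by move: pq; rewrite e1 eqxx.
  - by rewrite bt_exponent0 mulr0.
rewrite opprD expRD /mean => h; under eq_integral => w _.
  rewrite -expRD -opprD.
  rewrite (_ : c * incr p w + c * incr q w = \sum_(e : bool) \sum_(k < K) (F c e k + G c e k) *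
        (L e w (grid m k.+1) - L e w (grid m k))); first over.
  rewrite -(pick_sum (fun e k => c * (L e w (grid m k.+1) - L e w (grid m k))) pK).
  rewrite -[X in _ + X](pick_sum (fun e k => c * (L e w (grid m k.+1) - L e w (grid m k))) qK).
  rewrite -big_split; apply: eq_bigr => e _; rewrite -big_split; apply: eq_bigr => k _ /=.
  rewrite mulrDl /F /G; congr (_ + _); case: ifP => // _; by rewrite mul0r.
rewrite h// => e k; rewrite addr_ge0// /F /G; by case: ifP.
Qed.

Let mE p c : measurable_fun setT (fun w => expR (- (c * incr p w))).
Proof. by apply: measurable_expN; apply: measurable_funM => //; exact: measurable_incr. Qed.

Let E01 p c w : 0 <= c -> 0 <= expR (- (c * incr p w)) <= 1.
Proof. by move=> c0; apply: expN_itv; rewrite mulr_ge0// incr_ge0. Qed.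

Let mchord p n : measurable_fun setT (fun w => chord n (incr p w)).
Proof. by apply: measurable_funM => //; apply: measurable_funB => //; exact: mE. Qed.

Let compl01 (x : R) : 0 <= x <= 1 -> 0 <= 1 - x <= 1.
Proof. by move=> /andP[? ?]; rewrite subr_ge0 lerBlDr lerDl; apply/andP. Qed.

Let mean1B (f : T -> R) : measurable_fun setT f -> (forall w, 0 <= f w <= 1) ->
  mean P (fun w => 1 - f w) = 1 - mean P f.
Proof.
move=> mf f01; rewrite (@meanB _ _ _ P (fun=> 1) f)//; last first.
  by move=> w; rewrite ler01 lexx.
congr (_ - _); rewrite /mean [X in fine X](_ : _ = 1%E)//.
rewrite [LHS](_ : _ = \int[P]_x (cst 1%:E x))%E// integral_cst//= mul1e.
exact: probability_setT.
Qed.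

Lemma incr_mean p : (p.2 < K)%N -> (\int[P]_w (incr p w)%:E)%E = (bt_mean * delta)%:E.
Proof.
move=> pK; have vl : n.+1%:R * (1 - expR (- (delta * bt_exponent alpha nu (step n)))) @[n --> \oo] -->
    bt_mean * delta by exact: laplace_rate.
apply: (@fatou_cvg _ _ _ P (fun n w => chord n (incr p w)) _ _ _ _ _ _ _ _ vl).
- by move=> n; exact: mchord.
- exact: measurable_incr.
- by move=> n w; rewrite chord_ge0 ?incr_ge0//= chord_le.
- by move=> w; apply: chord_cvg; exact: incr_ge0.
move=> n; have c0 := ltW (@step_gt0 R n).
under eq_integral do rewrite EFinM.
rewrite ge0_integralZl//=; last 2 first.
- by apply/measurable_EFinP; apply: measurable_funB => //; exact: mE.
- by move=> w _; rewrite lee_fin; have /compl01/andP[] := E01 p w c0.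
rewrite meanE; last 2 first.
- by apply: measurable_funB => //; exact: mE.
- by move=> w; apply: compl01; exact: E01.
by rewrite mean1B ?incr_laplace// => w; exact: E01.
Qed.

(** The means of products of chords are combinations of transforms. Distinct cells factor by
    independence; on the same cell the product e^(-s X) e^(-s X) is the transform at 2 s, which
    brings in the variance. *)
Lemma incr_mean_prod p q : (p.2 < K)%N -> (q.2 < K)%N ->
  (\int[P]_w (incr p w * incr q w)%:E)%E =
  ((bt_mean * delta) ^+ 2 + (if p == q then bt_var * delta else 0))%:E.
Proof.
move=> pK qK.
pose E n := expR (- (delta * bt_exponent alpha nu (step n))).
pose E2 n := if p == q then expR (- (delta * bt_exponent alpha nu (2 * step n))) else E n * E n.
have vl : n.+1%:R ^+ 2 * (1 - E n - E n + E2 n) @[n --> \oo] -->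
    (bt_mean * delta) ^+ 2 + (if p == q then bt_var * delta else 0).
  rewrite /E2; case: ifP => _; first exact: laplace_curvature.
  rewrite addr0 expr2.
  rewrite (_ : (fun n => _) = (fun n => n.+1%:R * (1 - E n) * (n.+1%:R * (1 - E n)))).
    by apply: cvgM; exact: laplace_rate.
  by apply/funext => n; ring.
apply: (@fatou_cvg _ _ _ P (fun n w => chord n (incr p w) * chord n (incr q w)) _ _ _ _ _ _ _ _ vl).
- by move=> n; apply: measurable_funM; exact: mchord.
- by apply: measurable_funM; exact: measurable_incr.
- move=> n w; rewrite mulr_ge0 ?chord_ge0 ?incr_ge0//=.
  by rewrite ler_pM ?chord_ge0 ?chord_le ?incr_ge0.
- by move=> w; apply: cvgM; apply: chord_cvg; exact: incr_ge0.
move=> n; have c0 := ltW (@step_gt0 R n).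
pose x w := expR (- (step n * incr p w)); pose y w := expR (- (step n * incr q w)).
have mx : measurable_fun setT x by exact: mE.
have my : measurable_fun setT y by exact: mE.
have x01 w : 0 <= x w <= 1 by exact: E01.
have y01 w : 0 <= y w <= 1 by exact: E01.
have xy01 w : 0 <= x w * y w <= 1.
  by have /andP[? ?] := x01 w; have /andP[? ?] := y01 w; rewrite mulr_ge0// mulr_ile1.
have mxy : measurable_fun setT (fun w => x w * y w) by exact: measurable_funM.
have yx01 w : 0 <= y w - x w * y w <= 1.
  have -> : y w - x w * y w = (1 - x w) * y w by ring.
  have /compl01/andP[? ?] := x01 w; have /andP[? ?] := y01 w.
  by rewrite mulr_ge0// mulr_ile1.
have x1 w := compl01 (x01 w).
have E3 : mean P (fun w => (1 - x w) * (1 - y w)) = 1 - E n - E n + E2 n.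
  (* This grouping has both terms with values in [0, 1], as [meanB] requires. *)
  rewrite (_ : (fun w => _) = (fun w => (1 - x w) - (y w - x w * y w))); last first.
    by apply/funext => w; ring.
  rewrite (@meanB _ _ _ P (fun w => 1 - x w) (fun w => y w - x w * y w))//; last 2 first.
  - exact: measurable_funB.
  - exact: measurable_funB.
  rewrite mean1B// (@meanB _ _ _ P y (fun w => x w * y w))// !incr_laplace//.
  have -> : mean P (fun w => x w * y w) = E2 n; last by rewrite /E; ring.
  rewrite /E2; case: eqP => [pq|/eqP pq]; last by rewrite incr_laplace2.
  rewrite -(@incr_laplace p)//; last by rewrite mulr_ge0.
  by congr (mean P _); apply/funext => w; rewrite /x /y pq -expRD; congr expR; ring.
rewrite -E3 EFinM -meanE; last 2 first.
- by apply: measurable_funM; apply: measurable_funB.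
- move=> w; have /compl01/andP[? ?] := x01 w; have /compl01/andP[? ?] := y01 w.
  by rewrite mulr_ge0// mulr_ile1.
rewrite -ge0_integralZl//=.
- apply: eq_integral => w _; rewrite -EFinM; congr EFin; rewrite /chord /x /y /step; ring.
- apply/measurable_EFinP; by apply: measurable_funM; apply: measurable_funB.
- move=> w _; rewrite lee_fin; have /compl01/andP[? ?] := x01 w; have /compl01/andP[? ?] := y01 w.
  by rewrite mulr_ge0.
Qed.

End increment_moments.

(** * Riemann sums of exponential kernels *)

Section geometric_riemann_sums.
Context {R : realType}.

(** A Riemann sum of e^(c s) over [0, U], summed exactly as a geometric series with ratio r = e^(c
    mesh); mesh / (r - 1) tends to 1 / c. *)
Lemma riemann_geometric (c U : R) (K : nat -> nat) : c != 0 ->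
  (K m)%:R * mesh m @[m --> \oo] --> U ->
  \sum_(k < K m) mesh m * expR (c * grid m k) @[m --> \oo] --> c^-1 * (expR (c * U) - 1).
Proof.
move=> c0 KU.
have mm := @mesh_gt0 R.
have ec m : expR (c * mesh m) - 1 != 0.
  by rewrite subr_eq0 -expR0 (inj_eq (@expR_inj R)) mulf_neq0 // gt_eqF.
have E m : \sum_(k < K m) mesh m * expR (c * grid m k) =
   ((expR (c * mesh m) - 1) * (mesh m)^-1)^-1 * (expR (c * ((K m)%:R * mesh m)) - 1).
  have -> : expR (c * ((K m)%:R * mesh m)) - 1 =
      (expR (c * mesh m) - 1) * \sum_(k < K m) expR (c * mesh m) ^+ k.
    by rewrite -subrX1 -expRM_natr; congr (expR _ - _); ring.
  have alg (a b x : R) : a != 0 -> b != 0 -> (a / b)^-1 * (a * x) = b * x.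
    by move=> a0 b0; field; rewrite a0 b0.
  have ms : mesh m != 0 :> R by rewrite gt_eqF.
  rewrite alg// mulr_sumr.
  apply: eq_bigr => k _; rewrite -expRM_natr; congr (_ * expR _).
  by rewrite /grid; ring.
under eq_fun do rewrite E.
apply: cvgM.
  apply: cvgV => //; apply: expm1_cvg.
  - by move=> n; rewrite invr_ge0 ltW.
  - by rewrite -[X in _ --> X](mulr0 c); apply: cvgMr; exact: cvg_mesh.
  - under eq_fun => n do rewrite -mulrA mulfV ?gt_eqF// mulr1.
    exact: cvg_cst.
apply: cvgB; last exact: cvg_cst.
by apply: continuous_cvg; [exact: continuous_expR|exact: cvgMr].
Qed.

(** The kernel raised to the power [c]: c = 1 serves the mean and c = 2 the covariance. *)
Definition power_kernel (c u : R) (b : bool) (s : R) : R :=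
  if b then (if s <= u then expR (c * (s - u)) else 0) else expR (c * (- s - u)).

Lemma kernel_power1 u b s : kernel u b s = power_kernel 1 u b s.
Proof. by rewrite /power_kernel !mul1r; case: b. Qed.

(** The cutoff at the earlier time prevails, and e^(s - u) e^(s - v) = e^(-(v - u)) e^(2 (s - u)).
    This factor is the exponential decay of the covariance. *)
Lemma kernel_power2 u v b s : u <= v ->
  kernel u b s * kernel v b s = expR (- (v - u)) * power_kernel 2 u b s.
Proof.
move=> uv; rewrite /power_kernel; case: b => /=; last first.
  by rewrite /hneg -!expRD; congr expR; ring.
rewrite /hpos; case: (leP s u) => su; last by rewrite mul0r mulr0.
by rewrite (le_trans su uv) -!expRD; congr expR; ring.
Qed.

(** The integral of e^(c (s - u)) for s from -n to u. *)
Definition kernel_mass_limit (c u : R) (n : nat) : R := c^-1 * (1 - expR (- (c * (u + n%:R)))).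

Lemma power_kernel_mass_cvg (c u : R) n : 0 < c -> 0 <= u -> u + 1 <= n%:R ->
  \sum_(b : bool) \sum_(k < n * 2 ^ m) mesh m * power_kernel c u b (grid m k) @[m --> \oo] -->
  kernel_mass_limit c u n.
Proof.
move=> c0 u0 un.
have mm m := @mesh_gt0 R m; have m1 m := @mesh_le1 R m.
(* The number of grid points in [0, u]. Its product with the mesh exceeds [u] by at most one cell,
   and [u + 1 <= n] keeps these points inside the horizon. *)
pose K m := (Num.truncn (u / mesh m)).+1.
have gu m k : (grid m k <= u) = (k < K m)%N.
  rewrite /grid -ler_pdivlMr// /K ltnS truncn_ge_nat//.
  by rewrite divr_ge0// ltW.
have Kn m : (K m <= n * 2 ^ m)%N.
  rewrite /K truncn_lt_nat ?divr_ge0 ?(ltW (mm m))//.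
  rewrite ltr_pdivrMr// -/(grid m (n * 2 ^ m)) gridE.
  by apply: lt_le_trans un; rewrite ltrDl.
have KU : (K m)%:R * mesh m @[m --> \oo] --> u.
  apply: (@squeeze_cvgr _ _ _ _ (fun=> u) (fun m => u + mesh m)).
  - near=> m; have um : 0 <= u / mesh m by rewrite divr_ge0 ?(ltW (mm m)).
    have /andP[h1 h2] := truncn_itv um.
    rewrite -ler_pdivrMr// (ltW h2)/= /K -natr1 mulrDl mul1r lerD2r.
    by rewrite -ler_pdivlMr.
  - exact: cvg_cst.
  - by rewrite -[X in _ --> X]addr0; apply: cvgD; [exact: cvg_cst|exact: cvg_mesh].
have E m : \sum_(b : bool) \sum_(k < n * 2 ^ m) mesh m * power_kernel c u b (grid m k) =
   expR (- (c * u)) * (\sum_(k < K m) mesh m * expR (c * grid m k)) +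
   expR (- (c * u)) * (\sum_(k < n * 2 ^ m) mesh m * expR (- c * grid m k)).
  rewrite big_bool /=; congr (_ + _).
    rewrite (big_ord_widen _ (fun k => mesh m * expR (c * grid m k)) (Kn m)) [in RHS]big_mkcond mulr_sumr.
    apply: eq_bigr => k _; rewrite gu; case: ifP => _; last by rewrite !mulr0.
    by rewrite mulrCA -expRD; congr (_ * expR _); ring.
  rewrite mulr_sumr; apply: eq_bigr => k _.
  by rewrite mulrCA -expRD; congr (_ * expR _); ring.
under eq_fun do rewrite E.
have -> : kernel_mass_limit c u n = expR (- (c * u)) * (c^-1 * (expR (c * u) - 1)) +
    expR (- (c * u)) * ((- c)^-1 * (expR (- c * n%:R) - 1)).
  have -> : - c * n%:R = - (c * n%:R) by ring.
  have alg (i x y z : R) : x * y = 1 -> i * (1 - x * z) = x * (i * (y - 1)) + x * (- i * (z - 1)).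
    by move=> xy; rewrite -xy; ring.
  rewrite /kernel_mass_limit invrN -alg; last by rewrite -expRD addNr expR0.
  by rewrite -expRD; congr (_ * (1 - expR _)); ring.
apply: cvgD; apply: cvgMr; first by apply: riemann_geometric => //; rewrite gt_eqF.
apply: (@riemann_geometric _ _ (fun m => (n * 2 ^ m)%N)); first by rewrite oppr_eq0 gt_eqF.
under eq_fun do rewrite -/(grid _ _) gridE.
exact: cvg_cst.
Unshelve. all: by end_near. Qed.

Lemma kernel_mass_limit_cvg (c u : R) : 0 < c ->
  kernel_mass_limit c u n @[n --> \oo] --> c^-1.
Proof.
move=> c0.
have h : expR (- (c * (u + n%:R))) @[n --> \oo] --> (0 : R).
  rewrite (_ : (fun n => _) = (fun n => expR (- (c * u)) * expR (- c) ^+ n)).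
    rewrite -[X in _ --> X](mulr0 (expR (- (c * u)))); apply: cvgMr; apply: cvg_expr.
    by rewrite ger0_norm ?expR_ge0// expR_lt1 oppr_lt0.
  by apply/funext => n; rewrite -expRM_natr -expRD; congr expR; ring.
have h1 : 1 - expR (- (c * (u + n%:R))) @[n --> \oo] --> (1 - 0 : R).
  by apply: cvgB => //; exact: cvg_cst.
rewrite (_ : c^-1 = c^-1 * (1 - 0)); last by rewrite subr0 mulr1.
by apply: cvgMr.
Qed.

Lemma kernel_le1 (u : R) b (s : R) : 0 <= u -> 0 <= s -> kernel u b s <= 1.
Proof.
move=> u0 s0; case: b => /=.
  by rewrite /hpos; case: ifP => // su; rewrite -[leRHS]expR0 ler_expR subr_le0.
by rewrite /hneg -[leRHS]expR0 ler_expR -opprD oppr_le0 addr_ge0.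
Qed.

End geometric_riemann_sums.

(** * First two moments of the stationary solution *)

Section shot_moments.
Context d (T : measurableType d) (R : realType) (P : probability T R).
Variables (L : bool -> T -> R -> R) (nu1 : bool -> T -> R -> nat) (g1 : bool -> T -> nat -> R).
Variables alpha nu : R.
Hypotheses (halpha : 0 < alpha) (hnu : 0 < nu).
Hypotheses (sys : step_system L nu1 g1)
  (lap : laplace_system P L (fun _ => bt_exponent alpha nu)).
Implicit Types h : bool -> R -> R.

Definition mass h n m : R := \sum_(b : bool) \sum_(k < n * 2 ^ m) mesh m * h b (grid m k).

Let incrp m n (p : bool * 'I_(n * 2 ^ m)) w := incr L m (p.1, nat_of_ord p.2) w.

Let shot_gridE h n m w : shot_grid L h n m w =
  \sum_(p : bool * 'I_(n * 2 ^ m)) h p.1 (grid m p.2) * incrp p w.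
Proof. by rewrite /shot_grid /rsum pair_big_dep. Qed.

Let massE h n m : mass h n m = \sum_(p : bool * 'I_(n * 2 ^ m)) mesh m * h p.1 (grid m p.2).
Proof. by rewrite /mass pair_big_dep. Qed.

Let mincrp m n (p : bool * 'I_(n * 2 ^ m)) : measurable_fun setT (incrp p).
Proof. exact: (measurable_incr sys). Qed.

Let incrp0 m n (p : bool * 'I_(n * 2 ^ m)) w : 0 <= incrp p w.
Proof. exact: (incr_ge0 sys). Qed.

Lemma shot_grid_mean h n m : (forall b s, 0 <= h b s) ->
  (\int[P]_w (shot_grid L h n m w)%:E)%E = (bt_mean alpha nu * mass h n m)%:E.
Proof.
move=> h0; under eq_integral do rewrite shot_gridE -sumEFin.
rewrite ge0_integral_sum//; last 2 first.
- by move=> p; apply/measurable_EFinP; exact: measurable_funM.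
- by move=> p w _; rewrite lee_fin mulr_ge0.
rewrite massE mulr_sumr -sumEFin; apply: eq_bigr => p _.
under eq_integral do rewrite EFinM.
rewrite ge0_integralZl//=; last 3 first.
- exact/measurable_EFinP.
- by move=> w _; rewrite lee_fin.
- by rewrite lee_fin.
rewrite (incr_mean sys lap m (p := (p.1, nat_of_ord p.2)) (ltn_ord p.2)) -EFinM.
by congr EFin; rewrite mulrCA; congr (_ * _); rewrite mulrC.
Qed.

(** In the double sum over cells the squared mean occurs for every pair and yields the product of
    the means; the variance occurs on the diagonal only and yields the mass of the product
    kernel. *)
Lemma shot_grid_mean_prod h h' n m : (forall b s, 0 <= h b s) -> (forall b s, 0 <= h' b s) ->
  (\int[P]_w (shot_grid L h n m w * shot_grid L h' n m w)%:E)%E =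
  ((bt_mean alpha nu * mass h n m) * (bt_mean alpha nu * mass h' n m) +
   bt_var alpha nu * mass (fun b s => h b s * h' b s) n m)%:E.
Proof.
move=> h0 h0'.
set A := bt_mean alpha nu; set B := bt_var alpha nu; pose D : R := mesh m.
transitivity (\int[P]_w (\sum_(p : bool * 'I_(n * 2 ^ m)) \sum_(q : bool * 'I_(n * 2 ^ m))
    ((h p.1 (grid m p.2) * h' q.1 (grid m q.2)) * (incrp p w * incrp q w))%:E))%E.
  apply: eq_integral => w _; rewrite !shot_gridE big_distrlr /= -sumEFin.
  apply: eq_bigr => p _; rewrite -sumEFin; apply: eq_bigr => q _.
  by congr EFin; rewrite mulrACA.
have mt (p q : bool * 'I_(n * 2 ^ m)) : measurable_fun setT (fun w => ((h p.1 (grid m p.2) * h' q.1 (grid m q.2)) * (@incrp m n p w * @incrp m n q w))%:E).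
  by apply/measurable_EFinP; apply: measurable_funM => //; exact: measurable_funM.
have pt (p q : bool * 'I_(n * 2 ^ m)) w : (0 <= ((h p.1 (grid m p.2) * h' q.1 (grid m q.2)) * (@incrp m n p w * @incrp m n q w))%:E)%E.
  by rewrite lee_fin !mulr_ge0.
rewrite ge0_integral_sum//; last 2 first.
- by move=> p; apply: emeasurable_sum => q; exact: mt.
- by move=> p w _; apply: sume_ge0 => q _; exact: pt.
transitivity (\sum_(p : bool * 'I_(n * 2 ^ m)) \sum_(q : bool * 'I_(n * 2 ^ m))
   ((h p.1 (grid m p.2) * h' q.1 (grid m q.2)) * ((A * D) ^+ 2 + (if p == q then B * D else 0)))%:E)%E.
  apply: eq_bigr => p _; rewrite ge0_integral_sum//.
  apply: eq_bigr => q _; under eq_integral do rewrite EFinM.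
  rewrite ge0_integralZl//=; last 3 first.
  - by apply/measurable_EFinP; exact: measurable_funM.
  - by move=> w _; rewrite lee_fin mulr_ge0.
  - by rewrite lee_fin mulr_ge0.
  rewrite (incr_mean_prod sys lap m (p := (p.1, nat_of_ord p.2)) (q := (q.1, nat_of_ord q.2)) (ltn_ord p.2) (ltn_ord q.2)).
  by rewrite -EFinM; congr (EFin (_ * (_ + _))); case: p => [a i]; case: q => [b j].
under eq_bigr do rewrite sumEFin.
rewrite sumEFin; congr EFin.
under eq_bigr do under eq_bigr do rewrite mulrDr.
under eq_bigr do rewrite big_split /=.
rewrite big_split /=; congr (_ + _).
  rewrite !massE mulrACA big_distrlr /= mulr_sumr; apply: eq_bigr => p _; rewrite mulr_sumr.
  apply: eq_bigr => q _; rewrite -/D; ring.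
rewrite massE mulr_sumr; apply: eq_bigr => p _.
rewrite (bigD1 p)//= eqxx big1 ?addr0; first by rewrite -/D; ring.
by move=> q qp; rewrite eq_sym (negPf qp) mulr0.
Qed.

(** For kernels at most 1 the sampled sum is at most the total increment up to [n], which telescopes
    to the same value for every mesh. Taken at mesh 1, it dominates all the sampled sums at once. *)
Let shot_grid_le h n m w : (forall b s, 0 <= h b s) -> (forall b s, 0 <= s -> h b s <= 1) ->
  shot_grid L h n m w <= shot_grid L (fun _ _ => 1) n 0 w.
Proof.
move=> h0 h1.
have E m' : shot_grid L (fun _ _ => 1) n m' w = \sum_(b : bool) (L b w n%:R - L b w 0).
  rewrite /shot_grid /rsum; apply: eq_bigr => b _.
  under eq_bigr do rewrite mul1r.
  rewrite -(big_mkord xpredT (fun k => L b w (grid m' k.+1) - L b w (grid m' k))).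
  by rewrite (@telescope_sumr _ _ _ (fun k => L b w (grid m' k)))// gridE grid0.
rewrite E -(E m) !shot_gridE; apply: ler_sum => p _.
by rewrite ler_wpM2r// h1// grid_ge0.
Qed.

Lemma shot_mean h n s : (forall b, left_cts (h b)) -> (forall b s, 0 <= h b s) ->
  (forall b s, 0 <= s -> h b s <= 1) -> mass h n m @[m --> \oo] --> s ->
  (\int[P]_w (shot nu1 g1 h n w)%:E)%E = (bt_mean alpha nu * s)%:E.
Proof.
move=> hl h0 h1 hs.
have l1 := @ae_dominated_cvg _ _ _ P (shot_grid L h n) (shot nu1 g1 h n)
  (shot_grid L (fun _ _ => 1) n 0).
have l2 : (\int[P]_w (shot_grid L h n m w)%:E)%E @[m --> \oo] --> (bt_mean alpha nu * s)%:E.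
  rewrite (_ : (fun m => _) = (fun m => (bt_mean alpha nu * mass h n m)%:E)).
    by apply: cvg_EFin; [near=> m|apply: cvgMr; exact: hs].
  by apply/funext => m; exact: shot_grid_mean.
apply: (cvg_unique _ _ l2) => //; apply: l1.
- by move=> m; exact: (measurable_shot_grid sys.1).
- exact: (measurable_shot sys.1).
- exact: (measurable_shot_grid sys.1).
- by move=> w; apply: (shot_grid_ge0 sys) => *; exact: ler01.
- by rewrite shot_grid_mean ?ltry// => *; exact: ler01.
- by move=> m w; rewrite ger0_norm ?shot_grid_le//; exact: (shot_grid_ge0 sys).
- by apply: aeW => w; exact: (shot_grid_cvg sys.1).
Unshelve. all: by end_near. Qed.

Lemma shot_mean_prod h h' n s s' s2 :
  (forall b, left_cts (h b)) -> (forall b s, 0 <= h b s) -> (forall b s, 0 <= s -> h b s <= 1) ->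
  (forall b, left_cts (h' b)) -> (forall b s, 0 <= h' b s) -> (forall b s, 0 <= s -> h' b s <= 1) ->
  mass h n m @[m --> \oo] --> s -> mass h' n m @[m --> \oo] --> s' ->
  mass (fun b s => h b s * h' b s) n m @[m --> \oo] --> s2 ->
  (\int[P]_w (shot nu1 g1 h n w * shot nu1 g1 h' n w)%:E)%E =
  (bt_mean alpha nu * s * (bt_mean alpha nu * s') + bt_var alpha nu * s2)%:E.
Proof.
move=> hl h0 h1 hl' h0' h1' hs hs' hs2.
pose B := shot_grid L (fun _ _ => 1) n 0.
have B0 w : 0 <= B w by apply: (shot_grid_ge0 sys) => *; exact: ler01.
have l1 := @ae_dominated_cvg _ _ _ P (fun m w => shot_grid L h n m w * shot_grid L h' n m w)
  (fun w => shot nu1 g1 h n w * shot nu1 g1 h' n w) (fun w => B w * B w).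
have l2 : (\int[P]_w (shot_grid L h n m w * shot_grid L h' n m w)%:E)%E @[m --> \oo] -->
   (bt_mean alpha nu * s * (bt_mean alpha nu * s') + bt_var alpha nu * s2)%:E.
  rewrite (_ : (fun m => _) = (fun m => ((bt_mean alpha nu * mass h n m) * (bt_mean alpha nu * mass h' n m) +
   bt_var alpha nu * mass (fun b s => h b s * h' b s) n m)%:E)).
    apply: cvg_EFin; [by near=> m|apply: cvgD; last by apply: cvgMr; exact: hs2].
    by apply: cvgM; apply: cvgMr; [exact: hs|exact: hs'].
  by apply/funext => m; exact: shot_grid_mean_prod.
have mB : measurable_fun setT B by exact: (measurable_shot_grid sys.1).
apply: (cvg_unique _ _ l2) => //; apply: l1.
- by move=> m; apply: measurable_funM; exact: (measurable_shot_grid sys.1).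
- by apply: measurable_funM; exact: (measurable_shot sys.1).
- exact: measurable_funM.
- by move=> w; rewrite mulr_ge0.
- by rewrite shot_grid_mean_prod ?ltry// => *; exact: ler01.
- move=> m w; have p1 := shot_grid_ge0 sys n m w h0; have p2 := shot_grid_ge0 sys n m w h0'.
  by rewrite ger0_norm ?mulr_ge0// ler_pM// shot_grid_le.
- by apply: aeW => w; apply: cvgM; exact: (shot_grid_cvg sys.1).
Unshelve. all: by end_near. Qed.

Let K0 : 0 <= bt_mean alpha nu.
Proof. by rewrite /bt_mean !mulr_ge0 ?expR_ge0// ltW. Qed.

Let kernel_mass_cvg u n : 0 <= u -> u + 1 <= n%:R ->
  mass (kernel u) n m @[m --> \oo] --> kernel_mass_limit 1 u n.
Proof.
move=> u0 un; have := power_kernel_mass_cvg (@ltr01 R) u0 un.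
rewrite (_ : (fun m => \sum_b _) = mass (kernel u) n)//.
apply/funext => m; apply: eq_bigr => b _; apply: eq_bigr => k _.
by rewrite kernel_power1.
Qed.

Let kernel_mass2_cvg u v n : 0 <= u -> u <= v -> u + 1 <= n%:R ->
  mass (fun b s => kernel u b s * kernel v b s) n m @[m --> \oo] -->
  expR (- (v - u)) * kernel_mass_limit 2 u n.
Proof.
move=> u0 uv un; have h := @power_kernel_mass_cvg R 2 u n (ltr0Sn _ _) u0 un.
have {}h := @cvgMr _ _ _ _ _ (expR (- (v - u))) _ h.
rewrite (_ : mass _ n = (fun m => expR (- (v - u)) * \sum_(b : bool) \sum_(k < n * 2 ^ m) mesh m * power_kernel 2 u b (grid m k))); first exact: h.
apply/funext => m; rewrite /mass mulr_sumr; apply: eq_bigr => b _; rewrite mulr_sumr.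
by apply: eq_bigr => k _; rewrite kernel_power2// mulrCA.
Qed.

Let X u := kernel_limit nu1 g1 u.

Let aeX u : 0 <= u ->
  \forall w \ae P, shot nu1 g1 (kernel u) n w @[n --> \oo] --> X u w.
Proof.
move=> u0; have [] := kernel_limit_ae sys lap (kappa := bt_mean alpha nu) _ K0 u0 => //.
by move=> b x _; exact: bt_exponent_le.
Qed.

Let startP (u v : R) n : 0 <= v -> u <= v -> u + 1 <= (n + (Num.truncn (v + 1)).+1)%:R.
Proof.
move=> v0 uv; have v1 : 0 <= v + 1 by rewrite addr_ge0.
have /andP[_ h] := truncn_itv v1.
apply: (@le_trans _ _ (v + 1)); first by rewrite lerD2r.
by apply: (le_trans (ltW h)); rewrite ler_nat leq_addl.
Qed.

Lemma kernel_limit_mean u : 0 <= u -> (\int[P]_w (X u w)%:E)%E = (bt_mean alpha nu)%:E.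
Proof.
(* Shifting the horizon by [n0] ensures [u + 1 <= n] from the start, so that the mean is known for
   every term of the monotone sequence. *)
move=> u0; set n0 := (Num.truncn (u + 1)).+1.
apply: (@monotone_cvg _ _ _ P (fun n => shot nu1 g1 (kernel u) (n + n0)) (X u)
  (fun n => bt_mean alpha nu * kernel_mass_limit 1 u (n + n0))).
- by move=> n; apply: (measurable_shot sys.1) => b; exact: kernel_left_cts.
- exact: (measurable_kernel_limit sys).
- by move=> n w; apply: (shot_ge0 sys) => b s; exact: kernel_ge0.
- move=> w n m nm; apply: (shot_nondecreasing sys); last by rewrite leq_add2r.
  by move=> b s; exact: kernel_ge0.
- by apply: filterS (aeX u0) => w h; rewrite (cvg_shiftn n0 (fun n => shot nu1 g1 (kernel u) n w)).
- exact: (kernel_limit_ge0 sys).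
- move=> n; apply: shot_mean.
  + by move=> b; exact: kernel_left_cts.
  + by move=> b s; exact: kernel_ge0.
  + by move=> b s; exact: kernel_le1.
  + by apply: kernel_mass_cvg => //; exact: startP.
- rewrite (cvg_shiftn n0 (fun n => bt_mean alpha nu * kernel_mass_limit 1 u n)).
  have h : bt_mean alpha nu * kernel_mass_limit 1 u n @[n --> \oo] --> bt_mean alpha nu * 1^-1.
    by apply: cvgMr; exact: kernel_mass_limit_cvg.
  by rewrite invr1 mulr1 in h.
Qed.

(** As the horizon grows the kernel masses tend to 1 for c = 1 and to 1/2 for c = 2; the latter is
    the factor 1/2 of the covariance. *)
Lemma kernel_limit_mean_prod u v : 0 <= u -> u <= v ->
  (\int[P]_w (X u w * X v w)%:E)%E =
  (bt_mean alpha nu ^+ 2 + bt_var alpha nu / 2 * expR (- (v - u)))%:E.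
Proof.
move=> u0 uv; have v0 := le_trans u0 uv; set n0 := (Num.truncn (v + 1)).+1.
pose V n w := shot nu1 g1 (kernel u) n w * shot nu1 g1 (kernel v) n w.
pose l n := bt_mean alpha nu * kernel_mass_limit 1 u n * (bt_mean alpha nu * kernel_mass_limit 1 v n) +
  bt_var alpha nu * (expR (- (v - u)) * kernel_mass_limit 2 u n).
have k0 z b s : 0 <= kernel z b s :> R by exact: kernel_ge0.
have S0 z n w := shot_ge0 sys n w (k0 z).
apply: (@monotone_cvg _ _ _ P (fun n => V (n + n0)%N) (fun w => X u w * X v w)
  (fun n => l (n + n0)%N)).
- by move=> n; apply: measurable_funM; apply: (measurable_shot sys.1) => b; exact: kernel_left_cts.
- by apply: measurable_funM; exact: (measurable_kernel_limit sys).
- by move=> n w; rewrite mulr_ge0.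
- move=> w n m nm; rewrite /V ler_pM//; apply: (shot_nondecreasing sys) => //;
    by rewrite leq_add2r.
- apply: filterS2 (aeX u0) (aeX v0) => w h h'.
  by rewrite (cvg_shiftn n0 (fun n => V n w)); exact: cvgM.
- by move=> w; rewrite mulr_ge0//; exact: (kernel_limit_ge0 sys).
- move=> n; apply: shot_mean_prod => //.
  + by move=> b; exact: kernel_left_cts.
  + by move=> b s; exact: kernel_le1.
  + by move=> b; exact: kernel_left_cts.
  + by move=> b s; exact: kernel_le1.
  + by apply: kernel_mass_cvg => //; exact: startP.
  + by apply: kernel_mass_cvg => //; exact: startP.
  + by apply: kernel_mass2_cvg => //; exact: startP.
- rewrite (cvg_shiftn n0 l).
  have -> : bt_mean alpha nu ^+ 2 + bt_var alpha nu / 2 * expR (- (v - u)) =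
    bt_mean alpha nu * 1^-1 * (bt_mean alpha nu * 1^-1) + bt_var alpha nu * (expR (- (v - u)) * 2^-1).
    by rewrite invr1; ring.
  apply: cvgD; first by apply: cvgM; apply: cvgMr; exact: kernel_mass_limit_cvg.
  by apply: cvgMr; apply: cvgMr; exact: kernel_mass_limit_cvg.
Qed.

End shot_moments.

Lemma ae_nonneg_expectation d (T : measurableType d) (R : realType) (P : probability T R)
    (X X' : T -> R) (l : R) :
  measurable_fun setT X -> measurable_fun setT X' -> (forall w, 0 <= X' w) ->
  (\forall w \ae P, X w = X' w) -> (\int[P]_w (X' w)%:E)%E = l%:E ->
  X \in Lfun P 1 /\ ('E_P[X] = l%:E)%E.
Proof.
move=> mX mX' X'0 XX' Xl; split.
  apply/Lfun1_integrable; apply/integrableP; split; first exact/measurable_EFinP.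
  rewrite (_ : (\int[P]_w _)%E = l%:E) ?ltry// -Xl; apply: ae_eq_integral => //.
  - by apply: measurableT_comp => //; exact/measurable_EFinP.
  - exact/measurable_EFinP.
  - by apply: filterS XX' => w e _; rewrite /= e ger0_norm.
rewrite unlock -Xl; apply: ae_eq_integral => //.
- exact/measurable_EFinP.
- exact/measurable_EFinP.
- by apply: filterS XX' => w e _; rewrite e.
Qed.

Unset Implicit Arguments.

Theorem mainTheorem9 (R : realType) (alpha nu lam : R)
  (halpha : 0 < alpha) (hnu : 0 < nu) (hlam : 0 < lam)
  (d : measure_display) (T : measurableType d) (P : probability T R)
  (N : bool -> T -> R -> R) (Y : bool -> nat -> T -> R)
  (hN : forall b, poisson_process P (alpha * (expR nu - 1)) (N b))
  (hYm : forall b i, measurable_fun setT (Y b i))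
  (hYlaw : forall b i (n : nat), (0 < n)%N ->
     P (Y b i @^-1` [set n%:R]) = ((expR nu - 1)^-1 * nu ^+ n / n`!%:R)%:E)
  (hind : mutual_indep P (fun c : bool + (bool * nat) =>
     match c with
     | inl b => sigma_gen (fun t : R => N b ^~ t)
     | inr bi => sigma_gen (fun _ : unit => Y bi.1 bi.2)
     end)) :
  (forall (d' : measure_display) (T' : measurableType d') (P' : probability T' R)
     (M : nat -> bool -> T' -> R -> R),
     (forall j b, poisson_process P' (alpha * nu ^+ j.+1 / j.+1`!%:R) (M j b)) ->
     mutual_indep P' (fun jb : nat * bool => sigma_gen (fun t : R => M jb.1 jb.2 ^~ t)) ->
     fdd_eq P P' (XBT lam N Y)
       (fun t w => limn (fun n : nat =>
          \sum_(j < n) DOU lam (j.+1)%:R (M j) t w)))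
  /\ (forall t, 0 <= t -> ('E_P[XBT lam N Y t] = (alpha * nu * expR nu)%:E)%E)
  /\ (forall t tau, 0 <= t -> 0 <= tau ->
        covariance P (XBT lam N Y t) (XBT lam N Y (t + tau))
        = (alpha * expR nu / 2 * (nu * (nu + 1)) * expR (- (lam * tau)))%:E).
Proof.
split.
  by move=> d' T' P' M; exact: (XBT_fdd halpha hnu hlam hN hYm hYlaw hind).
have sys := bt_step_system hN hYm.
have lap := bt_laplace_system hnu hN hYm hYlaw hind.
have ae := XBT_ae hnu hlam hN hYm hYlaw.
have mX t : 0 <= t -> measurable_fun setT (XBT lam N Y t).
  exact: (measurable_XBT hlam hN hYm).
pose K t := kernel_limit (fun b => count (N b))
  (fun b w k => \sum_(i < k) `|Y b i w|) (lam * t).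
have mK t : measurable_fun setT (K t) by exact: (measurable_kernel_limit sys).
have K0 t w : 0 <= K t w by exact: (kernel_limit_ge0 sys).
have lt0 t : 0 <= t -> 0 <= lam * t by move=> t0; rewrite mulr_ge0// ltW.
have mean1 t : 0 <= t -> XBT lam N Y t \in Lfun P 1 /\
    ('E_P[XBT lam N Y t] = (bt_mean alpha nu)%:E)%E.
  move=> t0; apply: (@ae_nonneg_expectation _ _ _ _ _ (K t)) => //.
  - exact: mX.
  - by apply: filterS ae => w; exact.
  - exact: (kernel_limit_mean halpha hnu sys lap (lt0 _ t0)).
split; first by move=> t t0; have [_ ->] := mean1 t t0.
move=> t tau t0 tau0; have tt0 : 0 <= t + tau by rewrite addr_ge0.
have [l1 e1] := mean1 _ t0; have [l2 e2] := mean1 _ tt0.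
have [l3 e3] : (XBT lam N Y t * XBT lam N Y (t + tau))%R \in Lfun P 1 /\
    ('E_P[XBT lam N Y t * XBT lam N Y (t + tau)] =
     (bt_mean alpha nu ^+ 2 + bt_var alpha nu / 2 * expR (- (lam * (t + tau) - lam * t)))%:E)%E.
  apply: (@ae_nonneg_expectation _ _ _ _ _ (fun w => K t w * K (t + tau) w)).
  - by apply: measurable_funM; exact: mX.
  - exact: measurable_funM.
  - by move=> w; rewrite mulr_ge0.
  - apply: filterS ae => w h.
    by transitivity (XBT lam N Y t w * XBT lam N Y (t + tau) w) => //; rewrite !h.
  - apply: (kernel_limit_mean_prod halpha hnu sys lap (lt0 _ t0)).
    by rewrite ler_wpM2l ?(ltW hlam)// lerDl.
rewrite (covarianceE l1 l2 l3) e1 e2 e3 -EFinM -EFinB; congr EFin.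
have -> : lam * (t + tau) - lam * t = lam * tau by ring.
by rewrite /bt_var; ring.
Qed.
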